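(* Let $n>1$ and let $\gamma$ be a Lie series in $\mathcal{D}$ such that $\gamma_m\in\mathcal{P}_m$ for all odd $m$. For each partition $p$ of $n$ put $\Lambda^p:=\mathcal{D}_n\gamma_p$ and $M^p:=\Lambda^p/\mathsf{Rad}_{\mathcal{D}_n}\Lambda^p$, and put $M^0:=M^{2.1^{.(n-2)}}$. Then the modules $M^p$, $p$ an odd partition of $n$, together with $M^0$, represent the isomorphism classes of irreducible $\mathcal{P}_n$-modules. Furthermore, $M^0\cong M^q$ (as $\mathcal{P}_n$-left modules) for all partitions $q$ of $n$ containing an even part.
   Context: $K$ is a field of characteristic $0$. Permutations act on the right ($i\pi$ is the image of $i$) and products in $S_n$ are read from left to right. For $\pi\in S_n$: $\mathrm{Des}(\pi)=\{1\le i\le n-1\mid i\pi>(i+1)\pi\}$, $\mathrm{Peak}(\pi)=\{2\le i\le n-1\mid (i-1)\pi<i\pi>(i+1)\pi\}$. For $D\subseteq\{1,\ldots,n-1\}$ let $\Delta^D=\sum_{\mathrm{Des}(\pi)=D}\pi$ and $\Xi^D=\sum_{E\subseteq D}\Delta^E$; $\mathcal{D}_n$ is the span of the $\Delta^D$ (a subalgebra of $KS_n$), $\mathcal{D}=\bigoplus_{n\ge0}\mathcal{D}_n$. For a word $q=q_1.\cdots.q_k$ of positive integers with sum $n$: $D(q)=\{q_1,q_1+q_2,\ldots,q_1+\cdots+q_{k-1}\}$, $\Delta^q=\Delta^{D(q)}$, $\Xi^q=\Xi^{D(q)}$. The outer product on $\mathcal{D}$ is $\Xi^r\star\Xi^q=\Xi^{r.q}$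 (concatenation). $\mathcal{P}_n\subseteq\mathcal{D}_n$ is the span of the elements $\sum_{\mathrm{Peak}(\pi)=P}\pi$, $P\subseteq\{2,\ldots,n-1\}$; it is a left ideal of $\mathcal{D}_n$, hence an algebra, without identity in general, so the action on a $\mathcal{P}_n$-module may be zero. A module is irreducible if it is nonzero and has no submodules other than $0$ and itself (so one-dimensional modules with zero action are irreducible). Let $\omega_n=\sum_{k=0}^{n-1}(-1)^k\Delta^{1^{.k}.(n-k)}$, where $1^{.k}$ is the word of $k$ letters $1$. An idempotent $\alpha\in KS_n$ is a Lie idempotent if $\alpha KS_n=\omega_nKS_n$. A Lie series in $\mathcal{D}$ is a map $\gamma:\mathbb{N}\to\mathcal{D}$, $m\mapsto\gamma_m\in\mathcal{D}_m$, such that $\frac1m\gamma_m$ is a Lie idempotent for all $m\in\mathbb{N}$; for $q=q_1.\cdots.q_k$, $\gamma_q=\gamma_{q_1}\star\cdots\star\gamma_{q_k}$. A partition of $n$ is a weakly decreasing word of positive integers with sum $n$; it is odd if all parts are odd. $\mathsf{Rad}_AM$ is the intersection of all maximal $A$-submodules of $M$. (It is known that each $M^p$ is a one-dimensional irreducible $\mathcal{D}_n$-module; it is regarded as a $\mathcal{P}_n$-module by restriction.) *)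

(* Defs.v *)
From HB Require Import structures.
From mathcomp Require Import all_boot all_order all_algebra all_fingroup all_field.
From mathcomp Require Import generic_quotient ring_quotient.
From mathcomp Require Import boolp classical_sets.

Set Implicit Arguments.
Unset Strict Implicit.
Unset Printing Implicit Defensive.

Import GRing.Theory.
Local Open Scope ring_scope.
Local Open Scope quotient_scope.

(* Modules over a multiplicatively closed subspace A of an algebra F, where A *)
(* need not contain the identity of F.  The operator of a premodule is total  *)
(* on F, but only its values on A enter the predicates below, so that passing *)
(* to a smaller A is restriction of modules.                                  *)

Record premodule (K : fieldType) (F : falgType K) := Premodule {
  carrier :> lmodType K;
  act : F -> carrier -> carrier
}.

Section Modules.

Variables (K : fieldType) (F : falgType K).
Implicit Types (A : {vspace F}) (M N : premodule F).

Record is_module A M : Prop := IsModule {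
  act_linearl : forall (c : K) (a b : F) (x : M), a \in A -> b \in A ->
    act (c *: a + b) x = c *: act a x + act b x;
  act_linearr : forall (c : K) (a : F) (x y : M), a \in A ->
    act a (c *: x + y) = c *: act a x + act a y;
  actM : forall (a b : F) (x : M), a \in A -> b \in A ->
    act (a * b) x = act a (act b x)
}.

Record is_submodule A M (U : set M) : Prop := IsSubmodule {
  submodule0 : U 0;
  submoduleZD : forall (c : K) (x y : M), U x -> U y -> U (c *: x + y);
  submodule_act : forall (a : F) (x : M), a \in A -> U x -> U (act a x)
}.

Definition irreducible_module A M : Prop :=
  [/\ is_module A M, exists x : M, x != 0
    & forall U : set M, is_submodule A U -> U = [set 0]%classic \/ U = setT].

Definition is_maximal_submodule A M (U : set M) : Prop :=
  [/\ is_submodule A U, U <> setT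
    & forall W : set M, is_submodule A W -> (U `<=` W)%classic ->
        W = U \/ W = setT].

Definition module_iso A M N : Prop :=
  exists f : {linear M -> N}, bijective f /\
    forall (a : F) (x : M), a \in A -> f (act a x) = act a (f x).

Definition radical A M : {pred M} :=
  [pred x | `[< forall U : set M, is_maximal_submodule A U -> U x >]].

Arguments radical : clear implicits.

Fact radicalP A M (x : M) :
  reflect (forall U : set M, is_maximal_submodule A U -> U x)
          (x \in radical A M).
Proof. exact: asboolP. Qed.

Fact radical_linear A M (c : K) (x y : M) :
  x \in radical A M -> y \in radical A M -> c *: x + y \in radical A M.
Proof.
move=> /radicalP xR /radicalP yR; apply/radicalP => U maxU.
by have [subU _ _] := maxU; apply: (submoduleZD subU); [apply: xR | apply: yR].
Qed.

Fact radical0 A M : 0 \in radical A M.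
Proof. by apply/radicalP => U [subU _ _]; apply: submodule0 subU. Qed.

Fact radical_zmod_closed A M : zmod_closed (radical A M).
Proof.
split=> [|x y xR yR]; first exact: radical0.
by rewrite addrC -scaleN1r; apply: radical_linear.
Qed.

HB.instance Definition _ A M :=
  GRing.isZmodClosed.Build M (radical A M) (radical_zmod_closed A M).

Definition top_space A M := {ideal_quot (radical A M)}.

Section TopSpace.

Variables (A : {vspace F}) (M : premodule F).
Local Notation Q := (top_space A M).

HB.instance Definition _ := ZmodQuotient.on Q.

Definition top_scale (c : K) : Q -> Q := lift_op1 Q ( *:%R c).

Fact pi_top_scale (c : K) : {morph \pi_Q : x / c *: x >-> top_scale c x}.
Proof.
move=> x; unlock top_scale; apply/eqP.
rewrite /= -[_ == _]Quotient.idealrBE -scalerBr -[X in X \in _]addr0.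
apply: radical_linear (radical0 _ _); rewrite Quotient.idealrBE reprK.
exact: eqxx.
Qed.

Fact top_scaleA (a b : K) (x : Q) :
  top_scale a (top_scale b x) = top_scale (a * b) x.
Proof. by elim/quotW: x => x; rewrite -!pi_top_scale scalerA. Qed.

Fact top_scale1 : left_id 1 top_scale.
Proof. by elim/quotW=> x; rewrite -pi_top_scale scale1r. Qed.

Fact top_scaleDr : right_distributive top_scale +%R.
Proof.
move=> c; elim/quotW=> x; elim/quotW=> y.
by rewrite -[_ + _]raddfD -!pi_top_scale scalerDr [LHS]raddfD.
Qed.

Fact top_scaleDl (x : Q) : {morph top_scale^~ x : a b / a + b}.
Proof.
by move=> a b; elim/quotW: x => x; rewrite -!pi_top_scale scalerDl [LHS]raddfD.
Qed.

HB.instance Definition _ := GRing.Zmodule_isLmodule.Build K Q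
  top_scaleA top_scale1 top_scaleDr top_scaleDl.

(* The quotient M / Rad_A M.  The operator is defined through canonical       *)
(* representatives; when M is an A-module the class of act a x does not       *)
(* depend on the representative, for a in A.                                  *)
Definition top_module : premodule F :=
  @Premodule K F Q (fun a x => \pi_Q (act a (repr x : M))).

End TopSpace.

(* The left ideal L as a module under left multiplication.  The projection    *)
(* onto L is the identity on a * x whenever L is stable under a.              *)
Definition left_ideal_module (L : {vspace F}) : premodule F :=
  @Premodule K F (subvs_of L) (fun a x => vsproj L (a * vsval x)).

End Modules.

Arguments radical {K F} A M.

(* The group algebra of the symmetric group.  In perm.v permutations act on   *)
(* the right: s * t is s followed by t.                                       *)

Definition symalg (K : fieldType) (n : nat) : Type := {ffun 'S_n -> K^o}.

Section SymmetricGroupAlgebra.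

Variables (K : fieldType) (n : nat).
Local Notation KS := (symalg K n).

HB.instance Definition _ := Vector.copy KS {ffun 'S_n -> K^o}.

Definition symalg_one : KS := [ffun s => (s == 1%g)%:R].

Definition symalg_mul (a b : KS) : KS :=
  [ffun s => \sum_(t : 'S_n) (a t : K) * b (t^-1 * s)%g].

Fact symalg_mulA : associative symalg_mul.
Proof.
move=> a b c; apply/ffunP=> s; rewrite !ffunE.
under eq_bigr => t _ do rewrite ffunE big_distrr /=.
under [RHS]eq_bigr => t _ do rewrite ffunE big_distrl /=.
rewrite [RHS]exchange_big /=; apply: eq_bigr => t _.
rewrite [RHS](reindex_inj (mulgI t)) /=; apply: eq_bigr => u _.
by rewrite mulrA mulKg invMg mulgA.
Qed.

Fact symalg_mul1l : left_id symalg_one symalg_mul.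
Proof.
move=> a; apply/ffunP=> s; rewrite ffunE (bigD1 1%g) //= ffunE eqxx mul1r.
rewrite invg1 mul1g big1 ?addr0 // => t /negPf t_neq1.
by rewrite ffunE t_neq1 mul0r.
Qed.

Fact symalg_mul1r : right_id symalg_one symalg_mul.
Proof.
move=> a; apply/ffunP=> s; rewrite ffunE (bigD1 s) //= ffunE mulVg eqxx mulr1.
rewrite big1 ?addr0 // => t /negPf t_neq_s.
by rewrite ffunE -eq_mulVg1 t_neq_s mulr0.
Qed.

Fact symalg_mulDl : left_distributive symalg_mul +%R.
Proof.
move=> a b c; apply/ffunP=> s; rewrite !ffunE -big_split /=.
by apply: eq_bigr => t _; rewrite ffunE mulrDl.
Qed.

Fact symalg_mulDr : right_distributive symalg_mul +%R.
Proof.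
move=> a b c; apply/ffunP=> s; rewrite !ffunE -big_split /=.
by apply: eq_bigr => t _; rewrite ffunE mulrDr.
Qed.

Fact symalg_one_neq0 : symalg_one != 0.
Proof. by apply/eqP=> /ffunP/(_ 1%g)/eqP; rewrite !ffunE eqxx oner_eq0. Qed.

HB.instance Definition _ := GRing.Zmodule_isNzRing.Build KS
  symalg_mulA symalg_mul1l symalg_mul1r symalg_mulDl symalg_mulDr
  symalg_one_neq0.

Fact symalg_scaleAl (c : K) (a b : KS) : c *: (a * b) = (c *: a) * b.
Proof.
apply/ffunP=> s; rewrite !ffunE scaler_sumr; apply: eq_bigr => t _.
by rewrite ffunE -mulrA.
Qed.

HB.instance Definition _ := GRing.Lmodule_isLalgebra.Build K KS symalg_scaleAl.

Fact symalg_scaleAr (c : K) (a b : KS) : c *: (a * b) = a * (c *: b).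
Proof.
apply/ffunP=> s; rewrite !ffunE scaler_sumr; apply: eq_bigr => t _.
by rewrite ffunE mulrCA.
Qed.

HB.instance Definition _ := GRing.Lalgebra_isAlgebra.Build K KS symalg_scaleAr.

HB.instance Definition _ := Algebra_isFalgebra.Build K KS.

End SymmetricGroupAlgebra.

(* The letters 1, ..., n on which S_n acts are the ordinals 0, ..., n.-1,     *)
(* shifted by one.  Sets of positions are not shifted: the position i is the  *)
(* ordinal of value i, hence is preceded by the letter i.-1 and occupied by   *)
(* the letters (ordinals) i.-1 and i; position 0 is never a descent.          *)

Definition descents n (s : 'S_n) : {set 'I_n} :=
  [set i : 'I_n | [exists h : 'I_n, (h.+1 == i) && (s i < s h)%N]].

Definition peaks n (s : 'S_n) : {set 'I_n} :=
  [set i : 'I_n | [exists g : 'I_n, exists h : 'I_n,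
    [&& g.+1 == h, h.+1 == i, (s g < s h)%N & (s i < s h)%N]]].

(* D(q); the last partial sum n is dropped, as it is not an ordinal below n.  *)
Definition word_set n (q : seq nat) : {set 'I_n} :=
  [set i : 'I_n | (i : nat) \in scanl addn 0%N q].

Fixpoint compositions (n : nat) : seq (seq nat) :=
  if n is n'.+1 then
    [seq 1%N :: c | c <- compositions n'] ++
    [seq (head 0%N c).+1 :: behead c | c <- compositions n' & c != [::]]
  else [:: [::]].

Fact mem_compositions n (c : seq nat) :
  (c \in compositions n) = (0%N \notin c) && (sumn c == n).
Proof.
elim: n c => [|n IHn] c /=.
  rewrite inE; case: c => //= k c; rewrite inE negb_or eq_sym.
  by case: k => //= k; rewrite andbF.
rewrite mem_cat; apply/orP/idP => [[] /mapP[d] | ].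
- by rewrite IHn => /andP[d0 /eqP <-] ->; rewrite inE /= d0 add1n eqxx.
- rewrite mem_filter IHn; case: d => //= k d /andP[] + /eqP <- ->.
  by rewrite !inE !negb_or => /andP[_ ->]; rewrite /= addSn eqxx.
case: c => [|[|[|k]] c] //; rewrite inE negb_or /=.
  by move=> /andP[c0]; rewrite add1n eqSS => cn; left; rewrite map_f ?IHn ?c0.
move=> /andP[c0]; rewrite addSn eqSS => cn; right; apply/mapP.
by exists (k.+1 :: c); rewrite // mem_filter IHn /= inE negb_or c0.
Qed.

Fact compositions_uniq n : uniq (compositions n).
Proof.
elim: n => //= n IHn; rewrite cat_uniq map_inj_uniq ?IHn /=; last by move=> ? ? [].
apply/andP; split.
  apply/hasPn => _ /mapP[c + ->]; rewrite mem_filter mem_compositions.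
  case: c => //= k c; rewrite inE negb_or => /andP[/andP[k0 _] _].
  by apply/mapP => -[d _ [k0']]; rewrite k0' eqxx in k0.
rewrite map_inj_in_uniq ?filter_uniq // => c d.
by rewrite !mem_filter; case: c => // k c; case: d => // l d _ _ /= [-> ->].
Qed.

Section Descents.

Variables (K : fieldType) (n : nat).
Local Notation KS := (symalg K n).

Definition Delta (D : {set 'I_n}) : KS := [ffun s => (descents s == D)%:R].

Definition Xi (D : {set 'I_n}) : KS := \sum_(E : {set 'I_n} | E \subset D) Delta E.

Definition descent_algebra : {vspace KS} :=
  <<[seq Delta D | D : {set 'I_n}]>>%VS.

Definition peak_algebra : {vspace KS} :=
  <<[seq ([ffun s => (peaks s == P)%:R] : KS) | P : {set 'I_n}]>>%VS.

(* The elements Xi^q, q ranging over the compositions of n, form a basis of   *)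
(* the descent algebra.                                                       *)
Definition Xi_basis : (size (compositions n)).-tuple KS :=
  map_tuple (fun c => Xi (word_set n c)) (in_tuple (compositions n)).

Definition omega : KS :=
  \sum_(k < n) (-1) ^+ k *: Delta (word_set n (rcons (nseq k 1%N) (n - k)%N)).

Definition lie_idempotent (a : KS) : Prop :=
  a * a = a /\ (range ( *%R a) = range ( *%R omega))%classic.

End Descents.

(* The bilinear map such that Xi^r * Xi^q = Xi^(r.q), on the descent algebras. *)
Definition outer_product K m n (a : symalg K m) (b : symalg K n) :
    symalg K (m + n) :=
  \sum_(i < size (compositions m)) \sum_(j < size (compositions n))
    (coord (Xi_basis K m) i a * coord (Xi_basis K n) j b) *:
      Xi K (word_set (m + n)
             (nth [::] (compositions m) i ++ nth [::] (compositions n) j)).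

(* The empty product is Xi of the empty word, the identity of K S_0.          *)
Fixpoint word_product K (g : forall m, symalg K m) (q : seq nat) :
    symalg K (sumn q) :=
  if q is m :: q' then outer_product (g m) (word_product g q') else 1.

(* The value at 0 plays no role: degrees of Lie series start at 1.            *)
Definition lie_series K (g : forall m, symalg K m) : Prop :=
  forall m, (0 < m)%N ->
    g m \in descent_algebra K m /\ lie_idempotent (m%:R^-1 *: g m).

Definition is_intpart n (p : seq nat) : bool :=
  [&& sorted geq p, 0%N \notin p & sumn p == n].

Record intpart n := IntPart {
  parts :> seq nat;
  partsP : is_intpart n parts
}.

HB.instance Definition _ n := [isSub for @parts n].
HB.instance Definition _ n := [Equality of intpart n by <:].

Definition odd_intpart n (p : intpart n) : bool := all odd p.

Fact sumn_intpart n (p : intpart n) : sumn p = n.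
Proof. by case: p => p /= /and3P[_ _ /eqP]. Qed.

Fact intpart21_subproof n : (1 < n)%N -> is_intpart n (2 :: nseq (n - 2) 1)%N.
Proof.
move=> n_gt1; apply/and3P; split.
- by case: (n - 2)%N => //= k; elim: k.
- by rewrite inE mem_nseq andbF.
- by rewrite /= sumn_nseq mul1n subnKC.
Qed.

Definition intpart21 n (n_gt1 : (1 < n)%N) : intpart n :=
  IntPart (intpart21_subproof n_gt1).

Section LieSeriesModules.

Variables (K : fieldType) (g : forall m, symalg K m) (n : nat) (p : intpart n).

Definition partition_product : symalg K n :=
  ecast k (symalg K k) (sumn_intpart p) (word_product g p).

Definition Lambda : {vspace symalg K n} :=
  (descent_algebra K n * <[partition_product]>)%VS.

Definition Mtop : premodule (symalg K n) :=
  top_module (descent_algebra K n) (left_ideal_module Lambda).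

End LieSeriesModules.

(* Main.v *)
(** Let the group algebra act on words by rearranging places.  The sum Xi^q of
    the permutations with descents in D(q) then unshuffles a word into pieces
    of lengths q_1, ..., q_k and concatenates them, the outer product is the
    convolution for the unshuffle coproduct, and the members gamma_m of a Lie
    series, lying in omega_m K S_m with omega_m Dynkin's, are primitive.  Pushing
    coproducts through convolutions shows that

    - Xi^q Xi^r is a multiple of Xi^q plus terms Xi^s with s longer than q;
      the coefficient is a character chi_q of the descent algebra D_n, and
      products of sufficiently many elements killed by all chi_q vanish;
    - Xi^q gamma_p = 0 if q is longer than p, and Xi^p gamma_p is a nonzero
      multiple of gamma_p.  So {x | Xi^p x = 0} is the largest proper submodule
      of D_n gamma_p, and M^p is one-dimensional with character chi_p.

    The sum of all permutations without peaks generates P_n as a left ideal of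
    D_n: multiplying by Xi^q produces the sum of the permutations without peaks
    inside the blocks of q, and these sums are triangular in the peak classes.
    Twice this generator has chi_p-value prod_i (1 + (-1)^(p_i - 1)), as one
    sees by letting it act on omega.  Hence chi_p vanishes on P_n iff p has an
    even part.  Finally, on an irreducible P_n-module some ideal ker chi_q of P_n
    acts by zero, since the product of all these ideals is nilpotent; so P_n
    acts by scalars through chi_q, or by zero. *)

From HB Require Import structures.
Require Import Defs.
From mathcomp Require Import all_boot all_order all_algebra all_field fingroup perm.
From mathcomp Require Import zify ring.

Set Implicit Arguments.
Unset Strict Implicit.
Unset Printing Implicit Defensive.

Import GRing.Theory.
Local Open Scope ring_scope.

(** * Unshuffles *)

(** Products of permutations are never expanded. An element a of the group algebra is replaced by
    the functional f -> sum of a(s) f(x s), where x is a plain list and f a test function on lists.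
    No tensor algebra is needed, and nothing is lost: on a word with distinct letters the functional
    determines a. What matters is how a family of operators interacts with unshuffling. Two patterns
    occur: divided (the sum over b of G_b tensor G_(a-b)) for the Xi^q and the permutations without
    peaks, and primitive for Dynkin's omega and a Lie series. Either one turns a product with Xi^q
    into a finite list of words, and vanishing and triangularity are read off from the lengths of
    these words. As P_n need not have an identity, an irreducible module may have zero action. That
    module belongs to all partitions with an even part at once; 2.1^(n-2) is one of them and exists
    because n > 1. Characteristic 0 enters through the invertibility of 2, of the parts of p, and of
    the multiplicity in Xi^p gamma_p. *)

Fixpoint unshuffles (T : Type) (x : seq T) : seq (seq T * seq T) :=
  if x is a :: x' then
    [seq (a :: p.1, p.2) | p <- unshuffles x'] ++
    [seq (p.1, a :: p.2) | p <- unshuffles x']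
  else [:: ([::], [::])].

Lemma unsh_perm (T : eqType) (x : seq T) p :
  p \in unshuffles x -> perm_eq (p.1 ++ p.2) x.
Proof.
elim: x p => [|a x IHx] p /=; first by rewrite inE => /eqP->.
rewrite mem_cat => /orP[] /mapP[r /IHx rx ->] /=; first by rewrite perm_cons.
by rewrite -cat_rcons -cats1 -catA -cat1s (perm_catCA _ [:: a]) /= perm_cons.
Qed.

Lemma unsh_size (T : eqType) (x : seq T) p :
  p \in unshuffles x -> (size p.1 + size p.2)%N = size x.
Proof. by move/unsh_perm/perm_size; rewrite size_cat. Qed.

Section UnshuffleSums.

Variable V : nmodType.

(** Counit law of the unshuffle coproduct: exactly one unshuffle sends every letter to the right. *)
Lemma unsh_nill (T : eqType) (x : seq T) (F : seq T -> seq T -> V) :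
  \sum_(p <- unshuffles x | p.1 == [::]) F p.1 p.2 = F [::] x.
Proof.
elim: x F => [|a x IHx] F /=; first by rewrite big_mkcond big_seq1.
by rewrite big_cat !big_map /= big_pred0 // add0r (IHx (fun y z => F y (a :: z))).
Qed.

Lemma unsh_nilr (T : eqType) (x : seq T) (F : seq T -> seq T -> V) :
  \sum_(p <- unshuffles x | p.2 == [::]) F p.1 p.2 = F x [::].
Proof.
elim: x F => [|a x IHx] F /=; first by rewrite big_mkcond big_seq1.
rewrite big_cat !big_map /= [X in _ + X]big_pred0 // addr0.
exact: (IHx (fun y z => F (a :: y) z)).
Qed.

Lemma unsh_swap (T : Type) (x : seq T) (F : seq T -> seq T -> V) :
  \sum_(p <- unshuffles x) F p.1 p.2 = \sum_(p <- unshuffles x) F p.2 p.1.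
Proof.
elim: x F => [|a x IHx] F /=; first by rewrite !big_seq1.
rewrite !big_cat !big_map /= (IHx (fun y z => F (a :: y) z)).
by rewrite (IHx (fun y z => F y (a :: z))) addrC.
Qed.

(** The bialgebra axiom: unshuffling is multiplicative for concatenation. *)
Lemma unsh_cat (T : Type) (x y : seq T) (F : seq T -> seq T -> V) :
  \sum_(p <- unshuffles (x ++ y)) F p.1 p.2 =
  \sum_(p <- unshuffles x) \sum_(r <- unshuffles y) F (p.1 ++ r.1) (p.2 ++ r.2).
Proof.
elim: x F => [|a x IHx] F /=; first by rewrite big_seq1.
rewrite !big_cat !big_map /= (IHx (fun y z => F (a :: y) z)).
by rewrite (IHx (fun y z => F y (a :: z))).
Qed.

Lemma unsh_rev (T : Type) (x : seq T) (F : seq T -> seq T -> V) :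
  \sum_(p <- unshuffles (rev x)) F p.1 p.2 =
  \sum_(p <- unshuffles x) F (rev p.1) (rev p.2).
Proof.
elim: x F => [|a x IHx] F /=; first by rewrite !big_seq1.
rewrite rev_cons -cats1 unsh_cat big_cat !big_map /=.
rewrite (IHx (fun y z => \sum_(r <- _) F (y ++ r.1) (z ++ r.2))) -big_split /=.
by apply: eq_bigr => p _; rewrite big_cons big_seq1 !rev_cons -!cats1 !cats0.
Qed.

(** Coassociativity: both sides distribute the letters over three pieces. *)
Lemma unsh_assoc (T : Type) (x : seq T) (F : seq T -> seq T -> seq T -> V) :
  \sum_(p <- unshuffles x) \sum_(r <- unshuffles p.1) F r.1 r.2 p.2 =
  \sum_(p <- unshuffles x) \sum_(r <- unshuffles p.2) F p.1 r.1 r.2.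
Proof.
elim: x F => [|a x IHx] F /=; first by rewrite !big_seq1 /=.
rewrite !big_cat !big_map /=.
under eq_bigr => p _ do rewrite big_cat !big_map /=.
under [X in _ = _ + X]eq_bigr => p _ do rewrite big_cat !big_map /=.
rewrite !big_split /= (IHx (fun y => F (a :: y))) (IHx (fun y z => F y (a :: z))).
by rewrite (IHx (fun y z w => F y z (a :: w))) addrA.
Qed.

(** Both sides distribute the letters over four pieces; only the roles of the two middle pieces are
    exchanged. In this form cocommutativity enters the computation of coproducts of convolutions. *)
Lemma unsh_exchange (T : Type) (x : seq T)
    (F : seq T -> seq T -> seq T -> seq T -> V) :
  \sum_(p <- unshuffles x) \sum_(r <- unshuffles p.1) \sum_(s <- unshuffles p.2)
    F r.1 r.2 s.1 s.2 =
  \sum_(p <- unshuffles x) \sum_(r <- unshuffles p.1) \sum_(s <- unshuffles p.2)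
    F r.1 s.1 r.2 s.2.
Proof.
elim: x F => [|a x IHx] F /=; first by rewrite !big_seq1 /=.
rewrite !big_cat !big_map /=.
under eq_bigr => p _ do rewrite big_cat !big_map /=.
under [X in _ + X = _]eq_bigr => p _.
  under eq_bigr => r _ do rewrite big_cat !big_map /=.
  rewrite big_split; over.
under [X in _ = X + _]eq_bigr => p _ do rewrite big_cat !big_map /=.
under [X in _ = _ + X]eq_bigr => p _.
  under eq_bigr => r _ do rewrite big_cat !big_map /=.
  rewrite big_split; over.
rewrite !big_split /= (IHx (fun y => F (a :: y))) (IHx (fun y z => F y (a :: z))).
rewrite (IHx (fun y z w => F y z (a :: w))).
rewrite (IHx (fun y z w v => F y z w (a :: v))) !addrA; congr (_ + _).
by rewrite -!addrA; congr (_ + _); rewrite addrC.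
Qed.

(** When letters are distinct, the left piece determines the unshuffle, so the sum has one term. *)
Lemma unsh_filter (T : eqType) (x : seq T) (A : pred T)
    (F : seq T -> seq T -> V) : uniq x ->
  \sum_(p <- unshuffles x | p.1 == filter A x) F p.1 p.2 =
  F (filter A x) (filter (predC A) x).
Proof.
elim: x F => [|a x IHx] F /=; first by rewrite big_mkcond big_seq1.
case/andP=> ax ux; rewrite big_cat !big_map /=.
have notin (p : seq T * seq T) : p \in unshuffles x -> a \notin p.1.
  by move/unsh_perm/perm_mem=> px; apply: contra ax => pa; rewrite -px mem_cat pa.
case: ifP => Aa /=.
  rewrite [X in _ + X]big_seq_cond [X in _ + X]big_pred0 => [|p]; last first.
    apply/andP => -[/notin pa /eqP pE]; move: pa.
    by rewrite pE inE eqxx.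
  rewrite addr0 -(IHx (fun y z => F (a :: y) z) ux).
  by apply: eq_bigl => p; rewrite eqseq_cons eqxx.
rewrite [X in X + _]big_pred0 => [|p]; last first.
  apply/eqP => pE; move/negP: ax; apply.
  by have := mem_head a p.1; rewrite pE mem_filter => /andP[].
by rewrite add0r (IHx (fun y z => F y (a :: z)) ux).
Qed.

End UnshuffleSums.

(** * Convolution of functionals on words *)

Section Functionals.

Variable K : fieldType.
Implicit Types (F : (seq nat -> K) -> K) (G : nat -> seq nat -> (seq nat -> K) -> K).

(** [F] encodes a linear combination of rearrangements of [x], evaluated on test functions. The
    second clause allows a test function to be changed away from these rearrangements, hence to be
    rewritten under its binder. *)
Definition perm_form (x : seq nat) F : Prop :=
  (forall c f g, F (fun t => c * f t + g t) = c * F f + F g) /\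
  (forall f g, (forall t, perm_eq t x -> f t = g t) -> F f = F g).

Section PermForm.

Variables (x : seq nat) (F : (seq nat -> K) -> K).
Hypothesis formF : perm_form x F.

Lemma perm_form_ext f g : (forall t, perm_eq t x -> f t = g t) -> F f = F g.
Proof. by case: formF => _; apply. Qed.

Lemma perm_formD f g : F (fun t => f t + g t) = F f + F g.
Proof.
case: formF => linF _; rewrite -[F f]mul1r -linF.
by apply: perm_form_ext => t _; rewrite mul1r.
Qed.

Lemma perm_form0 : F (fun=> 0) = 0.
Proof.
have := perm_formD (fun=> 0) (fun=> 0).
rewrite (@perm_form_ext _ (fun=> 0)) => [|t _]; last exact: addr0.
by move/eqP; rewrite -{1}[F _]addr0 (inj_eq (addrI _)) eq_sym => /eqP.
Qed.

Lemma perm_formZ c f : F (fun t => c * f t) = c * F f.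
Proof.
case: formF => linF _; rewrite -[RHS]addr0 -perm_form0 -linF.
by apply: perm_form_ext => t _; rewrite addr0.
Qed.

Lemma perm_form_sum I (r : seq I) (f : I -> seq nat -> K) :
  F (fun t => \sum_(i <- r) f i t) = \sum_(i <- r) F (f i).
Proof.
elim: r => [|i r IHr].
  rewrite big_nil -[RHS]perm_form0.
  by apply: perm_form_ext => t _; rewrite big_nil.
rewrite big_cons -IHr -perm_formD.
by apply: perm_form_ext => t _; rewrite big_cons.
Qed.

Lemma perm_form_delta f :
  F f = \sum_(t <- permutations x) F (fun s => (s == t)%:R) * f t.
Proof.
transitivity (F (fun s => \sum_(t <- permutations x) f t * (s == t)%:R)).
  apply: perm_form_ext => t tx; rewrite (bigD1_seq t) ?permutations_uniq //=.
    rewrite eqxx mulr1 big1 ?addr0 // => s /negPf st.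
    by rewrite eq_sym st mulr0.
  by rewrite mem_permutations.
by rewrite perm_form_sum; apply: eq_bigr => t _; rewrite perm_formZ mulrC.
Qed.

End PermForm.

Definition perm_family G : Prop :=
  (forall a x, perm_form x (G a x)) /\
  (forall a x f, size x != a -> G a x f = 0).

(** A finite Fubini theorem: by [perm_form_delta] a functional is a finite sum of evaluations. *)
Lemma perm_form_exchange x y F F' (f : seq nat -> seq nat -> K) :
  perm_form x F -> perm_form y F' ->
  F (fun t => F' (f t)) = F' (fun s => F (f^~ s)).
Proof.
move=> formF formF'; rewrite [RHS](perm_form_delta formF').
under (perm_form_ext formF) => t _ do rewrite (perm_form_delta formF').
by rewrite (perm_form_sum formF); apply: eq_bigr => s _; rewrite (perm_formZ formF).
Qed.

(* A family G stands for elements G_a of degree a; G a x f is the value of f,  *)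
(* extended linearly, at the combination of words obtained by applying G_a to *)
(* x.  Then conv G q stands for the outer product of the G_a, a in q.          *)
Fixpoint conv G (q : seq nat) (x : seq nat) (f : seq nat -> K) : K :=
  if q is a :: q' then
    \sum_(p <- unshuffles x) G a p.1 (fun t => conv G q' p.2 (fun s => f (t ++ s)))
  else (x == [::])%:R * f [::].

Section Conv.

Variable G : nat -> seq nat -> (seq nat -> K) -> K.
Hypothesis famG : perm_family G.

Lemma conv_form q x : perm_form x (conv G q x).
Proof.
have [formG _] := famG.
elim: q x => [|a q IHq] x; split=> [c f g | f g eq_fg] /=.
- by rewrite mulrDr mulrCA.
- by case: eqP => [x0|_]; rewrite ?mul0r // eq_fg // x0.
- rewrite big_distrr -big_split /=; apply: eq_bigr => p _.
  rewrite -(perm_formZ (formG _ _)) -(perm_formD (formG _ _)).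
  by apply: perm_form_ext => // t _; case: (IHq p.2) => -> _.
apply: eq_big_seq => p px; apply: perm_form_ext => // t tp.
apply: (perm_form_ext (IHq _)) => s sp; apply: eq_fg.
by rewrite -(permPr (unsh_perm px)) perm_cat.
Qed.

Lemma conv_size q x f : size x != sumn q -> conv G q x f = 0.
Proof.
have [formG sizeG] := famG.
elim: q x f => [|a q IHq] x f /=; first by case: x => //=; rewrite mul0r.
move=> xq; rewrite big_seq big1 // => p px.
have [pa|pa] := eqVneq (size p.1) a; last by rewrite sizeG.
rewrite -[RHS](perm_form0 (formG a p.1)).
apply: perm_form_ext => // t _; rewrite IHq //; apply: contra xq => /eqP <-.
by rewrite -(unsh_size px) pa.
Qed.

Lemma conv1 a x f : conv G [:: a] x f = G a x f.
Proof.
have [formG _] := famG.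
rewrite /= -(unsh_nilr x (fun y z => G a y f)) [RHS]big_mkcond.
apply: eq_bigr => p _; case: eqP => _ /=.
  by apply: perm_form_ext => // t _; rewrite mul1r cats0.
by rewrite -[RHS](perm_form0 (formG a p.1)); apply: perm_form_ext => // t _; rewrite mul0r.
Qed.

(** Associativity of convolution, inherited from coassociativity of unshuffling. *)
Lemma conv_cat u v x f :
  conv G (u ++ v) x f =
  \sum_(p <- unshuffles x)
    conv G u p.1 (fun t => conv G v p.2 (fun s => f (t ++ s))).
Proof.
have [formG _] := famG.
elim: u x f => [|a u IHu] x f /=.
  rewrite -(unsh_nill x (fun _ z => conv G v z f)) big_mkcond.
  by apply: eq_bigr => p _; case: eqP; rewrite ?mul1r ?mul0r.
under eq_bigr => p _.
  under (perm_form_ext (formG _ _)) => t _ do rewrite IHu.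
  rewrite (perm_form_sum (formG _ _)); over.
rewrite -(unsh_assoc x (fun y z w => G a y (fun t => conv G u z (fun s =>
   conv G v w (fun s' => f (t ++ (s ++ s'))))))).
apply: eq_bigr => p _; apply: eq_bigr => r _; apply: perm_form_ext => // t _.
apply: (perm_form_ext (conv_form _ _)) => s _.
by apply: (perm_form_ext (conv_form _ _)) => s' _; rewrite catA.
Qed.

End Conv.

Lemma eq_conv G H q x f : (forall a y, a \in q -> G a y =1 H a y) ->
  perm_family G -> conv G q x f = conv H q x f.
Proof.
move=> GH famG; elim: q x f GH => [|a q IHq] x f GH //=.
apply: eq_bigr => p _; rewrite -GH ?mem_head //.
have [formG _] := famG; apply: perm_form_ext => // t _.
by apply: IHq => b y bq; apply: GH; rewrite inE bq orbT.
Qed.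

(* If delta a lists the terms of the coproduct of G_a as pairs of words in the *)
(* letters G_b, then act_words delta q r lists the terms of Xi^q * G_r.        *)
Fixpoint coproduct (delta : nat -> seq (seq nat * seq nat)) (r : seq nat) :=
  if r is a :: r' then
    [seq (d.1 ++ p.1, d.2 ++ p.2) | d <- delta a, p <- coproduct delta r']
  else [:: ([::], [::])].

Fixpoint act_words (delta : nat -> seq (seq nat * seq nat)) (q r : seq nat) :=
  if q is a :: q' then
    [seq p.1 ++ s | p <- [seq p <- coproduct delta r | sumn p.1 == a],
                    s <- act_words delta q' p.2]
  else if sumn r == 0%N then [:: r] else [::].

(** As operators on words: G_a followed by unshuffling equals unshuffling followed by the sum over
    [d] of the convolutions along [d.1] and [d.2] on the two pieces. The function [f] tests pairs of
    words. *)
Definition comultiplicative G (delta : nat -> seq (seq nat * seq nat)) : Prop :=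
  forall a x (f : seq nat -> seq nat -> K),
    G a x (fun t => \sum_(p <- unshuffles t) f p.1 p.2) =
    \sum_(d <- delta a) \sum_(p <- unshuffles x)
      conv G d.1 p.1 (fun t => conv G d.2 p.2 (f t)).

Section Coproduct.

Variables (G : nat -> seq nat -> (seq nat -> K) -> K).
Variable delta : nat -> seq (seq nat * seq nat).
Hypotheses (famG : perm_family G) (comulG : comultiplicative G delta).

(** By cocommutativity the coproduct of a convolution is the convolution of the coproducts, so the
    description by [delta] extends from single operators to words [r]. *)
Lemma conv_unsh r x (f : seq nat -> seq nat -> K) :
  conv G r x (fun t => \sum_(p <- unshuffles t) f p.1 p.2) =
  \sum_(d <- coproduct delta r) \sum_(p <- unshuffles x)
    conv G d.1 p.1 (fun t => conv G d.2 p.2 (f t)).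
Proof.
have [formG _] := famG.
elim: r x f => [|a r IHr] x f.
  rewrite /= !big_seq1 /= -(unsh_nill x (fun _ z => (z == [::])%:R * f [::] [::])).
  rewrite big_mkcond; apply: eq_bigr => p _.
  by case: eqP => _; rewrite ?mul1r ?mul0r.
transitivity (\sum_(d <- delta a) \sum_(d' <- coproduct delta r)
  \sum_(p <- unshuffles x) \sum_(v <- unshuffles p.1) \sum_(u <- unshuffles p.2)
   conv G d.1 v.1 (fun t1 => conv G d.2 v.2 (fun t2 =>
     conv G d'.1 u.1 (fun s1 => conv G d'.2 u.2 (fun s2 =>
       f (t1 ++ s1) (t2 ++ s2)))))).
  rewrite /=; under eq_bigr => p _.
    under (perm_form_ext (formG _ _)) => t _.
      under (perm_form_ext (conv_form famG _ _)) => s _ do rewrite unsh_cat.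
      rewrite (perm_form_sum (conv_form famG _ _)).
      under eq_bigr => e _ do rewrite (IHr _ (fun s1 s2 => f (e.1 ++ s1) (e.2 ++ s2))).
      over.
    rewrite (comulG a p.1 (fun y z => \sum_(d <- coproduct delta r)
      \sum_(u <- unshuffles p.2) conv G d.1 u.1 (fun s1 =>
        conv G d.2 u.2 (fun s2 => f (y ++ s1) (z ++ s2))))).
    over.
  rewrite exchange_big; apply: eq_bigr => d _; rewrite [RHS]exchange_big.
  apply: eq_bigr => p _; rewrite [RHS]exchange_big; apply: eq_bigr => v _ /=.
  under (perm_form_ext (conv_form famG _ _)) => t1 _.
    rewrite (perm_form_sum (conv_form famG _ _)).
    under eq_bigr => d' _ do rewrite (perm_form_sum (conv_form famG _ _)).
    over.
  rewrite (perm_form_sum (conv_form famG _ _)); apply: eq_bigr => d' _.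
  by rewrite (perm_form_sum (conv_form famG _ _)).
rewrite /= big_allpairs_dep; apply: eq_bigr => d _; apply: eq_bigr => d' _.
(* So far the outer unshuffle separates [d] from [d']; after the exchange it separates left
   components from right components, as the coproduct does. *)
rewrite (unsh_exchange x (fun v1 v2 u1 u2 => conv G d.1 v1 (fun t1 =>
  conv G d.2 v2 (fun t2 => conv G d'.1 u1 (fun s1 => conv G d'.2 u2 (fun s2 =>
       f (t1 ++ s1) (t2 ++ s2))))))) /=.
apply: eq_bigr => p _; rewrite (conv_cat famG); apply: eq_bigr => v _.
under [RHS](perm_form_ext (conv_form famG _ _)) => t1 _.
  under (perm_form_ext (conv_form famG _ _)) => s1 _ do rewrite (conv_cat famG).
  rewrite (perm_form_sum (conv_form famG _ _)); over.
rewrite (perm_form_sum (conv_form famG _ _)); apply: eq_bigr => u _.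
apply: (perm_form_ext (conv_form famG _ _)) => t1 _.
by rewrite (perm_form_exchange _ (conv_form famG _ _) (conv_form famG _ _)).
Qed.

End Coproduct.

(** The projection onto words of length [a]. Its convolution products are the operators of the Xi^q,
    see [word_act_Xi]. *)
Definition unit_family (a : nat) (x : seq nat) (f : seq nat -> K) : K :=
  (size x == a)%:R * f x.

Lemma unit_family_perm : perm_family unit_family.
Proof.
split=> [a x|a x f /negPf xa]; last by rewrite /unit_family xa mul0r.
split=> [c f g|f g fg]; first by rewrite /unit_family mulrDr mulrCA.
by rewrite /unit_family fg.
Qed.

(** The coproduct of a divided power. The extreme values of [b] are included, so words built from it
    may contain zeros; [support_word] discards them later. *)
Definition divided_delta (a : nat) : seq (seq nat * seq nat) :=
  [seq ([:: b], [:: (a - b)%N]) | b <- iota 0 a.+1].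

Definition primitive_delta (a : nat) : seq (seq nat * seq nat) :=
  [:: ([:: a], [::]); ([::], [:: a])].

Lemma sum_divided_delta (V : nmodType) a (F : seq nat -> seq nat -> V) :
  \sum_(d <- divided_delta a) F d.1 d.2 = \sum_(b < a.+1) F [:: nat_of_ord b] [:: (a - b)%N].
Proof.
by rewrite big_map -(big_mkord xpredT (fun b => F [:: b] [:: (a - b)%N])).
Qed.

Lemma divided_comul_sizes a x (f : seq nat -> seq nat -> K) :
  \sum_(b < a.+1) \sum_(p <- unshuffles x)
     (size p.1 == b)%:R * ((size p.2 == a - b)%N%:R * f p.1 p.2) =
  (size x == a)%:R * \sum_(p <- unshuffles x) f p.1 p.2.
Proof.
rewrite exchange_big big_distrr /= big_seq [RHS]big_seq; apply: eq_bigr => p px.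
have sz := unsh_size px.
have [xa|xa] := eqVneq (size x) a.
  have pa : (size p.1 < a.+1)%N by rewrite -xa -sz ltnS leq_addr.
  rewrite (bigD1 (Ordinal pa)) //= eqxx big1 => [|b /negPf bp].
    by rewrite addr0 -xa -sz addKn eqxx !mul1r.
  by rewrite eq_sym -[_ == _]/(b == Ordinal pa) bp mul0r.
rewrite mul0r big1 // => b _; have [pb|_] := eqVneq; last by rewrite mul0r.
have [pb'|_] := eqVneq; last by rewrite mul0r mulr0.
by case/eqP: xa; rewrite -sz pb pb' subnKC // -ltnS.
Qed.

Lemma unit_comultiplicative : comultiplicative unit_family divided_delta.
Proof.
move=> a x f; rewrite (sum_divided_delta _ (fun u v => \sum_(p <- unshuffles x)
  conv _ u p.1 (fun t => conv _ v p.2 (f t)))) {1}/unit_family -divided_comul_sizes.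
apply: eq_bigr => b _; apply: eq_bigr => p _.
by rewrite !(conv1 unit_family_perm) /unit_family !(conv1 unit_family_perm).
Qed.

Section Action.

Variables (G : nat -> seq nat -> (seq nat -> K) -> K).
Variable delta : nat -> seq (seq nat * seq nat).
Hypotheses (famG : perm_family G) (comulG : comultiplicative G delta).

(** Xi^q cuts off a piece of length q_1 and recurses. Applied after G_r, this selects the terms of
    the coproduct of G_r whose left part has degree q_1, and continues with the right part. *)
Lemma conv_act q r x f :
  conv G r x (fun t => conv unit_family q t f) =
  \sum_(s <- act_words delta q r) conv G s x f.
Proof.
elim: q r x f => [|a q IHq] r x f /=.
  (* For empty [q] only degree 0 survives; [r] may then still consist of zeros and is kept as it
     is. *)
  have [r0|r0] := eqVneq (sumn r) 0; last first.
    rewrite big_nil; have [xr|xr] := eqVneq (size x) (sumn r); last exact: conv_size.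
    rewrite -[RHS](perm_form0 (conv_form famG r x)).
    apply: (perm_form_ext (conv_form famG r x)) => t /perm_size tx.
    by case: t tx r0 => [|? ?] /=; rewrite ?mul0r // -xr => <-.
  rewrite big_seq1; have [xr|xr] := eqVneq (size x) (sumn r); last first.
    by rewrite !conv_size.
  apply: (perm_form_ext (conv_form famG r x)) => t /perm_size.
  by rewrite xr r0 => /size0nil->; rewrite eqxx mul1r.
rewrite (conv_unsh famG comulG _ _ (fun y z => unit_family a y (fun t =>
  conv unit_family q z (fun s => f (t ++ s))))).
rewrite big_allpairs_dep big_filter [RHS]big_mkcond; apply: eq_bigr => d _.
have [da|da] := eqVneq (sumn d.1) a; last first.
  rewrite big1 // => p _; have [pd|pd] := eqVneq (size p.1) (sumn d.1); last exact: conv_size.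
  rewrite -[RHS](perm_form0 (conv_form famG d.1 p.1)).
  apply: (perm_form_ext (conv_form famG d.1 p.1)) => t /perm_size tp.
  rewrite -[RHS](perm_form0 (conv_form famG d.2 p.2)).
  apply: (perm_form_ext (conv_form famG d.2 p.2)) => s _.
  by rewrite /unit_family tp pd (negPf da) mul0r.
under [RHS]eq_bigr => s _ do rewrite (conv_cat famG).
rewrite exchange_big; apply: eq_bigr => p _ /=.
rewrite -(perm_form_sum (conv_form famG _ _)).
have [pd|pd] := eqVneq (size p.1) (sumn d.1); last by rewrite !conv_size.
apply: (perm_form_ext (conv_form famG _ _)) => t /perm_size tp.
rewrite -IHq; apply: (perm_form_ext (conv_form famG _ _)) => s _.
by rewrite /unit_family tp pd da eqxx mul1r.
Qed.

End Action.

End Functionals.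

(** * Action of the group algebra on words *)

Lemma unsh_map (V : nmodType) (S T : Type) (h : S -> T) (x : seq S)
    (F : seq T -> seq T -> V) :
  \sum_(p <- unshuffles (map h x)) F p.1 p.2 =
  \sum_(p <- unshuffles x) F (map h p.1) (map h p.2).
Proof.
elim: x F => [|a x IHx] F /=; first by rewrite !big_seq1.
rewrite !big_cat !big_map /= (IHx (fun y z => F (h a :: y) z)).
by rewrite (IHx (fun y z => F y (h a :: z))).
Qed.

Lemma unsh_subseq (T : eqType) (x : seq T) p : p \in unshuffles x -> subseq p.1 x.
Proof.
elim: x p => [|a x IHx] p; first by rewrite inE => /eqP->.
rewrite mem_cat => /orP[] /mapP[r /IHx rx ->] /=; first by rewrite eqxx.
exact: subseq_trans rx (subseq_cons _ _).
Qed.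

Lemma filter_sort_take a t : uniq t ->
  filter (mem (take a t)) (sort leq t) = sort leq (take a t).
Proof.
rewrite -{1}(cat_take_drop a t) cat_uniq => /and3P[_ disj _].
rewrite filter_sort; [congr sort|exact: leq_total|exact: leq_trans].
have noB : filter (mem (take a t)) (drop a t) = [::].
  by apply/eqP; rewrite -[_ == _]negbK -has_filter.
rewrite -{2}(cat_take_drop a t) filter_cat noB cats0.
by apply/all_filterP/allP.
Qed.

Lemma filter_sort_drop a t : uniq t ->
  filter (predC (mem (take a t))) (sort leq t) = sort leq (drop a t).
Proof.
rewrite -{1}(cat_take_drop a t) cat_uniq => /and3P[_ disj _].
rewrite filter_sort; [congr sort|exact: leq_total|exact: leq_trans].
have noA : filter (predC (mem (take a t))) (take a t) = [::].
  by apply/eqP; rewrite -[_ == _]negbK -has_filter has_predC negbK; apply/allP.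
rewrite -{2}(cat_take_drop a t) filter_cat noA.
by apply/all_filterP; rewrite all_predC.
Qed.

Definition perm_word n (x : seq nat) (s : 'S_n) : seq nat :=
  [seq nth 0%N x (s i) | i <- enum 'I_n].

Lemma size_perm_word n x (s : 'S_n) : size (perm_word x s) = n.
Proof. by rewrite size_map size_enum_ord. Qed.

Lemma nth_perm_word n x (s : 'S_n) (i : 'I_n) :
  nth 0%N (perm_word x s) i = nth 0%N x (s i).
Proof. by rewrite (nth_map i) ?size_enum_ord // nth_ord_enum. Qed.

Lemma nth_perm_iota n (s : 'S_n) (i : 'I_n) :
  nth 0%N (perm_word (iota 0 n) s) i = s i.
Proof. by rewrite nth_perm_word nth_iota. Qed.

Lemma perm_wordP n x (s : 'S_n) : size x = n -> perm_eq (perm_word x s) x.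
Proof.
move=> xn; have xE : x = [seq nth 0%N x (val i) | i <- enum 'I_n].
  by rewrite (map_comp (nth 0%N x)) val_enum_ord -xn map_nth_iota0 ?take_size.
rewrite [X in perm_eq _ X]xE /perm_word (map_comp (fun i : 'I_n => nth 0%N x i) s).
apply: perm_map; apply: uniq_perm; rewrite ?enum_uniq //.
  by rewrite map_inj_uniq ?enum_uniq //; apply: perm_inj.
move=> i; rewrite mem_enum inE; apply/mapP; exists ((s^-1)%g i); rewrite ?mem_enum //.
by rewrite permKV.
Qed.

Lemma perm_word_inj n : injective (@perm_word n (iota 0 n)).
Proof.
by move=> s s' ss'; apply/permP => i; apply: val_inj; rewrite /= -!nth_perm_iota ss'.
Qed.

(** Letter [i] of the new word is letter [s i] of the old one, so [t * s] applies [s] first: place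
    permutation is a left action although permutations act on the right. *)
Lemma perm_wordM n x (s t : 'S_n) :
  perm_word x (t * s)%g = perm_word (perm_word x s) t.
Proof. by apply: eq_map => i; rewrite permM nth_perm_word. Qed.

Lemma perm_word1 n x : size x = n -> perm_word x (1%g : 'S_n) = x.
Proof.
move=> xn; apply: (@eq_from_nth _ 0%N); rewrite size_perm_word // => i i_lt.
by rewrite (nth_perm_word x 1%g (Ordinal i_lt)) perm1.
Qed.

Lemma perm_word_iota n x (s : 'S_n) : size x = n ->
  perm_word x s = map (nth 0%N x) (perm_word (iota 0 n) s).
Proof.
by move=> xn; rewrite -map_comp; apply: eq_map => i /=; rewrite nth_iota.
Qed.

Lemma permutations_iota n :
  perm_eq (permutations (iota 0 n)) [seq perm_word (iota 0 n) s | s : 'S_n].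
Proof.
rewrite perm_sym; have un : uniq [seq perm_word (iota 0 n) s | s : 'S_n].
  by rewrite map_inj_uniq ?enum_uniq //; apply: perm_word_inj.
have sub : {subset [seq perm_word (iota 0 n) s | s : 'S_n] <= permutations (iota 0 n)}.
  move=> _ /mapP[s _ ->]; rewrite mem_permutations.
  by apply: perm_wordP; rewrite size_iota.
apply: uniq_perm; rewrite ?permutations_uniq //.
have /(uniq_min_size un sub) [] // : (size (permutations (iota 0 n)) <=
  size [seq perm_word (iota 0 n) s | s : 'S_n])%N.
by rewrite size_permutations ?iota_uniq // size_iota size_map -cardE card_Sn.
Qed.

Section WordAction.

Variable K : fieldType.

Definition word_act n (a : symalg K n) (x : seq nat) (f : seq nat -> K) : K :=
  \sum_(s : 'S_n) (a s : K) * f (perm_word x s).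

Section Fixed.

Variable n : nat.
Implicit Types (a b : symalg K n) (x : seq nat) (f : seq nat -> K).

Lemma word_act_form a x : size x = n -> perm_form x (word_act a x).
Proof.
move=> xn; split=> [c f g|f g fg].
  rewrite big_distrr -big_split; apply: eq_bigr => s _ /=.
  by rewrite mulrDr mulrCA.
by apply: eq_bigr => s _; rewrite fg ?perm_wordP.
Qed.

Lemma word_actD a b x f : word_act (a + b) x f = word_act a x f + word_act b x f.
Proof. by rewrite -big_split; apply: eq_bigr => s _; rewrite ffunE mulrDl. Qed.

Lemma word_actZ c a x f : word_act (c *: a) x f = c * word_act a x f.
Proof. by rewrite big_distrr; apply: eq_bigr => s _; rewrite ffunE -mulrA. Qed.

Lemma word_act0 x f : word_act (0 : symalg K n) x f = 0.
Proof. by rewrite /word_act big1 // => s _; rewrite ffunE mul0r. Qed.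

Lemma word_act_sum I r (P : pred I) (a : I -> symalg K n) x f :
  word_act (\sum_(i <- r | P i) a i) x f = \sum_(i <- r | P i) word_act (a i) x f.
Proof.
apply: (big_morph (fun a => word_act a x f)) => [b c|]; first exact: word_actD.
exact: word_act0.
Qed.

Lemma word_act1 x f : size x = n -> word_act (1 : symalg K n) x f = f x.
Proof.
move=> xn; rewrite /word_act (bigD1 1%g) //= [X in X * _]ffunE eqxx mul1r.
rewrite big1 ?addr0 => [|s /negPf s1]; last by rewrite [X in X * _]ffunE s1 mul0r.
by rewrite perm_word1.
Qed.

Lemma word_actM a b x f : size x = n ->
  word_act (a * b) x f = word_act b x (fun t => word_act a t f).
Proof.
move=> xn; rewrite /word_act.
under eq_bigr => s _ do rewrite [X in X * _]ffunE big_distrl /=.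
under [RHS]eq_bigr => s _ do rewrite big_distrr /=.
rewrite exchange_big [RHS]exchange_big; apply: eq_bigr => t _ /=.
rewrite (reindex_inj (mulgI t)) /=; apply: eq_bigr => s _.
by rewrite mulKg perm_wordM mulrCA mulrA.
Qed.

(** The letters of [iota 0 n] are distinct, so test functions that single out one rearrangement read
    off the coefficients. *)
Lemma word_act_inj a b :
  (forall f, word_act a (iota 0 n) f = word_act b (iota 0 n) f) -> a = b.
Proof.
move=> eq_ab; apply/ffunP => s.
have coefE (c : symalg K n) :
    word_act c (iota 0 n) (fun t => (t == perm_word (iota 0 n) s)%:R) = c s.
  rewrite /word_act (bigD1 s) //= eqxx mulr1 big1 ?addr0 // => t /negPf ts.
  by rewrite (inj_eq (@perm_word_inj n)) ts mulr0.
by rewrite -coefE eq_ab coefE.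
Qed.

Lemma word_act_iota a x f : size x = n ->
  word_act a x f = word_act a (iota 0 n) (fun t => f (map (nth 0%N x) t)).
Proof. by move=> xn; apply: eq_bigr => s _; rewrite perm_word_iota. Qed.

Lemma word_act_delta a F : perm_form (iota 0 n) F ->
  (forall s : 'S_n, a s = F (fun t => (t == perm_word (iota 0 n) s)%:R)) ->
  forall f, word_act a (iota 0 n) f = F f.
Proof.
move=> formF aF f; rewrite (perm_form_delta formF).
rewrite (perm_big _ (permutations_iota n)) big_map big_enum /=.
by apply: eq_bigr => s _; rewrite aF.
Qed.

End Fixed.

Definition natural_family (G : nat -> seq nat -> (seq nat -> K) -> K) : Prop :=
  forall a h x f, G a (map h x) f = G a x (fun t => f (map h t)).

Lemma conv_map G q h x f : perm_family G -> natural_family G ->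
  conv G q (map h x) f = conv G q x (fun t => f (map h t)).
Proof.
move=> famG natG; have [formG _] := famG.
elim: q x f => [|a q IHq] x f /=; first by case: x.
rewrite (unsh_map h x (fun y z => G a y (fun t => conv G q z (fun s => f (t ++ s))))).
apply: eq_bigr => p _; rewrite natG; apply: perm_form_ext => // t _.
by rewrite IHq; apply: (perm_form_ext (conv_form famG _ _)) => s _; rewrite map_cat.
Qed.

Lemma unit_family_natural : natural_family (@unit_family K).
Proof. by move=> a h x f; rewrite /unit_family size_map. Qed.

(** Only one unshuffle of the sorted word can produce [t]: its left piece consists of the first [a]
    letters of [t]. Hence the coefficient of [t] factors along the blocks. *)
Lemma conv_delta (G : nat -> seq nat -> (seq nat -> K) -> K) a q t :
  perm_family G -> uniq t -> (a <= size t)%N ->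
  conv G (a :: q) (sort leq t) (fun s => (s == t)%:R) =
  G a (sort leq (take a t)) (fun s => (s == take a t)%:R) *
  conv G q (sort leq (drop a t)) (fun s => (s == drop a t)%:R).
Proof.
move=> famG ut at_; have [formG sizeG] := famG.
have tE : take a t ++ drop a t = t by apply: cat_take_drop.
rewrite /= -filter_sort_take // -filter_sort_drop // -(unsh_filter _ (fun y z =>
  G a y (fun s => (s == take a t)%:R) * conv G q z (fun s => (s == drop a t)%:R)));
  last by rewrite sort_uniq.
rewrite big_seq [RHS]big_mkcond [RHS]big_seq; apply: eq_bigr => p px.
have [pa|pa] := eqVneq (size p.1) a; last by rewrite !sizeG // mul0r if_same.
transitivity (G a p.1 (fun s => (s == take a t)%:R) *
              conv G q p.2 (fun s => (s == drop a t)%:R)).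
  rewrite mulrC -(perm_formZ (formG _ _)); apply: perm_form_ext => // s sp.
  rewrite mulrC -(perm_formZ (conv_form famG _ _)).
  apply: (perm_form_ext (conv_form famG _ _)) => s' _.
  rewrite -natrM mulnb -{1}tE eqseq_cat //.
  by rewrite (perm_size sp) pa size_takel.
(* For any other unshuffle, [G a] sees only rearrangements of [p.1], and [take a t] is none of
   them. *)
case: ifPn => // pA; rewrite (_ : G a p.1 _ = 0) ?mul0r //.
rewrite -[RHS](perm_form0 (formG a p.1)); apply: perm_form_ext => // s sp.
case: eqP => // sA; case/negP: pA.
rewrite (subseq_uniqP _ (unsh_subseq px)) ?sort_uniq //; apply/eqP.
by apply: eq_filter => i; rewrite /= -sA (perm_mem sp).
Qed.

End WordAction.

Fixpoint all_blocks (P : pred (seq nat)) (q t : seq nat) : bool :=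
  if q is a :: q' then P (take a t) && all_blocks P q' (drop a t) else true.

Lemma scanl_addn a q : scanl addn a q = map (addn a) (scanl addn 0%N q).
Proof.
elim: q a => [|b q IHq] a //=; rewrite add0n IHq [in RHS]IHq -map_comp.
by congr (_ :: _); apply: eq_map => i /=; rewrite addnA.
Qed.

(** [pat] is a condition on [w] consecutive letters and [P] its avoidance. Cutting [t] into blocks
    destroys an occurrence exactly when a cut falls strictly inside it. Descents are the case w = 2,
    peaks the case w = 3. *)
Lemma all_blocksP (w : nat) (pat P : pred (seq nat)) q t :
  (0 < w)%N -> size t = sumn q ->
  (forall u, reflect (forall i, (i + w <= size u)%N -> ~~ pat (take w (drop i u))) (P u)) ->
  reflect (forall i, (i + w <= size t)%N -> pat (take w (drop i t)) ->
             exists2 j, (0 < j < w)%N & (i + j)%N \in scanl addn 0%N q)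
          (all_blocks P q t).
Proof.
move=> w0 + PP; elim: q t => [|a q IHq] t.
  by move/size0nil->; apply: (iffP idP) => // _ i /=; lia.
move=> /= tsz; rewrite add0n scanl_addn.
have take_drop_take i : (i + w <= a)%N ->
    take w (drop i (take a t)) = take w (drop i t).
  by move=> iwa; rewrite !take_drop take_takel // addnC.
have vsz : size (drop a t) = sumn q by rewrite size_drop; lia.
apply: (iffP andP) => [[/PP Pu /(IHq _ vsz) Pv] i it pi|H].
  have [iwa|iwa] := leqP (i + w) a.
    have := Pu i; rewrite size_takel; last by lia.
    by rewrite take_drop_take // pi => /(_ iwa).
  have [ai|ia] := leqP a i; last first.
    by exists (a - i)%N; rewrite ?subnKC ?mem_head; lia.
  have [j jw jq] : exists2 j, (0 < j < w)%N & (i - a + j)%N \in scanl addn 0%N q.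
    by apply: Pv; rewrite ?vsz ?drop_drop ?subnK //; lia.
  exists j => //; rewrite inE; apply/orP; right; apply/mapP.
  by exists (i - a + j)%N => //; lia.
split.
  apply/PP => i; rewrite size_takel; last by lia.
  move=> iwa; rewrite take_drop_take //; apply/negP => pi.
  have [|j jw] := H i _ pi; first by lia.
  by rewrite inE => /orP[/eqP|/mapP[e _]]; lia.
apply/(IHq _ vsz) => i iv pi; have [||j jw] := H (a + i)%N.
- by lia.
- by rewrite addnC -drop_drop.
rewrite inE => /orP[/eqP|/mapP[e eq]]; first by lia.
by rewrite -addnA => /addnI ij; exists j; rewrite // ij.
Qed.

Definition descent_pattern (u : seq nat) := (nth 0 u 1 < nth 0 u 0)%N.

Lemma sorted_leqP u :
  reflect (forall i, (i + 2 <= size u)%N -> ~~ descent_pattern (take 2 (drop i u)))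
          (sorted leq u).
Proof.
apply: (iffP (sortedP 0%N)) => H i iu.
  rewrite /descent_pattern !nth_take // !nth_drop addn0 addn1 -leqNgt; apply: H; lia.
have := H i; rewrite /descent_pattern !nth_take // !nth_drop addn0 addn1 -leqNgt.
by apply; lia.
Qed.

Lemma descents_perm_word n (s : 'S_n) (i : 'I_n) :
  (i \in descents s) =
  (0 < i)%N && descent_pattern (take 2 (drop i.-1 (perm_word (iota 0 n) s))).
Proof.
rewrite inE /descent_pattern !nth_take // !nth_drop addn0 addn1.
apply/existsP/andP => [[h /andP[/eqP hi sih]]|[i0]].
  by rewrite -hi /= hi !nth_perm_iota; split; rewrite // -hi.
have hn : (i.-1 < n)%N by have := ltn_ord i; lia.
rewrite prednK // nth_perm_iota (nth_perm_iota s (Ordinal hn)) => sih.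
by exists (Ordinal hn); rewrite sih /= prednK ?eqxx.
Qed.

Lemma descents_sub_word n (s : 'S_n) q : sumn q = n ->
  (descents s \subset word_set n q) =
  all_blocks (sorted leq) q (perm_word (iota 0 n) s).
Proof.
move=> qn; apply/subsetP/(all_blocksP _ _ sorted_leqP) => //.
- by rewrite size_perm_word qn.
- move=> sub i; rewrite size_perm_word => i_lt pi.
  have i1 : (i.+1 < n)%N by lia.
  exists 1%N => //; have := sub (Ordinal i1).
  by rewrite descents_perm_word pi !inE addn1 => /(_ isT).
move=> H i; rewrite descents_perm_word inE => /andP[i0 pi].
have [|j] := H i.-1 _ pi; first by rewrite size_perm_word; have := ltn_ord i; lia.
by case: j => [|[|j]] //= _; rewrite addn1 prednK.
Qed.

Lemma sort_perm_iota n (s : 'S_n) : sort leq (perm_word (iota 0 n) s) = iota 0 n.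
Proof.
apply: (sorted_eq leq_trans anti_leq); rewrite ?sort_sorted ?iota_sorted //.
  exact: leq_total.
by rewrite perm_sort perm_wordP // size_iota.
Qed.

Section XiAction.

Variable K : fieldType.

Lemma XiE n (D : {set 'I_n}) (s : 'S_n) : Xi K D s = (descents s \subset D)%:R.
Proof.
rewrite sum_ffunE; case: (boolP (_ \subset _)) => sD.
  rewrite (bigD1 (descents s)) //= ffunE eqxx big1 ?addr0 // => E /andP[_ /negPf sE].
  by rewrite ffunE eq_sym sE.
rewrite big1 // => E ED; rewrite ffunE; case: eqP => // sE.
by rewrite sE ED in sD.
Qed.

Lemma conv_unit_delta q t : uniq t -> size t = sumn q ->
  conv (@unit_family K) q (sort leq t) (fun s => (s == t)%:R) =
  (all_blocks (sorted leq) q t)%:R.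
Proof.
elim: q t => [|a q IHq] t ut tq; first by case: t tq {ut} => //; rewrite /= mul1r.
rewrite (conv_delta _ (@unit_family_perm K)) //; last by rewrite tq leq_addr.
rewrite IHq ?drop_uniq //; last by rewrite size_drop tq addKn.
rewrite /unit_family size_sort size_takel; last by rewrite tq leq_addr.
rewrite eqxx mul1r -natrM mulnb /=; congr (_ && _)%:R.
apply/eqP/idP => [<-|]; first exact: (sort_sorted leq_total).
exact: (sorted_sort leq_trans).
Qed.

(** On the standard word both sides have coefficient 1 at the words increasing on every block of [q]
    and 0 elsewhere; naturality carries this to all words. *)
Lemma word_act_Xi n q x f : sumn q = n -> size x = n ->
  word_act (Xi K (word_set n q)) x f = conv (@unit_family K) q x f.
Proof.
move=> qn xn; rewrite word_act_iota //.
rewrite (word_act_delta (conv_form (@unit_family_perm K) q (iota 0 n))) => [|s].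
  rewrite -(conv_map _ _ _ _ (@unit_family_perm K) (@unit_family_natural K)).
  by rewrite -xn map_nth_iota0 ?take_size.
rewrite XiE descents_sub_word // -conv_unit_delta ?sort_perm_iota //.
  rewrite (perm_uniq (perm_wordP _ _)) ?iota_uniq ?size_iota //.
by rewrite size_perm_word.
Qed.

End XiAction.

(** * Compositions and descent sets *)

Lemma exists_rank_perm n (key : 'I_n -> nat) : injective key ->
  exists s : 'S_n, forall i j, (s i < s j)%N = (key i < key j)%N.
Proof.
move=> key_inj; pose low i := [set j | (key j < key i)%N].
have low_lt i : (#|low i| < n)%N.
  rewrite -[n in (_ < n)%N]card_ord; apply: proper_card; apply/properP; split.
    by apply/subsetP.
  by exists i; rewrite // inE ltnn.
have low_mono i j : (key i < key j)%N -> (#|low i| < #|low j|)%N.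
  move=> ij; apply: proper_card; apply/properP; split.
    by apply/subsetP => k; rewrite !inE => /ltn_trans; apply.
  by exists i; rewrite !inE ?ij ?ltnn.
have low_lt_eq i j : (#|low i| < #|low j|)%N = (key i < key j)%N.
  apply/idP/idP => [|/low_mono //]; apply: contraLR; rewrite -!leqNgt leq_eqVlt.
  by case/orP => [/eqP/key_inj->//|/low_mono/ltnW].
have rank_inj : injective (fun i => Ordinal (low_lt i)).
  move=> i j [] ij; apply: key_inj.
  by case: (ltngtP (key i) (key j)) => // /low_mono; [rewrite ij|rewrite -ij]; rewrite ltnn.
by exists (perm rank_inj) => i j; rewrite !permE /= low_lt_eq.
Qed.

Lemma descents_surj n (D : {set 'I_n}) : (forall i, i \in D -> (0 < i)%N) ->
  exists s : 'S_n, descents s = D.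
Proof.
(* [b i] counts the elements of [D] up to [i]. Each of them lowers [key] by [n], more than the gain
   of one position, and [i] is recovered as the remainder modulo [n]. *)
move=> D0; pose b (i : 'I_n) := #|[set d in D | (d <= i)%N]|.
have b_le i : (b i <= n)%N.
  by rewrite -[n in (_ <= n)%N]card_ord; apply: max_card.
pose key (i : 'I_n) := (i + n * (n - b i))%N.
have key_inj : injective key.
  move=> i j ij; apply: val_inj => /=.
  have := congr1 (modn^~ n) ij; rewrite /key /=.
  by rewrite ![(n * _)%N]mulnC ![(_ + _ * n)%N]addnC !modnMDl !modn_small.
have [s sP] := exists_rank_perm key_inj; exists s; apply/setP => i; rewrite inE.
apply/existsP/idP => [[h /andP[/eqP hi]]|iD].
  rewrite sP; apply: contraTT => iD.
  have bE : b i = b h.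
    congr (#|pred_of_set _|); apply/setP => d; rewrite !inE -hi leq_eqVlt ltnS.
    by case: eqP => // dh; rewrite (_ : d = i) ?(negPf iD) //; apply: val_inj; rewrite /= dh.
  by rewrite /key bE -leqNgt leq_add2r -hi.
have i0 := D0 i iD; have hn : (i.-1 < n)%N by have := ltn_ord i; lia.
exists (Ordinal hn); rewrite sP /= prednK // eqxx /=.
have bE : b i = (b (Ordinal hn)).+1.
  rewrite /b (_ : [set d in D | (d <= i)%N] = i |: [set d in D | (d <= Ordinal hn)%N]).
    by rewrite cardsU1 inE iD /=; case: leqP => //; lia.
  apply/setP => d; rewrite !inE -val_eqE /= leq_eqVlt -(prednK i0) ltnS.
  rewrite prednK //; case: eqP => //= di.
  by rewrite (_ : d = i) ?iD //; apply: val_inj.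
have := b_le i; rewrite /key /= bE; have := ltn_ord i; nia.
Qed.

Lemma scanl_gaps a l : path ltn a l ->
  scanl addn a (pairmap (fun x y => y - x)%N a l) = l /\
  0%N \notin pairmap (fun x y => y - x)%N a l.
Proof.
elim: l a => [|b l IHl] a //= /andP[ab /IHl[sE n0]].
by rewrite subnKC ?sE ?inE ?negb_or ?n0 ?andbT 1?ltnW //; split=> //; lia.
Qed.

Lemma path_scanl a c : 0%N \notin c -> path ltn a (scanl addn a c).
Proof.
elim: c a => [|b c IHc] a //=; rewrite inE negb_or => /andP[b0 /IHc->].
by rewrite andbT; lia.
Qed.

Lemma last_scanl a c : last a (scanl addn a c) = (a + sumn c)%N.
Proof. by elim: c a => [|b c IHc] a //=; rewrite ?addn0 // IHc addnA. Qed.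

Lemma word_set_surj n (D : {set 'I_n}) : (forall i, i \in D -> (0 < i)%N) ->
  exists2 c, c \in compositions n & word_set n c = D.
Proof.
case: n D => [|n] D D0; first by exists [::]; rewrite // ; apply/setP => [[]].
(* The composition consists of the gaps between the elements of [D]. The total is appended below so
   that the gaps add up to it; it is not a position and does not enter [word_set]. *)
pose l := [seq i <- iota 0 n.+1 | i \in map val (enum D)].
have lE (i : 'I_n.+1) : (val i \in l) = (i \in D).
  by rewrite mem_filter mem_iota /= add0n ltn_ord andbT (mem_map val_inj) mem_enum.
have lP : path ltn 0 (rcons l n.+1).
  rewrite -cats1 cat_path /= andbT path_min_sorted; last first.
    apply/allP => i; rewrite mem_filter => /andP[/mapP[j jD ->] _].
    by rewrite mem_enum in jD; apply: D0.
  apply/andP; split; first by apply: sorted_filter (iota_ltn_sorted _ _); apply: ltn_trans.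
  have := mem_last 0%N l; rewrite inE => /predU1P[->//|].
  by rewrite mem_filter mem_iota => /and3P[].
have [sE c0] := scanl_gaps lP.
exists (pairmap (fun x y => y - x)%N 0%N (rcons l n.+1)).
  by rewrite mem_compositions c0 -[sumn _]add0n -last_scanl sE last_rcons /=.
apply/setP => i; rewrite inE sE mem_rcons inE lE.
by case: eqP (ltn_ord i) => // ->; rewrite ltnn.
Qed.

Lemma scanl_le a c i : i \in scanl addn a c -> (i <= a + sumn c)%N.
Proof.
elim: c a => [|b c IHc] a //=; rewrite inE addnA => /predU1P[->|/IHc//].
exact: leq_addr.
Qed.

Lemma mem_scanl_sumn a c : c != [::] -> (a + sumn c)%N \in scanl addn a c.
Proof. by case: c => [|b c] //= _; rewrite addnA -last_scanl mem_last. Qed.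

Lemma word_set_inj n : {in compositions n &, injective (word_set n)}.
Proof.
move=> c d; rewrite !mem_compositions => /andP[c0 /eqP cn] /andP[d0 /eqP dn] /setP cd.
have nilE (e : seq nat) : 0%N \notin e -> (e == [::]) = (sumn e == 0%N).
  by case: e => [|[|k] e].
have scanlE : scanl addn 0%N c = scanl addn 0%N d.
  apply: (irr_sorted_eq ltn_trans ltnn); try exact: path_sorted (path_scanl 0 _).
  move=> i; have [i_lt|] := ltnP i n.
    by have := cd (Ordinal i_lt); rewrite !inE.
  rewrite leq_eqVlt => /predU1P[<-|n_lt].
    have [c_nil|c_cons] := eqVneq c [::].
      by move: dn; rewrite -cn c_nil => /eqP; rewrite -nilE // => /eqP->.
    rewrite -{1}cn -[sumn c]add0n mem_scanl_sumn // -dn -[sumn d]add0n.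
    by rewrite mem_scanl_sumn // nilE // dn -cn -nilE.
  by apply/idP/idP => /scanl_le; rewrite add0n ?cn ?dn leqNgt n_lt.
have addnK' (x : nat) : cancel (addn x) (fun y => y - x)%N by move=> y; apply: addKn.
by rewrite -(scanlK addnK' 0%N c) scanlE scanlK.
Qed.

(** * The length filtration of the descent algebra *)

Lemma word_set_gt0 n c (i : 'I_n) : 0%N \notin c -> i \in word_set n c -> (0 < i)%N.
Proof.
by move/(path_scanl 0)/(order_path_min ltn_trans)/allP => c0; rewrite inE => /c0.
Qed.

Definition support_word (q : seq nat) : seq nat := [seq a <- q | (0 < a)%N].

Lemma sumn_support q : sumn (support_word q) = sumn q.
Proof. by elim: q => [|[|a] q IHq] //=; rewrite IHq. Qed.

Lemma support_composition q : support_word q \in compositions (sumn q).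
Proof. by rewrite mem_compositions mem_filter sumn_support /= eqxx. Qed.

Lemma support_id q : 0%N \notin q -> support_word q = q.
Proof.
by move=> q0; apply/all_filterP/allP => a aq; rewrite lt0n; apply: contraNneq q0 => <-.
Qed.

Lemma coproduct_sumn delta r p :
  (forall a d, d \in delta a -> (sumn d.1 + sumn d.2)%N = a) ->
  p \in coproduct delta r -> (sumn p.1 + sumn p.2)%N = sumn r.
Proof.
move=> delta_sum; elim: r p => [|a r IHr] p /=; first by rewrite inE => /eqP->.
case/allpairsP=> [[d e] [/= /delta_sum <- /IHr <- ->]] /=.
by rewrite !sumn_cat addnACA.
Qed.

Lemma act_words_sumn delta q r s :
  (forall a d, d \in delta a -> (sumn d.1 + sumn d.2)%N = a) ->
  s \in act_words delta q r -> sumn s = sumn r.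
Proof.
move=> delta_sum; elim: q r s => [|a q IHq] r s /=.
  by case: ifP => // _; rewrite inE => /eqP->.
case/allpairsPdep=> p [t] []; rewrite mem_filter => /andP[_ pr] /IHq tp ->.
by rewrite sumn_cat tp -(coproduct_sumn delta_sum pr).
Qed.

(** [s] is a concatenation of blocks with sums q_1, q_2, ..., followed by zeros. A block with
    positive sum has a nonzero letter, so without its zeros [s] is at least as long as [q], with
    equality only if each block keeps a single letter. *)
Lemma act_words_support delta q r s : 0%N \notin q -> s \in act_words delta q r ->
  support_word s = q \/ (size q < size (support_word s))%N.
Proof.
elim: q r s => [|a q IHq] r s /=.
  move=> _; case: ifP => // /eqP r0; rewrite inE => /eqP->; left.
  by elim: r r0 => [|[] r IHr].
rewrite inE negb_or => /andP[a0 q0] /allpairsPdep[p [t] []].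
rewrite mem_filter => /andP[/eqP pa _] /(IHq _ _ q0) tq ->.
have := sumn_support p.1; rewrite pa /support_word filter_cat.
case: (filter _ p.1) => [|b [|c u]] /= => [a0'|ba|_]; first by rewrite -a0' in a0.
  rewrite addn0 in ba; rewrite ba.
  by case: tq => [<-|tq]; [left|right; rewrite ltnS].
right; rewrite !ltnS size_cat; have : (size q <= size (support_word t))%N.
  by case: tq => [->|/ltnW].
by rewrite /support_word => /leq_trans; apply; rewrite leq_addl.
Qed.

Lemma divided_delta_sumn a d : d \in divided_delta a -> (sumn d.1 + sumn d.2)%N = a.
Proof. by case/mapP=> b; rewrite mem_iota ltnS => ba ->; rewrite /= !addn0 subnKC. Qed.

Section DescentAlgebra.

Variables (K : fieldType) (n : nat).
Local Notation KS := (symalg K n).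
Local Notation D := (descent_algebra K n).
Local Notation X q := (Xi K (word_set n q)).

Lemma Xi_basis_ord (i : 'I_(size (compositions n))) :
  (Xi_basis K n)`_i = X (nth [::] (compositions n) i).
Proof. by rewrite (nth_map [::]). Qed.

Lemma Xi_basis_free : free (Xi_basis K n).
Proof.
apply/freeP => k k0 i; apply/eqP; apply: contraT => ki.
pose ws (j : 'I_(size (compositions n))) := word_set n (nth [::] (compositions n) j).
(* A largest set with nonzero coefficient is chosen. At a permutation with exactly this descent set,
   all other terms of the relation vanish. *)
case: (@arg_maxnP _ i (fun j => k j != 0) (fun j => #|ws j|) ki) => j kj jmax.
have comp_nth l : nth [::] (compositions n) (l : 'I_(size (compositions n))) \in compositions n.
  exact: mem_nth.
have [s sj] : exists s : 'S_n, descents s = ws j.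
  apply: descents_surj => l; apply: word_set_gt0.
  by have := comp_nth j; rewrite mem_compositions => /andP[].
have := congr1 (fun a : KS => a s) k0; rewrite /= sum_ffunE ffunE.
rewrite (bigD1 j) //= big1 => [|l lj].
  rewrite ffunE Xi_basis_ord XiE sj subxx [_ *: _]mulr1 addr0 => kj0.
  by rewrite kj0 eqxx in kj.
rewrite ffunE Xi_basis_ord XiE sj; have [->|kl] := eqVneq (k l) 0; first exact: scale0r.
case: (boolP (_ \subset _)) => [sub|_]; last exact: mulr0.
have jl : ws j = ws l by apply/eqP; rewrite eqEcard sub; apply: jmax.
case/eqP: lj; apply: val_inj; apply/eqP; rewrite /= -(nth_uniq [::] _ _ (compositions_uniq n)) //.
by apply/eqP; apply: (word_set_inj (comp_nth _) (comp_nth _)).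
Qed.

Lemma Delta_descent_algebra (E : {set 'I_n}) : Delta K E \in D.
Proof. by apply/memv_span/imageP; exists E. Qed.

Lemma Xi_descent_algebra (E : {set 'I_n}) : Xi K E \in D.
Proof. by apply: rpred_sum => F _; apply: Delta_descent_algebra. Qed.

Lemma Xi_basis_span : (<<Xi_basis K n>> = D)%VS.
Proof.
apply/vspaceP => a; apply/idP/idP; move: a; apply/subvP.
  by apply/span_subvP => _ /mapP[c _ ->]; apply: Xi_descent_algebra.
apply/span_subvP => _ /imageP[E _ ->].
have [m] := ubnP #|E|; elim: m E => // m IHm E; rewrite ltnS => Em.
(* Position 0 is never a descent, so a set containing it gives 0 and comes from no composition. *)
case: (boolP [exists i, (i \in E) && (i == 0 :> nat)]) => [/existsP[i /andP[iE /eqP i0]]|E0].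
  rewrite (_ : Delta K E = 0) ?mem0v //; apply/ffunP => s; rewrite !ffunE.
  case: eqP => // sE; have := descents_perm_word s i.
  by rewrite sE iE i0.
have [|c cn cE] := @word_set_surj n E.
  move=> i iE; rewrite lt0n; apply: contra E0 => i0.
  by apply/existsP; exists i; rewrite iE.
have : Xi K E \in <<Xi_basis K n>>%VS.
  by apply: memv_span; apply/mapP; exists c; rewrite // cE.
rewrite /Xi (bigD1 E) //= => sumE; set S := \sum_(F | _) _ in sumE.
rewrite -[Delta K E](addrK S) rpredB //.
apply: rpred_sum => F /andP[FE FE']; apply: IHm; apply: leq_trans Em.
by apply: proper_card; rewrite properEneq FE' FE.
Qed.

Lemma descent_coord a : a \in D ->
  a = \sum_i coord (Xi_basis K n) i a *: X (nth [::] (compositions n) i).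
Proof.
rewrite -Xi_basis_span => /coord_span {1}->.
by apply: eq_bigr => i _; rewrite Xi_basis_ord.
Qed.

Lemma descent_ind (P : KS -> Prop) :
  P 0 -> (forall c a b, P a -> P b -> P (c *: a + b)) ->
  (forall c, c \in compositions n -> P (X c)) -> forall a, a \in D -> P a.
Proof.
move=> P0 PZD PX a /descent_coord ->; apply: big_ind => // [b c Pb Pc|i _].
  by rewrite -[b]scale1r; apply: PZD.
by rewrite -[_ *: _]addr0; apply: PZD => //; apply/PX/mem_nth.
Qed.

Lemma Xi_support q : sumn q = n -> X (support_word q) = X q.
Proof.
move=> qn; apply: word_act_inj => f.
rewrite !word_act_Xi ?size_iota ?sumn_support //.
elim: q (iota 0 n) f {qn} => [|[|a] q IHq] x f //=.
  rewrite IHq -(unsh_nill x (fun _ z => conv (@unit_family K) q z f)) big_mkcond.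
  apply: eq_bigr => p _; rewrite /unit_family size_eq0.
  by case: eqP => [->|_]; rewrite ?mul1r ?mul0r.
apply: eq_bigr => p _; congr (_ * _); exact: IHq.
Qed.

(** Solomon's rule: [act_words] runs through the nonnegative integer matrices with row sums [q] and
    column sums [r], read row by row, with a final row of zeros. *)
Lemma Xi_mul q r : sumn q = n -> sumn r = n ->
  X q * X r = \sum_(s <- act_words divided_delta q r) X s.
Proof.
move=> qn rn; apply: word_act_inj => f.
rewrite word_actM ?size_iota // word_act_Xi ?size_iota // word_act_sum.
have formr := conv_form (@unit_family_perm K) r (iota 0 n).
rewrite (perm_form_ext formr (g := fun t => conv (@unit_family K) q t f)); last first.
  by move=> t /perm_size tn; rewrite word_act_Xi // tn size_iota.
rewrite (conv_act (@unit_family_perm K) (@unit_comultiplicative K)).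
rewrite [LHS]big_seq [RHS]big_seq; apply: eq_bigr => s /act_words_sumn sr.
by rewrite word_act_Xi ?size_iota // sr //; apply: divided_delta_sumn.
Qed.

Definition length_filter (k : nat) : {vspace KS} :=
  <<[seq X c | c <- compositions n & (k <= size c)%N]>>%VS.

Local Notation Fil := length_filter.

Lemma Xi_length_filter q k : sumn q = n -> (k <= size (support_word q))%N -> X q \in Fil k.
Proof.
move=> qn kq; rewrite -Xi_support //; apply/memv_span/map_f.
by rewrite mem_filter kq -qn support_composition.
Qed.

Lemma length_filterS k l : (k <= l)%N -> (Fil l <= Fil k)%VS.
Proof.
move=> kl; apply: sub_span => _ /mapP[c + ->]; rewrite mem_filter => /andP[lc cn].
by apply: map_f; rewrite mem_filter cn (leq_trans kl).
Qed.

Lemma length_filter0 : Fil 0 = D.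
Proof.
by rewrite -Xi_basis_span /Fil (_ : [seq _ <- _ | _] = compositions n) // filter_predT.
Qed.

Lemma length_filter_sub_descent k : (Fil k <= D)%VS.
Proof. by rewrite -length_filter0 length_filterS. Qed.

Lemma length_filter_eq0 k : (n < k)%N -> Fil k = 0%VS.
Proof.
move=> nk; rewrite /Fil (_ : [seq _ <- _ | _] = [::]) ?span_nil //.
apply/eqP; rewrite -[_ == _]negbK -has_filter; apply/hasPn => c.
rewrite mem_compositions => /andP[c0 /eqP cn]; rewrite -ltnNge; apply: leq_ltn_trans nk.
by rewrite -cn; elim: c c0 {cn} => [|[|a] c IHc] //= /IHc; lia.
Qed.

(** The coefficient at Xi^q, written as a sum over matching indices so that it is defined, with
    value 0, also when [q] is not a composition of [n]. *)
Definition Xi_coef (q : seq nat) (a : KS) : K :=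
  \sum_(i < size (compositions n) | nth [::] (compositions n) i == q) coord (Xi_basis K n) i a.

Lemma Xi_coefZD q c a b : Xi_coef q (c *: a + b) = c * Xi_coef q a + Xi_coef q b.
Proof. by rewrite big_distrr -big_split; apply: eq_bigr => i _; rewrite linearP. Qed.

Lemma Xi_coefE q c : c \in compositions n -> Xi_coef q (X c) = (c == q)%:R.
Proof.
move=> cn; have c_lt : (index c (compositions n) < size (compositions n))%N.
  by rewrite index_mem.
have coordE i : coord (Xi_basis K n) i (X c) = (nth [::] (compositions n) i == c)%:R.
  have -> : X c = (Xi_basis K n)`_(Ordinal c_lt) by rewrite Xi_basis_ord /= nth_index.
  rewrite coord_free ?Xi_basis_free // -{2}(nth_index [::] cn).
  by rewrite nth_uniq ?compositions_uniq // eq_sym.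
rewrite /Xi_coef; have [<-|cq] := eqVneq c q.
  rewrite (bigD1 (Ordinal c_lt)) /= ?nth_index // coordE /= nth_index // eqxx.
  rewrite big1 ?addr0 // => i /andP[/eqP ic]; rewrite -val_eqE /=.
  by rewrite -ic index_uniq ?compositions_uniq ?eqxx.
rewrite big1 // => i /eqP iq; rewrite coordE iq.
by rewrite eq_sym (negPf cq).
Qed.

Lemma Xi_coef_filter q a : a \in Fil (size q).+1 -> Xi_coef q a = 0.
Proof.
have coef0 b c : Xi_coef q b = 0 -> Xi_coef q c = 0 -> Xi_coef q (b + c) = 0.
  by move=> b0 c0; rewrite -[b]scale1r Xi_coefZD b0 c0 mulr0 addr0.
have zero0 : Xi_coef q 0 = 0 by rewrite /Xi_coef big1 // => i _; rewrite linear0.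
move=> aF; rewrite (@coord_span _ _ _
  (in_tuple [seq X c | c <- compositions n & ((size q).+1 <= size c)%N]) a aF).
apply: (big_ind (fun b => Xi_coef q b = 0)) => // i _.
rewrite -[_ *: _]addr0 Xi_coefZD zero0 addr0.
have /mapP[c + ->] := mem_nth 0 (ltn_ord i); rewrite mem_filter => /andP[qc cn].
by rewrite Xi_coefE //; case: eqP qc => [->|_ _]; rewrite ?ltnn ?mulr0.
Qed.

Lemma Xi_mulP q a : q \in compositions n -> a \in D ->
  exists c, X q * a - c *: X q \in Fil (size q).+1.
Proof.
rewrite mem_compositions => /andP[q0 /eqP qn]; move: a; apply: descent_ind.
- by exists 0; rewrite mulr0 scale0r subr0 mem0v.
- move=> k a b [c ca] [d db]; exists (k * c + d).
  rewrite mulrDr -scalerAr scalerDl -scalerA opprD addrACA -scalerBr.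
  by rewrite rpredD ?rpredZ.
move=> r; rewrite mem_compositions => /andP[_ /eqP rn]; rewrite Xi_mul //.
have sumP s : s \in act_words divided_delta q r -> sumn s = n.
  by move/act_words_sumn=> ->; rewrite ?rn // => *; apply: divided_delta_sumn.
(* The coefficient counts the terms of Solomon's rule that reduce to [q]; all others are longer by
   [act_words_support]. *)
exists (count (fun s => support_word s == q) (act_words divided_delta q r))%:R.
rewrite -sum1_count natr_sum scaler_suml [Z in _ - Z]big_mkcond -sumrB big_seq.
apply: rpred_sum => s sqr.
have sn := sumP s sqr; case: ifPn => [/eqP sq|sq].
  by rewrite scale1r -Xi_support // sq subrr mem0v.
rewrite subr0; apply: Xi_length_filter => //.
by case: (act_words_support q0 sqr) => // sq'; rewrite sq' eqxx in sq.
Qed.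

Lemma descent_mul a b : a \in D -> b \in D -> a * b \in D.
Proof.
move=> aD bD; move: a aD; apply: descent_ind.
- by rewrite mul0r mem0v.
- by move=> c a a' aD aD'; rewrite mulrDl -scalerAl rpredD ?rpredZ.
move=> q qn; have [c] := Xi_mulP qn bD.
move/(subvP (length_filter_sub_descent _)) => H.
by rewrite -(subrK (c *: X q) (X q * b)) rpredD ?rpredZ ?Xi_descent_algebra.
Qed.

Lemma length_filter_mulr k a b : a \in Fil k -> b \in D -> a * b \in Fil k.
Proof.
move=> aF bD; have : (Fil k <= amulr b @^-1: Fil k)%VS.
  apply/span_subvP => _ /mapP[c + ->]; rewrite mem_filter => /andP[kc cn].
  rewrite -memv_preim lfunE /=; have [e] := Xi_mulP cn bD.
  move/(subvP (length_filterS (leqW kc))) => H.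
  rewrite -(subrK (e *: X c) (X c * b)) rpredD ?rpredZ //.
  by apply/memv_span/map_f; rewrite mem_filter kc.
by move/subvP/(_ a aF); rewrite -memv_preim lfunE.
Qed.

(* The character through which the descent algebra acts, from the right, on  *)
(* the line of Xi^q modulo the Xi^s with s longer than q.                     *)
Definition chi (q : seq nat) (a : KS) : K := Xi_coef q (X q * a).

Lemma chiZD q c a b : chi q (c *: a + b) = c * chi q a + chi q b.
Proof. by rewrite /chi mulrDr -scalerAr Xi_coefZD. Qed.

Lemma chi_eq q a c : q \in compositions n ->
  X q * a - c *: X q \in Fil (size q).+1 -> chi q a = c.
Proof.
move=> qn cF; rewrite /chi -[X q * a](subrK (c *: X q)) addrC Xi_coefZD.
by rewrite (Xi_coef_filter cF) addr0 Xi_coefE // eqxx mulr1.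
Qed.

Lemma chi_filter q a : q \in compositions n -> a \in D ->
  X q * a - chi q a *: X q \in Fil (size q).+1.
Proof. by move=> qn aD; have [c cF] := Xi_mulP qn aD; rewrite (chi_eq qn cF). Qed.

Lemma chiM q a b : q \in compositions n -> a \in D -> b \in D ->
  chi q (a * b) = chi q a * chi q b.
Proof.
move=> qn aD bD; apply: chi_eq => //.
(* Modulo longer words [a] is replaced by its scalar before [b] is applied; the filtration is stable
   under right multiplication. *)
have -> : X q * (a * b) - (chi q a * chi q b) *: X q =
    (X q * a - chi q a *: X q) * b + chi q a *: (X q * b - chi q b *: X q).
  by rewrite mulrBl -scalerAl scalerBr scalerA mulrA addrA subrK.
by rewrite rpredD ?rpredZ ?chi_filter // length_filter_mulr ?chi_filter.
Qed.

End DescentAlgebra.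

(** * Valleys *)

Section Valleys.

Variable K : fieldType.
Implicit Types (w : nat -> nat -> K).

(** Reversal is the antipode up to the sign (-1)^k. On an increasing word the terms first decrease
    and then increase. The constant weight 1 gives the peak generator, [dynkin_weight] gives
    omega. *)
Definition valley_family w (a : nat) (x : seq nat) (f : seq nat -> K) : K :=
  (size x == a)%:R *
  \sum_(p <- unshuffles x) w (size p.1) (size p.2) * f (rev p.1 ++ p.2).

Lemma valley_family_perm w : perm_family (valley_family w).
Proof.
split=> [a x|a x f /negPf xa]; last by rewrite /valley_family xa mul0r.
split=> [c f g|f g fg].
  rewrite /valley_family.
  under eq_bigr => p _ do rewrite mulrDr mulrCA.
  by rewrite big_split -big_distrr /= mulrDr mulrCA.
congr (_ * _); apply: eq_big_seq => p px; rewrite fg // -(permPr (unsh_perm px)).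
by rewrite perm_cat2r perm_rev.
Qed.

Lemma valley_family_natural w : natural_family (valley_family w).
Proof.
move=> a h x f; rewrite /valley_family size_map; congr (_ * _).
rewrite (unsh_map h x (fun y z => w (size y) (size z) * f (rev y ++ z))).
by apply: eq_bigr => p _; rewrite !size_map map_cat map_rev.
Qed.

Lemma valley_unsh w x (f : seq nat -> seq nat -> K) :
  \sum_(p <- unshuffles x) w (size p.1) (size p.2) *
     \sum_(r <- unshuffles (rev p.1 ++ p.2)) f r.1 r.2 =
  \sum_(p <- unshuffles x) \sum_(r <- unshuffles p.1) \sum_(s <- unshuffles p.2)
     w (size r.1 + size s.1)%N (size r.2 + size s.2)%N *
     f (rev r.1 ++ r.2) (rev s.1 ++ s.2).
Proof.
rewrite (unsh_exchange x (fun y1 y2 z1 z2 => w (size y1 + size z1)%N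
  (size y2 + size z2)%N * f (rev y1 ++ y2) (rev z1 ++ z2))).
apply: eq_bigr => p _; rewrite unsh_cat big_distrr /=.
rewrite (unsh_rev p.1 (fun y z => w (size p.1) (size p.2) *
  \sum_(r <- unshuffles p.2) f (y ++ r.1) (z ++ r.2))).
rewrite big_seq [RHS]big_seq; apply: eq_bigr => r rp; rewrite big_distrr /=.
by apply: eq_big_seq => s sp; rewrite (unsh_size rp) (unsh_size sp).
Qed.

Lemma unsh_antipode (x : seq nat) (f : seq nat -> K) :
  \sum_(p <- unshuffles x) (-1) ^+ size p.1 * f (rev p.1 ++ p.2) =
  (x == [::])%:R * f [::].
Proof.
case: x => [|a x] /=; first by rewrite big_seq1 /= expr0 !mul1r.
rewrite mul0r big_cat !big_map /= -big_split big1 //= => p _.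
by rewrite exprS rev_cons cat_rcons mulN1r mulNr addNr.
Qed.

Lemma comultiplicative1 G a x (f : seq nat -> seq nat -> K) : perm_family G ->
  \sum_(d <- primitive_delta a) \sum_(p <- unshuffles x)
      conv G d.1 p.1 (fun t => conv G d.2 p.2 (f t)) =
  G a x (fun t => f t [::]) + G a x (f [::]).
Proof.
move=> famG; rewrite big_cons big_seq1; congr (_ + _).
  rewrite -(unsh_nilr x (fun y z => G a y (fun t => f t [::]))) [RHS]big_mkcond.
  apply: eq_bigr => p _; rewrite conv1 // (perm_formZ (famG.1 a p.1)).
  by case: eqP => _; rewrite ?mul1r ?mul0r.
rewrite -(unsh_nill x (fun y z => G a z (f [::]))) [RHS]big_mkcond.
apply: eq_bigr => p _; rewrite [LHS]/=; case: eqP => _; rewrite ?mul1r ?mul0r //.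
exact: (conv1 famG a p.2 (f [::])).
Qed.

Lemma valley1_comultiplicative :
  comultiplicative (valley_family (fun _ _ => 1)) divided_delta.
Proof.
move=> a x f; rewrite (sum_divided_delta _ (fun u v => \sum_(p <- unshuffles x)
  conv _ u p.1 (fun t => conv _ v p.2 (f t)))) [LHS]/valley_family.
rewrite (valley_unsh (fun _ _ => 1)) -(divided_comul_sizes a x (fun y z =>
  \sum_(r <- unshuffles y) \sum_(s <- unshuffles z)
     1 * f (rev r.1 ++ r.2) (rev s.1 ++ s.2))).
apply: eq_bigr => b _; apply: eq_bigr => p _.
rewrite [RHS](conv1 (valley_family_perm _)) [RHS]/valley_family; congr (_ * _).
rewrite big_distrr; apply: eq_bigr => r _.
rewrite [RHS]mul1r [RHS](conv1 (valley_family_perm _)); congr (_ * _).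
Qed.

(* Dynkin's omega is the convolution of the antipode with the degree operator. *)
Definition dynkin_weight (k l : nat) : K := (-1) ^+ k * l%:R.

(** The weight of a fourfold unshuffle splits into two terms, as the length factor is additive. In
    each term one half carries a pure sign and collapses by [unsh_antipode], which leaves the two
    primitive terms. *)
Lemma dynkin_comultiplicative :
  comultiplicative (valley_family dynkin_weight) primitive_delta.
Proof.
move=> a x f; rewrite comultiplicative1; last exact: valley_family_perm.
rewrite /valley_family -mulrDr valley_unsh; congr (_ * _).
pose W (y z : seq nat) := dynkin_weight (size y) (size z).
pose S (y : seq nat) : K := (-1) ^+ size y.
transitivity
 (\sum_(p <- unshuffles x) \sum_(r <- unshuffles p.1) \sum_(s <- unshuffles p.2)
    W r.1 r.2 * (S s.1 * f (rev r.1 ++ r.2) (rev s.1 ++ s.2)) +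
  \sum_(p <- unshuffles x) \sum_(r <- unshuffles p.1) \sum_(s <- unshuffles p.2)
    S r.1 * f (rev r.1 ++ r.2) (rev s.1 ++ s.2) * W s.1 s.2).
  rewrite -big_split; apply: eq_bigr => p _; rewrite -big_split; apply: eq_bigr => r _.
  rewrite -big_split; apply: eq_bigr => s _; rewrite /W /S /dynkin_weight /= exprD natrD.
  ring.
congr (_ + _).
  rewrite -(unsh_nilr x (fun y _ => \sum_(r <- unshuffles y)
    W r.1 r.2 * f (rev r.1 ++ r.2) [::])) [RHS]big_mkcond.
  apply: eq_bigr => p _.
  under eq_bigr => r _ do rewrite -big_distrr /= unsh_antipode.
  by case: eqP => _; [apply: eq_bigr => r _; rewrite mul1r|
    rewrite big1 // => r _; rewrite mul0r mulr0].
rewrite -(unsh_nill x (fun _ z => \sum_(s <- unshuffles z)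
    W s.1 s.2 * f [::] (rev s.1 ++ s.2))) [RHS]big_mkcond.
apply: eq_bigr => p _; rewrite exchange_big /=.
under eq_bigr => s _.
  rewrite -big_distrl /= (unsh_antipode p.1 (f^~ (rev s.1 ++ s.2))); over.
by case: eqP => _; [apply: eq_bigr => r _; rewrite mul1r mulrC|
    rewrite big1 // => r _; rewrite !mul0r].
Qed.

(** [j] is the position of the minimum, shared by the decreasing and the increasing part; in
    [split_valley] the two parts are disjoint. *)
Definition valley (j : nat) (t : seq nat) : bool :=
  sorted leq (rev (take j.+1 t)) && sorted leq (drop j t).

Definition split_valley (k : nat) (t : seq nat) : bool :=
  sorted leq (rev (take k t)) && sorted leq (drop k t).

Lemma split_valleyE u v : uniq (u ++ v) -> u ++ v != [::] ->
  (split_valley (size u) (u ++ v))%:R =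
  ((v != [::]) && valley (size u) (u ++ v))%:R +
  ((u != [::]) && valley (size u).-1 (u ++ v))%:R :> K.
Proof.
case/lastP: u => [|u a].
  by case: v => [|b v] // _ _; rewrite /split_valley /valley /= take0 addr0.
have take_u : take (size u).+1 (rcons u a ++ v) = rcons u a.
  by rewrite take_size_cat ?size_rcons.
have drop_u : drop (size u) (rcons u a ++ v) = a :: v.
  by rewrite cat_rcons drop_size_cat.
have drop_u1 : drop (size u).+1 (rcons u a ++ v) = v.
  by rewrite drop_size_cat ?size_rcons.
rewrite /split_valley /valley size_rcons /= drop_u take_u drop_u1 rev_rcons.
have -> : (rcons u a != [::]) by case: u {take_u drop_u drop_u1}.
case: v {take_u drop_u drop_u1} => [|b v] uv _ /=; first by rewrite add0r.
have -> : take (size u).+2 (rcons u a ++ b :: v) = rcons (rcons u a) b.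
  by rewrite -cat_rcons take_size_cat ?size_rcons.
rewrite !rev_rcons /=.
have ab : a != b.
  by apply: contraTneq uv => ->; rewrite cat_uniq /= mem_rcons mem_head andbF.
by case: ltngtP ab => //= ab _; rewrite ?andbF ?addr0 ?add0r.
Qed.

(** A valley with bottom [j] arises from the cuts just before and just after its bottom, hence the
    two consecutive weights. *)
Lemma sum_split_valley (w : nat -> K) t : uniq t -> t != [::] ->
  \sum_(k < (size t).+1) w k * (split_valley k t)%:R =
  \sum_(j < size t) (w j + w j.+1) * (valley j t)%:R.
Proof.
move=> ut t0.
transitivity (\sum_(k < (size t).+1) w k * (((k < size t)%N && valley k t)%:R +
   ((0 < k)%N && valley k.-1 t)%:R)).
  apply: eq_bigr => k _; congr (_ * _); have kt : (k <= size t)%N by rewrite -ltnS.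
  have := @split_valleyE (take k t) (drop k t).
  rewrite cat_take_drop size_takel // => -> //; congr ((_ && _)%:R + (_ && _)%:R).
    by rewrite -size_eq0 size_drop subn_eq0 -ltnNge.
  by rewrite -size_eq0 size_takel // lt0n.
under eq_bigr => k _ do rewrite mulrDr.
rewrite big_split /= big_ord_recr /= ltnn mulr0 addr0 big_ord_recl /= mulr0 add0r.
by rewrite -big_split; apply: eq_bigr => k _; rewrite ltn_ord /= mulrDl.
Qed.

Lemma valley_uniq i j t : uniq t -> (i < size t)%N -> (j < size t)%N ->
  valley i t -> valley j t -> i = j.
Proof.
move=> ut it jt; wlog ij : i j it jt / (i < j)%N => [H vi vj|].
  by case: (ltngtP i j) => // ?; [apply: H|apply/esym/H].
case/andP=> _ /(sortedP 0%N) /(_ 0%N); rewrite size_drop !nth_drop addn0 addn1 => up.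
case/andP; rewrite rev_sorted => /(sortedP 0%N) /(_ i) down _.
have up' : (nth 0%N t i <= nth 0%N t i.+1)%N by apply: up; rewrite ltn_subRL addn1 (leq_ltn_trans ij).
have down' : (nth 0%N t i.+1 <= nth 0%N t i)%N.
  by move: down; rewrite size_takel // ltnS => /(_ ij); rewrite !nth_take // ltnS ltnW.
have : nth 0%N t i != nth 0%N t i.+1.
  by rewrite nth_uniq ?(leq_ltn_trans ij) // neq_ltn ltnSn.
by rewrite eqn_leq up' down'.
Qed.

Lemma valley_family_delta w t : uniq t ->
  valley_family w (size t) (sort leq t) (fun s => (s == t)%:R) =
  \sum_(k < (size t).+1) w k (size t - k)%N * (split_valley k t)%:R.
Proof.
move=> ut; rewrite /valley_family size_sort eqxx mul1r.
transitivity (\sum_(p <- unshuffles (sort leq t)) \sum_(k < (size t).+1)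
   (if p.1 == rev (take k t) then
     w k (size t - k)%N * (p.2 == drop k t)%:R else 0)).
  apply: eq_big_seq => p px; have pt := unsh_size px; rewrite size_sort in pt.
  have pt' : (size p.1 < (size t).+1)%N by rewrite ltnS -pt leq_addr.
  rewrite (bigD1 (Ordinal pt')) //= big1 => [|k]; last first.
    move=> kp; case: eqP => // pE; case/negP: kp.
    by rewrite -val_eqE /= pE size_rev size_takel // -ltnS.
  rewrite addr0 -pt addKn -{1}(cat_take_drop (size p.1) t) eqseq_cat; last first.
    by rewrite size_rev size_takel // -ltnS.
  by rewrite (can2_eq revK revK); case: ifP => //; rewrite mulr0.
rewrite exchange_big; apply: eq_bigr => k _ /=; rewrite -big_mkcond /=.
have kt : (k <= size t)%N by rewrite -ltnS.
rewrite /split_valley; have [sk|sk] := boolP (sorted leq (rev (take k t))).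
  have revE : rev (take k t) = filter (mem (take k t)) (sort leq t).
    rewrite filter_sort_take // -(perm_sortP leq_total leq_trans anti_leq _ _ (permEl (perm_rev _))).
    by rewrite (sorted_sort leq_trans sk).
  rewrite revE (unsh_filter _ (fun _ z => w k (size t - k)%N * (z == drop k t)%:R)).
    rewrite filter_sort_drop // [RHS]/=; congr (_ * (nat_of_bool _)%:R).
    apply/idP/idP => [/eqP<-|/(sorted_sort leq_trans)->//].
    exact: (sort_sorted leq_total).
  by rewrite sort_uniq.
rewrite mulr0 big_seq_cond big_pred0 // => p; apply/andP => -[px /eqP p1].
case/negP: sk; rewrite -p1; apply: (subseq_sorted leq_trans (unsh_subseq px)).
exact: (sort_sorted leq_total).
Qed.

End Valleys.

(** * The outer product *)

Lemma mem_scanl_hook a k l i :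
  (i \in scanl addn a (rcons (nseq k 1%N) l)) = (a < i <= a + k)%N || (i == a + k + l)%N.
Proof.
elim: k a => [|k IHk] a /=; first by rewrite inE addn0; lia.
by rewrite inE IHk; lia.
Qed.

Definition hook_set n j : {set 'I_n} := word_set n (rcons (nseq j 1%N) (n - j)%N).

Lemma mem_hook_set n j (i : 'I_n) : (j <= n)%N -> (i \in hook_set n j) = (0 < i <= j)%N.
Proof. by move=> jn; rewrite inE mem_scanl_hook; have := ltn_ord i; lia. Qed.

Lemma valley_descents n (s : 'S_n) j : (j < n)%N ->
  valley j (perm_word (iota 0 n) s) = (descents s == hook_set n j).
Proof.
move=> jn; set t := perm_word _ s; have st : size t = n by rewrite size_perm_word.
have ut : uniq t by rewrite (perm_uniq (perm_wordP _ _)) ?size_iota ?iota_uniq.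
have desE (i : 'I_n) : (i \in descents s) = (0 < i)%N && (nth 0%N t i < nth 0%N t i.-1)%N.
  rewrite descents_perm_word; case: (posnP i) => //= i0.
  by rewrite /descent_pattern !nth_take // !nth_drop addn0 addn1 prednK.
have neq i : (i.+1 < n)%N -> nth 0%N t i != nth 0%N t i.+1.
  by move=> i_lt; rewrite nth_uniq ?st ?(ltnW i_lt) // neq_ltn ltnSn.
apply/andP/eqP => [[]|sj].
  rewrite rev_sorted => /(sortedP 0%N) down /(sortedP 0%N) up.
  apply/setP => i; rewrite desE mem_hook_set ?(ltnW jn) //.
  case: (posnP i) => //= i0; have in_ := ltn_ord i.
  case: (leqP i j) => ij.
    have down_i : (nth 0%N t i <= nth 0%N t i.-1)%N.
      have := down i.-1; rewrite size_takel ?st // prednK // ltnS => /(_ ij).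
      by rewrite !nth_take // ltnS (leq_trans (leq_pred _)).
    move: down_i; rewrite leq_eqVlt => /orP[/eqP tE|//].
    by have := neq i.-1; rewrite prednK // tE eqxx => /(_ in_).
  have := up (i.-1 - j)%N; rewrite size_drop st !nth_drop.
  have -> : (j + (i.-1 - j).+1)%N = i by lia.
  have -> : (j + (i.-1 - j))%N = i.-1 by lia.
  by move=> up_i; apply/negbTE; rewrite -leqNgt; apply: up_i; lia.
split.
  rewrite rev_sorted; apply/(sortedP 0%N) => i; rewrite size_takel ?st // ltnS => ij.
  have i_lt : (i.+1 < n)%N by lia.
  have tE := desE (Ordinal i_lt); rewrite sj mem_hook_set ?(ltnW jn) //= ij in tE.
  by rewrite !nth_take ?ltnS ?(ltnW ij) // ltnW // -tE.
apply/(sortedP 0%N) => i; rewrite size_drop st => ij; rewrite !nth_drop.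
have i_lt : ((j + i).+1 < n)%N by lia.
have := desE (Ordinal i_lt); rewrite sj mem_hook_set ?(ltnW jn) //= => tE.
by rewrite addnS leqNgt -tE; lia.
Qed.

Section ValleyElements.

Variable K : fieldType.

(** The coefficients are those of [sum_split_valley], so that the element acts on words as
    [valley_family w]. *)
Definition valley_element (w : nat -> nat -> K) n : symalg K n :=
  \sum_(j < n) (w j (n - j)%N + w j.+1 (n - j.+1)%N) *: Delta K (hook_set n j).

Lemma valley_element_descent w n : valley_element w n \in descent_algebra K n.
Proof. by apply: rpred_sum => j _; rewrite rpredZ ?Delta_descent_algebra. Qed.

Lemma word_act_valley w n x f : (0 < n)%N -> size x = n ->
  word_act (valley_element w n) x f = valley_family w n x f.
Proof.
move=> n0 xn; rewrite word_act_iota //.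
rewrite (word_act_delta ((valley_family_perm w).1 n (iota 0 n))) => [|s].
  by rewrite -valley_family_natural -xn map_nth_iota0 ?take_size.
have st : size (perm_word (iota 0 n) s) = n by rewrite size_perm_word.
have ut : uniq (perm_word (iota 0 n) s).
  by rewrite (perm_uniq (perm_wordP _ _)) ?size_iota ?iota_uniq.
have t0 : perm_word (iota 0 n) s != [::] by rewrite -size_eq0 st -lt0n.
have := valley_family_delta w ut; rewrite st sort_perm_iota => ->.
have := sum_split_valley (fun k => w k (n - k)%N) ut t0; rewrite st => ->.
rewrite sum_ffunE; apply: eq_bigr => j _.
by rewrite !ffunE valley_descents.
Qed.

(** Two consecutive Dynkin weights combine to (-1)^j ((n - j) - (n - j - 1)) = (-1)^j. *)
Lemma omega_valley n : omega K n = valley_element (@dynkin_weight K) n.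
Proof.
apply: eq_bigr => j _; congr (_ *: _).
rewrite /dynkin_weight exprS mulN1r mulNr -mulrBr -natrB ?leq_sub2l //.
have -> : (n - j - (n - j.+1))%N = 1%N by have := ltn_ord j; lia.
by rewrite mulr1.
Qed.

(** The identity has coefficient 1, since only the hook set with j = 0 is empty. *)
Lemma omega_neq0 n : (0 < n)%N -> omega K n != 0.
Proof.
move=> n0; have omegaE : omega K n = \sum_(j < n) (-1) ^+ j *: Delta K (hook_set n j) by [].
have des1 : descents (1%g : 'S_n) = set0.
  apply/setP => i; rewrite !inE; apply/negbTE/existsP => -[h /andP[/eqP hi]].
  by rewrite !perm1 -hi ltnNge leqnSn.
have hookE j : (j < n)%N -> (set0 == hook_set n j) = (j == 0%N).
  move=> jn; apply/eqP/eqP => [/setP hook0|->]; last first.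
    by apply/setP => i; rewrite mem_hook_set // inE; case: (i : nat).
  apply/eqP; rewrite -leqn0 leqNgt; apply/negP => j0.
  by have := hook0 (Ordinal jn); rewrite mem_hook_set ?(ltnW jn) // inE /= j0 leqnn.
apply/eqP => /ffunP/(_ 1%g); rewrite omegaE sum_ffunE ffunE.
rewrite (bigD1 (Ordinal n0)) //= big1 => [|j j0].
  rewrite !ffunE des1 hookE // [_ *: _]mulr1 addr0 => /eqP.
  by rewrite oner_eq0.
by rewrite !ffunE des1 hookE // -[_ == 0%N]/(j == Ordinal n0) (negPf j0) [_ *: _]mulr0.
Qed.

(* Twice the sum of the permutations without peaks: each of them has exactly  *)
(* two decompositions into a decreasing and an increasing part.               *)
Definition peak_generator n : symalg K n := valley_element (fun _ _ => 1) n.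

End ValleyElements.

Section OuterProduct.

Variable K : fieldType.
Local Notation X n q := (Xi K (word_set n q)).

Lemma outer_descent m n (a : symalg K m) (b : symalg K n) :
  outer_product a b \in descent_algebra K (m + n).
Proof.
by apply: rpred_sum => i _; apply: rpred_sum => j _; rewrite rpredZ ?Xi_descent_algebra.
Qed.

Lemma nth_compositions n (i : 'I_(size (compositions n))) :
  nth [::] (compositions n) i \in compositions n.
Proof. exact: mem_nth. Qed.

(** The outer product is defined by coordinates in the Xi basis; here it is identified with
    convolution on words. *)
Lemma word_act_outer m n (a : symalg K m) (b : symalg K n) x f :
  a \in descent_algebra K m -> b \in descent_algebra K n -> size x = (m + n)%N ->
  word_act (outer_product a b) x f =
  \sum_(p <- unshuffles x) (size p.1 == m)%:R *
    word_act a p.1 (fun t => word_act b p.2 (fun s => f (t ++ s))).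
Proof.
move=> aD bD xmn; rewrite word_act_sum.
transitivity (\sum_(i < size (compositions m)) \sum_(j < size (compositions n))
  \sum_(p <- unshuffles x) (size p.1 == m)%:R *
    (coord (Xi_basis K m) i a * coord (Xi_basis K n) j b *
      word_act (X m (nth [::] (compositions m) i)) p.1 (fun t =>
         word_act (X n (nth [::] (compositions n) j)) p.2 (fun s => f (t ++ s))))).
  apply: eq_bigr => i _; rewrite word_act_sum; apply: eq_bigr => j _.
  have := nth_compositions i; rewrite mem_compositions => /andP[_ /eqP ci].
  have := nth_compositions j; rewrite mem_compositions => /andP[_ /eqP cj].
  have famh := @unit_family_perm K.
  rewrite word_actZ word_act_Xi ?sumn_cat ?ci ?cj // conv_cat // big_distrr /=.
  apply: eq_big_seq => p px; have := unsh_size px; rewrite xmn => pmn.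
  have [pm|pm] := eqVneq (size p.1) m; last first.
    by rewrite conv_size ?ci // mulr0 mul0r.
  have pn : size p.2 = n by move: pmn; rewrite pm => /addnI.
  rewrite mul1r word_act_Xi //; congr (_ * _).
  apply: (perm_form_ext (conv_form famh _ _)) => t _.
  by rewrite word_act_Xi.
under eq_bigr => i _ do rewrite exchange_big.
rewrite exchange_big; apply: eq_big_seq => p px.
under eq_bigr => i _ do rewrite -big_distrr.
rewrite -big_distrr /=.
have [pm|pm] := eqVneq (size p.1) m; last by rewrite !mul0r.
rewrite !mul1r; rewrite [Z in word_act Z p.1](descent_coord aD) word_act_sum.
apply: eq_bigr => i _; rewrite word_actZ.
have formi := word_act_form (X m (nth [::] (compositions m) i)) pm.
rewrite (perm_form_ext formi (g := fun t => \sum_(j < size (compositions n))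
  coord (Xi_basis K n) j b * word_act (X n (nth [::] (compositions n) j)) p.2
    (fun s => f (t ++ s)))).
  rewrite (perm_form_sum formi) big_distrr; apply: eq_bigr => j _ /=.
  by rewrite (perm_formZ formi) mulrA.
move=> t _; rewrite {1}(descent_coord bD) word_act_sum.
by apply: eq_bigr => j _; rewrite word_actZ.
Qed.

Lemma outer_Xi m n q r : q \in compositions m -> r \in compositions n ->
  outer_product (X m q) (X n r) = X (m + n) (q ++ r).
Proof.
rewrite !mem_compositions => /andP[_ /eqP qm] /andP[_ /eqP rn].
apply: word_act_inj => f; rewrite word_act_outer ?Xi_descent_algebra ?size_iota //.
have famh := @unit_family_perm K.
rewrite word_act_Xi ?sumn_cat ?qm ?rn ?size_iota // conv_cat //.
apply: eq_big_seq => p px; have := unsh_size px; rewrite size_iota => pmn.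
have [pm|pm] := eqVneq (size p.1) m; last by rewrite conv_size ?qm // mul0r.
have pn : size p.2 = n by move: pmn; rewrite pm => /addnI.
rewrite mul1r word_act_Xi //; apply: (perm_form_ext (conv_form famh _ _)) => t _.
by rewrite word_act_Xi.
Qed.

Lemma outerDl m n k (a b : symalg K m) (c : symalg K n) :
  outer_product (k *: a + b) c = k *: outer_product a c + outer_product b c.
Proof.
rewrite /outer_product scaler_sumr -big_split; apply: eq_bigr => i _.
rewrite scaler_sumr -big_split; apply: eq_bigr => j _ /=.
by rewrite linearP mulrDl scalerDl scalerA mulrA.
Qed.

Lemma outerDr m n k (a : symalg K m) (b c : symalg K n) :
  outer_product a (k *: b + c) = k *: outer_product a b + outer_product a c.
Proof.
rewrite /outer_product scaler_sumr -big_split; apply: eq_bigr => i _.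
rewrite scaler_sumr -big_split; apply: eq_bigr => j _ /=.
by rewrite linearP mulrDr scalerDl scalerA mulrCA.
Qed.

Lemma outerBl m n k (a b : symalg K m) (c : symalg K n) :
  outer_product (a - k *: b) c = outer_product a c - k *: outer_product b c.
Proof. by rewrite addrC -scaleNr outerDl scaleNr addrC. Qed.

Lemma outerBr m n k (a : symalg K m) (b c : symalg K n) :
  outer_product a (b - k *: c) = outer_product a b - k *: outer_product a c.
Proof. by rewrite addrC -scaleNr outerDr scaleNr addrC. Qed.

Lemma outer0l m n (b : symalg K n) : outer_product (0 : symalg K m) b = 0.
Proof. by rewrite -[in LHS](addNr 0) -scaleN1r outerDl scaleN1r addNr. Qed.

Lemma outer0r m n (a : symalg K m) : outer_product a (0 : symalg K n) = 0.
Proof. by rewrite -[in LHS](addNr 0) -scaleN1r outerDr scaleN1r addNr. Qed.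

Lemma length_filter_ind n k (P : symalg K n -> Prop) :
  P 0 -> (forall c a b, P a -> P b -> P (c *: a + b)) ->
  (forall c, c \in compositions n -> (k <= size c)%N -> P (X n c)) ->
  forall a, a \in length_filter K n k -> P a.
Proof.
move=> P0 PZD PX a aF.
rewrite (@coord_span _ _ _
  (in_tuple [seq X n c | c <- compositions n & (k <= size c)%N]) a aF).
apply: big_ind => // [b c Pb Pc|i _]; first by rewrite -[b]scale1r; apply: PZD.
rewrite -[_ *: _]addr0; apply: PZD => //.
have /mapP[c + ->] := mem_nth 0 (ltn_ord i); rewrite mem_filter => /andP[kc cn].
exact: PX.
Qed.

Lemma outer_filter m n k l (a : symalg K m) (b : symalg K n) :
  a \in length_filter K m k -> b \in length_filter K n l ->
  outer_product a b \in length_filter K (m + n) (k + l).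
Proof.
move=> aF bF; move: a aF; apply: length_filter_ind.
- by rewrite outer0l mem0v.
- by move=> c a a' aF aF'; rewrite outerDl rpredD ?rpredZ.
move=> q qm kq; move: b bF; apply: length_filter_ind.
- by rewrite outer0r mem0v.
- by move=> c b b' bF bF'; rewrite outerDr rpredD ?rpredZ.
move=> r rn lr; rewrite outer_Xi //; apply: memv_span; apply: map_f.
rewrite mem_filter size_cat leq_add //=; move: qm rn.
rewrite !mem_compositions mem_cat sumn_cat => /andP[/negPf-> /eqP->] /andP[/negPf-> /eqP->].
exact: eqxx.
Qed.

End OuterProduct.

(** * Primitive elements *)

Section LieElements.

Variable K : fieldType.
Local Notation X n q := (Xi K (word_set n q)).

Definition primitive n (a : symalg K n) : Prop :=
  forall x (f : seq nat -> seq nat -> K), size x = n ->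
    word_act a x (fun t => \sum_(p <- unshuffles t) f p.1 p.2) =
    word_act a x (fun t => f t [::]) + word_act a x (f [::]).

Lemma omega_primitive n : (0 < n)%N -> primitive (omega K n).
Proof.
move=> n0 x f xn; rewrite omega_valley !word_act_valley //.
rewrite dynkin_comultiplicative comultiplicative1 //.
exact: valley_family_perm.
Qed.

(** As [b] acts first, the values of [a * b] are combinations of values of [a]. Thus primitivity
    passes from omega to all Lie idempotents. *)
Lemma primitive_mulr n (a b : symalg K n) : primitive a -> primitive (a * b).
Proof.
move=> prim x f xn; rewrite !word_actM // -(perm_formD (word_act_form b xn)).
apply: (perm_form_ext (word_act_form b xn)) => t /perm_size tx.
by rewrite prim // tx.
Qed.

Lemma Xi_one n : X n [:: n] = 1.
Proof.
apply: word_act_inj => f; rewrite word_act1 ?size_iota // word_act_Xi ?size_iota //.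
  by rewrite (conv1 (@unit_family_perm K)) /unit_family size_iota eqxx mul1r.
by rewrite /= addn0.
Qed.

(** Xi^c with at least two parts uses a component of the coproduct with two nonempty pieces, and a
    primitive element has none. *)
Lemma length_filter2_primitive n (a b : symalg K n) : (0 < n)%N ->
  a \in length_filter K n 2 -> primitive b -> a * b = 0.
Proof.
move=> n0 aF prim; move: a aF; apply: length_filter_ind; first by rewrite mul0r.
  by move=> c a a' aP aP'; rewrite mulrDl -scalerAl aP aP' scaler0 addr0.
move=> c; rewrite mem_compositions; case: c => [|k [|l c]] // /andP[c0 /eqP cn] _.
apply: word_act_inj => f; rewrite word_act0 word_actM ?size_iota //.
have formb : perm_form (iota 0 n) (word_act b (iota 0 n)).
  by apply: word_act_form; rewrite size_iota.
pose F y z := unit_family k y (fun t => conv (@unit_family K) (l :: c) z (fun s => f (t ++ s))).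
rewrite (perm_form_ext formb (g := fun t => \sum_(p <- unshuffles t) F p.1 p.2)).
  have [k0 l0] : k != 0%N /\ l != 0%N.
    by move: c0; rewrite !inE !negb_or ![0%N == _]eq_sym => /and3P[].
  rewrite prim ?size_iota // -(perm_formD formb) -[RHS](perm_form0 formb).
  apply: (perm_form_ext formb) => t _.
  rewrite /F /unit_family (conv_size (@unit_family_perm K)) ?mulr0 ?add0r.
    by rewrite [size [::] == k]eq_sym (negPf k0) mul0r.
  by rewrite eq_sym /= addn_eq0 negb_and l0.
by move=> t /perm_size tn; rewrite word_act_Xi // tn size_iota.
Qed.

Lemma Xi_coef_leading n (a : symalg K n) : (0 < n)%N -> a \in descent_algebra K n ->
  a - Xi_coef [:: n] a *: 1 \in length_filter K n 2.
Proof.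
move=> n0; have coef0 : Xi_coef [:: n] (0 : symalg K n) = 0.
  by apply: Xi_coef_filter; rewrite mem0v.
move: a; apply: descent_ind.
- by rewrite coef0 scale0r subr0 mem0v.
- move=> c a b aF bF; rewrite Xi_coefZD scalerDl -scalerA opprD addrACA -scalerBr.
  by rewrite rpredD ?rpredZ.
move=> c cn; rewrite Xi_coefE //; case: eqP => [->|/eqP cn1].
  by rewrite Xi_one scale1r subrr mem0v.
rewrite scale0r subr0; apply/memv_span/map_f; rewrite mem_filter cn andbT.
move: cn cn1; rewrite mem_compositions; case: c => [|k [|l c]] //=.
  by move/eqP=> n0'; rewrite -n0' in n0.
by rewrite addn0 => /andP[_ /eqP->]; rewrite eqxx.
Qed.

Lemma mul_primitive n (a b : symalg K n) : (0 < n)%N -> a \in descent_algebra K n ->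
  primitive b -> a * b = Xi_coef [:: n] a *: b.
Proof.
move=> n0 aD prim; have := length_filter2_primitive n0 (Xi_coef_leading n0 aD) prim.
by move/eqP; rewrite mulrBl subr_eq0 -scalerAl mul1r => /eqP.
Qed.

Lemma lie_idempotent_primitive n (a : symalg K n) : (0 < n)%N ->
  lie_idempotent a -> primitive a /\ a != 0.
Proof.
move=> n0 [_ /classical_sets.seteqP[sub1 sub2]]; split.
  by have [b _ <-] := sub1 a (ex_intro2 _ _ 1 I (mulr1 a)); apply/primitive_mulr/omega_primitive.
apply: contraNneq (omega_neq0 K n0) => a0.
by have [b _ <-] := sub2 (omega K n) (ex_intro2 _ _ 1 I (mulr1 _)); rewrite a0 mul0r.
Qed.

Lemma lie_idempotent_coef n (a : symalg K n) : (0 < n)%N -> a \in descent_algebra K n ->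
  lie_idempotent a -> Xi_coef [:: n] a = 1.
Proof.
move=> n0 aD lie; have [prim a_neq0] := lie_idempotent_primitive n0 lie.
have [aa _] := lie; have := mul_primitive n0 aD prim; rewrite aa => /eqP.
rewrite -{1}[a]scale1r -subr_eq0 -scalerBl scaler_eq0 (negPf a_neq0) orbF subr_eq0.
by move/eqP.
Qed.

(** Applied to a primitive element, the generator returns the element plus its reversal, and
    reversal multiplies omega by (-1)^(n-1). By [mul_primitive] the resulting factor is the
    coefficient. *)
Lemma peak_generator_coef n : (0 < n)%N ->
  Xi_coef [:: n] (peak_generator K n) = 1 + (-1) ^+ n.-1.
Proof.
move=> n0; have prim := omega_primitive n0.
have := mul_primitive n0 (valley_element_descent (fun _ _ => 1) n) prim.
suff -> : peak_generator K n * omega K n = (1 + (-1) ^+ n.-1) *: omega K n.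
  move/eqP; rewrite -subr_eq0 -scalerBl scaler_eq0 (negPf (omega_neq0 K n0)) orbF subr_eq0.
  by move/eqP.
apply: word_act_inj => f; rewrite word_actM ?size_iota // word_actZ.
have formo : perm_form (iota 0 n) (word_act (omega K n) (iota 0 n)).
  by apply: word_act_form; rewrite size_iota.
pose F y z : K := f (rev y ++ z).
rewrite (perm_form_ext formo (g := fun t => \sum_(p <- unshuffles t) F p.1 p.2)); last first.
  move=> t /perm_size; rewrite size_iota => tn.
  rewrite word_act_valley // /valley_family tn eqxx mul1r.
  by apply: eq_bigr => p _; rewrite mul1r.
rewrite prim ?size_iota // /F addrC mulrDl mul1r; congr (_ + _).
rewrite omega_valley !word_act_valley ?size_iota // /valley_family size_iota eqxx !mul1r.
rewrite (unsh_swap _ (fun y z => dynkin_weight K (size y) (size z) *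
   f (rev (rev y ++ z) ++ [::]))).
pose sg (p : seq nat * seq nat) : K := (-1) ^+ size p.1 * f (rev p.1 ++ p.2).
(* The weight now contains the length of the left piece, that is, n minus the length of the right
   one. The part with factor n vanishes by [unsh_antipode], the other is omega up to sign. *)
transitivity ((-1) ^+ n * (n%:R * \sum_(p <- unshuffles (iota 0 n)) sg p -
  \sum_(p <- unshuffles (iota 0 n)) dynkin_weight K (size p.1) (size p.2) * f (rev p.1 ++ p.2))).
  rewrite big_distrr -sumrB big_distrr; apply: eq_big_seq => p px /=.
  rewrite cats0 rev_cat revK /dynkin_weight /sg.
  have := unsh_size px; rewrite size_iota => <-.
  rewrite natrD exprD; set u := (-1) ^+ size p.1; set v := (-1) ^+ size p.2.
  have uu : u * u = 1 by rewrite -expr2 sqrr_sign.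
  transitivity (u * u * (v * (size p.1)%:R * f (rev p.1 ++ p.2))); last by ring.
  by rewrite uu mul1r.
rewrite (unsh_antipode (iota 0 n) f) (_ : (iota 0 n == [::]) = false); last by case: (n) n0.
by rewrite mul0r mulr0 sub0r mulrN -mulNr -[n in (-1) ^+ n](prednK n0) exprS mulN1r opprK.
Qed.

End LieElements.

(** * Outer products of a family of elements and their leading terms *)

Section WordProducts.

Variables (K : fieldType) (g : forall m, symalg K m).
Hypothesis gD : forall m, (0 < m)%N -> g m \in descent_algebra K m.
Local Notation X n q := (Xi K (word_set n q)).

(** Nothing is assumed about [g 0], so degree 0 is set to zero. *)
Definition elt_family (a : nat) (x : seq nat) (f : seq nat -> K) : K :=
  ((0 < a)%N && (size x == a))%:R * word_act (g a) x f.

Lemma elt_family_perm : perm_family elt_family.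
Proof.
split=> [a x|a x f /negPf xa]; last by rewrite /elt_family xa andbF mul0r.
rewrite /elt_family; have [xa|xa] := eqVneq (size x) a; last first.
  by rewrite andbF; split=> [c f h|f h _]; rewrite !mul0r ?mulr0 ?addr0.
have form := word_act_form (g a) xa.
split=> [c f h|f h fh]; last by rewrite (perm_form_ext form fh).
by case: form => -> _; rewrite mulrDr mulrCA.
Qed.

Lemma word_product_descent p : word_product g p \in descent_algebra K (sumn p).
Proof.
case: p => [|a p] /=; last exact: outer_descent.
by rewrite -[1](Xi_one K 0) Xi_descent_algebra.
Qed.

Lemma word_act_product p x f : 0%N \notin p -> size x = sumn p ->
  word_act (word_product g p) x f = conv elt_family p x f.
Proof.
elim: p x f => [|a p IHp] x f.
  by move=> _ /size0nil->; rewrite /= word_act1 // mul1r.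
rewrite inE negb_or => /andP[a0 p0] xp /=.
have a_gt0 : (0 < a)%N by rewrite lt0n eq_sym.
rewrite word_act_outer ?gD ?word_product_descent //.
apply: eq_big_seq => r rx; have := unsh_size rx; rewrite xp /= => rp.
rewrite /elt_family a_gt0 /=.
have [ra|_] := eqVneq (size r.1) a; last by rewrite !mul0r.
have rp2 : size r.2 = sumn p by move: rp; rewrite ra => /addnI.
congr (_ * _); apply: (perm_form_ext (word_act_form _ ra)) => t _.
by rewrite IHp.
Qed.

(** Up to longer words each factor is a scalar times the identity, and lengths add under the outer
    product. *)
Lemma word_product_leading p : 0%N \notin p ->
  word_product g p - (\prod_(a <- p) Xi_coef [:: a] (g a)) *: X (sumn p) p
    \in length_filter K (sumn p) (size p).+1.
Proof.
elim: p => [|a p IHp] /=.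
  by rewrite big_nil scale1r -(Xi_one K 0) -(@Xi_support K 0 [:: 0%N]) // subrr mem0v.
rewrite inE negb_or => /andP[a0 p0]; have {}IHp := IHp p0.
have a_gt0 : (0 < a)%N by rewrite lt0n eq_sym.
rewrite big_cons; set al := Xi_coef _ _; set be := \prod_(_ <- _) _ in IHp *.
have aF := Xi_coef_leading a_gt0 (gD a_gt0); rewrite -/al -(Xi_one K a) in aF.
have acomp : [:: a] \in compositions a by rewrite mem_compositions inE a0 /= addn0.
have pcomp : p \in compositions (sumn p) by rewrite mem_compositions p0 eqxx.
have XpF : X (sumn p) p \in length_filter K (sumn p) (size p).
  by apply: Xi_length_filter; rewrite ?support_id.
have pF : word_product g p \in length_filter K (sumn p) (size p).
  rewrite -[word_product g p](subrK (be *: X (sumn p) p)) rpredD ?rpredZ //.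
  by move/(subvP (length_filterS K _ (leqnSn _))): IHp.
have -> : outer_product (g a) (word_product g p) - (al * be) *: X (a + sumn p) (a :: p) =
    outer_product (g a - al *: X a [:: a]) (word_product g p) +
    al *: outer_product (X a [:: a]) (word_product g p - be *: X (sumn p) p).
  by rewrite -cat1s -outer_Xi // outerBl outerBr scalerBr scalerA addrA subrK.
rewrite rpredD ?rpredZ //; first exact: (outer_filter aF pF).
apply: (@outer_filter K a (sumn p) 1 _ _ _ _ IHp).
by apply: Xi_length_filter; rewrite ?support_id //= ?addn0 ?inE.
Qed.

End WordProducts.

(** * Words produced by the two coproduct patterns *)

Lemma coproduct_primitive_perm r p :
  p \in coproduct primitive_delta r -> perm_eq (p.1 ++ p.2) r.
Proof.
elim: r p => [|a r IHr] p /=; first by rewrite inE => /eqP->.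
rewrite cats0 mem_cat => /orP[] /mapP[d /IHr dr ->] /=; first by rewrite perm_cons.
by rewrite -cat1s perm_catCA /= perm_cons.
Qed.

Lemma act_primitive_perm q r s : s \in act_words primitive_delta q r -> perm_eq s r.
Proof.
elim: q r s => [|a q IHq] r s; first by rewrite /=; case: ifP => // _; rewrite inE => /eqP->.
case/allpairsPdep=> p [t] [] ; rewrite mem_filter => /andP[_ pr] /IHq tp ->.
by rewrite -(permPr (coproduct_primitive_perm pr)) perm_cat2l.
Qed.

Lemma coproduct_primitive_nil r : ([::], r) \in coproduct primitive_delta r.
Proof.
elim: r => [|a r IHr] //=; rewrite cats0 mem_cat; apply/orP; right.
by apply/mapP; exists ([::], r).
Qed.

Lemma act_primitive_refl p : p \in act_words primitive_delta p p.
Proof.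
elim: p => [|a p IHp] //=; rewrite cats0; apply/allpairsPdep.
exists ([:: a], p), p; split=> //; rewrite mem_filter /= addn0 eqxx mem_cat.
by apply/orP; left; apply/mapP; exists ([::], p); rewrite ?coproduct_primitive_nil.
Qed.

(** [s] arranges the letters of [p] in nonempty blocks with sums q_1, q_2, .... *)
Lemma act_primitive_size q p s : 0%N \notin q -> 0%N \notin p ->
  s \in act_words primitive_delta q p -> (size q <= size p)%N /\
  (size q = size p -> s = q).
Proof.
move=> q0 p0 sq; have sp := act_primitive_perm sq.
have s0 : 0%N \notin s by rewrite (perm_mem sp).
have := act_words_support q0 sq; rewrite support_id // => -[sE|].
  by rewrite -(perm_size sp) sE.
by rewrite (perm_size sp) => lt; split=> [|qp]; [apply: ltnW|rewrite qp ltnn in lt].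
Qed.

(** A matrix with a single column is determined by its row sums; the 0 is what remains of the column
    at the end. *)
Lemma sum_act_divided (V : nmodType) w (F : seq nat -> V) :
  \sum_(s <- act_words divided_delta w [:: sumn w]) F s = F (rcons w 0%N).
Proof.
elim: w F => [|a w IHw] F; first by rewrite /= big_seq1.
have -> : act_words divided_delta (a :: w) [:: sumn (a :: w)] =
  [seq p.1 ++ s | p <- [seq p <- coproduct divided_delta [:: sumn (a :: w)] | sumn p.1 == a],
                  s <- act_words divided_delta w p.2] by [].
rewrite big_allpairs_dep big_filter big_mkcond.
rewrite big_allpairs_dep (sum_divided_delta _ (fun u v => \sum_(p <- [:: ([::], [::])])
  (if sumn (u ++ p.1) == a then \sum_(s <- act_words divided_delta w (v ++ p.2))
     F ((u ++ p.1) ++ s) else 0))).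
under eq_bigr => b _ do rewrite big_seq1 /= addn0.
have a_lt : (a < (a + sumn w).+1)%N by rewrite ltnS leq_addr.
rewrite (bigD1 (Ordinal a_lt)) //= eqxx addKn (IHw (fun s => F (a :: s))).
by rewrite big1 ?addr0 // => b; rewrite -val_eqE /= => /negPf->.
Qed.

(** * Products of the Xi^w with the peak generator *)

Section PeakGenerator.

Variable K : fieldType.
Local Notation X n q := (Xi K (word_set n q)).
Local Notation Q := (valley_family (fun _ _ => 1 : K)).

(** Because of the divided coproduct, Xi^w cuts the operator into the convolution of the operators
    of degrees w_1, w_2, ...; the leftover factor of degree 0 acts as the counit. *)
Lemma conv_valley_Xi w x f :
  conv Q [:: sumn w] x (fun t => conv (@unit_family K) w t f) = conv Q w x f.
Proof.
have famQ := valley_family_perm (fun _ _ => 1 : K).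
rewrite (conv_act famQ (@valley1_comultiplicative K)) sum_act_divided -cats1 conv_cat //.
rewrite -[RHS](unsh_nilr x (fun y _ => conv Q w y f)) [RHS]big_mkcond.
apply: eq_bigr => p _; case: eqP => [->|/eqP p2].
  apply: (perm_form_ext (conv_form famQ _ _)) => t _.
  by rewrite conv1 // /valley_family /= big_seq1 /= !mul1r cats0.
rewrite -[RHS](perm_form0 (conv_form famQ w p.1)).
apply: (perm_form_ext (conv_form famQ _ _)) => t _.
by rewrite conv_size //= addn0 size_eq0.
Qed.

Lemma word_act_Xi_peak n w x f : (0 < n)%N -> sumn w = n -> size x = n ->
  word_act (X n w * peak_generator K n) x f = conv Q w x f.
Proof.
move=> n0 wn xn; rewrite word_actM // word_act_valley //.
have famQ := valley_family_perm (fun _ _ => 1 : K).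
rewrite -conv_valley_Xi conv1 // wn; apply: (perm_form_ext (famQ.1 _ _)) => t /perm_size.
by rewrite xn => tn; rewrite word_act_Xi.
Qed.

Lemma Xi_peak_generator n w : (0 < n)%N -> w \in compositions n ->
  X n w * peak_generator K n - (\prod_(a <- w) (1 + (-1) ^+ a.-1)) *: X n w
    \in length_filter K n (size w).+1.
Proof.
move=> n0; rewrite mem_compositions => /andP[w0 /eqP wn]; subst n.
have gD m : (0 < m)%N -> peak_generator K m \in descent_algebra K m.
  by move=> _; apply: valley_element_descent.
have := word_product_leading gD w0.
have -> : \prod_(a <- w) Xi_coef [:: a] (peak_generator K a) =
          \prod_(a <- w) (1 + (-1) ^+ a.-1).
  apply: eq_big_seq => a aw; rewrite peak_generator_coef // lt0n.
  by apply: contraNneq w0 => <-.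
have -> // : word_product (peak_generator K) w = X (sumn w) w * peak_generator K (sumn w).
apply: word_act_inj => f; rewrite word_act_product ?size_iota // word_act_Xi_peak ?size_iota //.
apply: eq_conv; last exact: elt_family_perm.
move=> a y aw h; have a0 : (0 < a)%N by rewrite lt0n; apply: contraNneq w0 => <-.
rewrite /elt_family a0 /=; have [ya|ya] := eqVneq (size y) a.
  by rewrite mul1r word_act_valley.
by rewrite mul0r /valley_family (negPf ya) mul0r.
Qed.

Lemma chi_peak_generator n w : (0 < n)%N -> w \in compositions n ->
  chi w (peak_generator K n) = \prod_(a <- w) (1 + (-1) ^+ a.-1).
Proof. by move=> n0 wn; apply: chi_eq => //; apply: Xi_peak_generator. Qed.

End PeakGenerator.

(** * Products of members of a Lie series *)

Section LieSeries.

Variables (K : fieldType) (charK0 : [pchar K] =i pred0).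
Variable g : forall m, symalg K m.
Hypothesis lie_g : lie_series g.
Local Notation X n q := (Xi K (word_set n q)).

Lemma natr_neq0 m : (0 < m)%N -> (m%:R : K) != 0.
Proof. by case: m => // m _; rewrite ((pcharf0P K).1 charK0). Qed.

Lemma lie_series_scale m : (0 < m)%N -> g m = m%:R *: (m%:R^-1 *: g m).
Proof. by move=> m0; rewrite scalerA divff ?scale1r ?natr_neq0. Qed.

Lemma lie_series_primitive m : (0 < m)%N -> primitive (g m).
Proof.
move=> m0 x f xm; have [_ /(lie_idempotent_primitive m0)[prim _]] := lie_g m0.
by rewrite lie_series_scale // !(word_actZ m%:R) prim // mulrDr.
Qed.

Lemma lie_series_coef m : (0 < m)%N -> Xi_coef [:: m] (g m) = m%:R.
Proof.
move=> m0; have [gD lie] := lie_g m0.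
have eD : m%:R^-1 *: g m \in descent_algebra K m by rewrite rpredZ.
have coef0 : Xi_coef [:: m] (0 : symalg K m) = 0.
  by apply: Xi_coef_filter; rewrite mem0v.
rewrite lie_series_scale // -[_ *: _]addr0 Xi_coefZD coef0 addr0.
by rewrite (lie_idempotent_coef m0 eD lie) mulr1.
Qed.

Lemma lie_series_descent m : (0 < m)%N -> g m \in descent_algebra K m.
Proof. by case/lie_g. Qed.

Lemma lie_series_comultiplicative : comultiplicative (elt_family g) primitive_delta.
Proof.
move=> a x f; rewrite comultiplicative1; last exact: elt_family_perm.
rewrite /elt_family -mulrDr; case: (posnP a) => [->|a0] /=; first by rewrite !mul0r.
have [xa|_] := eqVneq (size x) a; last by rewrite !mul0r.
by rewrite lie_series_primitive.
Qed.

Lemma word_act_Xi_product n q p (a : symalg K n) x f :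
  (forall y h, size y = n -> word_act a y h = conv (elt_family g) p y h) ->
  sumn q = n -> size x = n ->
  word_act (X n q * a) x f =
  \sum_(s <- act_words primitive_delta q p) conv (elt_family g) s x f.
Proof.
move=> aE qn xn; rewrite word_actM // aE //.
rewrite -(conv_act (elt_family_perm g) lie_series_comultiplicative).
apply: (perm_form_ext (conv_form (elt_family_perm g) p x)) => t /perm_size tx.
by rewrite word_act_Xi // tx.
Qed.

Section Partition.

Variables (n : nat) (p : seq nat) (gp : symalg K n).
Hypotheses (p0 : 0%N \notin p) (pn : sumn p = n).
Hypothesis gpE : gp = ecast k (symalg K k) pn (word_product g p).

Lemma word_act_product_cast x f : size x = n -> word_act gp x f = conv (elt_family g) p x f.
Proof.
move=> xn; subst gp; case: n / pn xn => /= xn.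
by apply: word_act_product => //; apply: lie_series_descent.
Qed.

(** The leading coefficient at Xi^p is the product of the parts of [p]. *)
Lemma product_neq0 : gp != 0.
Proof.
subst gp; case: n / pn => /=; apply/eqP => gp0.
have := word_product_leading lie_series_descent p0; rewrite gp0 sub0r rpredN => pF.
have := @Xi_coefE K (sumn p) p p; rewrite mem_compositions p0 !eqxx => /(_ isT) coefp.
have := Xi_coef_filter pF; rewrite -[_ *: _]addr0 Xi_coefZD coefp mulr1.
have -> : Xi_coef p (0 : symalg K (sumn p)) = 0 by apply: Xi_coef_filter; rewrite mem0v.
rewrite addr0 => /eqP; apply/negP; rewrite prodf_seq_neq0; apply/allP => a ap /=.
have a0 : (0 < a)%N by rewrite lt0n; apply: contraNneq p0 => <-.
by rewrite lie_series_coef // natr_neq0.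
Qed.

Lemma Xi_mul_product_eq0 q : q \in compositions n -> (size p < size q)%N -> X n q * gp = 0.
Proof.
rewrite mem_compositions => /andP[q0 /eqP qn] pq; apply: word_act_inj => f.
rewrite word_act0 (word_act_Xi_product _ word_act_product_cast) ?size_iota // big_seq big1 // => s.
by case/(act_primitive_size q0 p0); rewrite leqNgt pq.
Qed.

Lemma length_filter_mul_product a : a \in length_filter K n (size p).+1 -> a * gp = 0.
Proof.
move: a; apply: length_filter_ind; first by rewrite mul0r.
  by move=> c a' b aP bP; rewrite mulrDl -scalerAl aP bP scaler0 addr0.
by move=> c cn pc; apply: Xi_mul_product_eq0.
Qed.

Lemma Xi_mul_product_perm q : q \in compositions n -> size q = size p -> X n q * gp != 0 ->
  perm_eq q p.
Proof.
rewrite mem_compositions => /andP[q0 /eqP qn] pq; apply: contraNT => qp.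
apply/eqP/word_act_inj => f; rewrite word_act0 (word_act_Xi_product _ word_act_product_cast) ?size_iota //.
rewrite big_seq big1 // => s sq; have [_ /(_ pq) sE] := act_primitive_size q0 p0 sq.
by case/negP: qp; rewrite -sE; apply: act_primitive_perm sq.
Qed.

(** All terms equal [p] by [act_primitive_size]; their number counts the permutations of equal parts
    of [p]. *)
Lemma Xi_mul_product : X n p * gp = (size (act_words primitive_delta p p))%:R *: gp.
Proof.
apply: word_act_inj => f; rewrite (word_act_Xi_product _ word_act_product_cast) ?size_iota //.
rewrite word_actZ word_act_product_cast ?size_iota // mulr_natl -sum1_size -sumrMnr.
rewrite big_seq [RHS]big_seq; apply: eq_bigr => s sp.
by have [_ /(_ erefl)->] := act_primitive_size p0 p0 sp.
Qed.

Lemma size_act_words_neq0 : (size (act_words primitive_delta p p))%:R != 0 :> K.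
Proof.
apply: natr_neq0; have := act_primitive_refl p.
by case: (act_words _ p p).
Qed.

Lemma Xi_mul_descent_product a : p \in compositions n -> a \in descent_algebra K n ->
  X n p * (a * gp) =
  (chi p a * (size (act_words primitive_delta p p))%:R) *: gp.
Proof.
move=> pc aD; rewrite mulrA; have := length_filter_mul_product (chi_filter pc aD).
by move/eqP; rewrite mulrBl subr_eq0 -scalerAl Xi_mul_product scalerA => /eqP.
Qed.

End Partition.

Lemma act_primitive_nonempty q p : perm_eq q p -> act_words primitive_delta q p != [::].
Proof.
suff : perm_eq q p -> exists s, s \in act_words primitive_delta q p.
  by move=> H /H[s]; case: (act_words _ q p).
elim: q p => [|a q IHq] p.
  by rewrite perm_sym => /perm_nilP->; exists [::].
move=> qp; have ap : a \in p by rewrite -(perm_mem qp) mem_head.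
case/splitPr: ap qp => u v; rewrite perm_sym -cat1s perm_catCA /= perm_cons perm_sym => quv.
have [s sq] := IHq _ quv.
have auv : ([:: a], u ++ v) \in coproduct primitive_delta (u ++ a :: v).
  elim: u {quv sq} => [|b u IHu] /=; rewrite cats0 mem_cat; apply/orP.
    by left; apply/mapP; exists ([::], v); rewrite ?coproduct_primitive_nil.
  by right; apply/mapP; exists ([:: a], u ++ v).
exists (a :: s); apply/allpairsPdep; exists ([:: a], u ++ v), s.
by rewrite mem_filter /= addn0 eqxx.
Qed.

Section Rearrangement.

Variables (n : nat) (p q : seq nat) (gp gq : symalg K n).
Hypotheses (pn : p \in compositions n) (qn : q \in compositions n) (pq : perm_eq q p).
Hypothesis gpE : forall y h, size y = n -> word_act gp y h = conv (elt_family g) p y h.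
Hypothesis gqE : forall y h, size y = n -> word_act gq y h = conv (elt_family g) q y h.

Lemma Xi_rearrangement : exists2 k : K, k != 0 & X n q * gp = k *: gq.
Proof.
move: pn qn; rewrite !mem_compositions => /andP[p0 _] /andP[q0 /eqP qsum].
exists (size (act_words primitive_delta q p))%:R.
  by apply: natr_neq0; rewrite lt0n size_eq0 act_primitive_nonempty.
apply: word_act_inj => f; rewrite (word_act_Xi_product _ gpE) ?size_iota //.
rewrite word_actZ gqE ?size_iota // mulr_natl -sum1_size -sumrMnr.
rewrite big_seq [RHS]big_seq; apply: eq_bigr => s sp.
by have [_ ->] := act_primitive_size q0 p0 sp; rewrite ?(perm_size pq).
Qed.

End Rearrangement.

(** X p * a is evaluated on gamma_q twice: through chi_q, and after replacing it by chi_p(a) X p,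
    since longer words kill gamma_q. The common factor chi_q(X p) is nonzero because X p and X q
    carry the two products into nonzero multiples of each other. *)
Lemma chi_perm n p q a : p \in compositions n -> q \in compositions n -> perm_eq q p ->
  a \in descent_algebra K n -> chi q a = chi p a.
Proof.
move=> pn qn pq aD; have := pn; have := qn; rewrite !mem_compositions.
move=> /andP[q0 /eqP qsum] /andP[p0 /eqP psum].
pose gp := ecast k (symalg K k) psum (word_product g p).
pose gq := ecast k (symalg K k) qsum (word_product g q).
have gpE : gp = ecast k (symalg K k) psum (word_product g p) by [].
have gqE : gq = ecast k (symalg K k) qsum (word_product g q) by [].
have actp := word_act_product_cast p0 gpE; have actq := word_act_product_cast q0 gqE.
have [k k0 Xqp] := Xi_rearrangement pn qn pq actp actq.
have [l l0 Xpq] : exists2 k : K, k != 0 & X n p * gq = k *: gp.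
  by have qp : perm_eq p q; [rewrite perm_sym|apply: (Xi_rearrangement qn pn qp actq actp)].
have XpD : X n p \in descent_algebra K n by apply: Xi_descent_algebra.
have gq0 := product_neq0 q0 gqE.
have chi_pq : (chi q (X n p) * (size (act_words primitive_delta q q))%:R) *: gq = (l * k) *: gq.
  by rewrite -(Xi_mul_descent_product q0 gqE qn XpD) Xpq -scalerAr Xqp scalerA.
have chi_eq0 : chi q (X n p) * (size (act_words primitive_delta q q))%:R != 0.
  apply: contraNneq (mulf_neq0 l0 k0) => chi0.
  by move/esym/eqP: chi_pq; rewrite chi0 scale0r scaler_eq0 (negPf gq0) orbF.
have XpaD := descent_mul XpD aD.
have := Xi_mul_descent_product q0 gqE qn XpaD; rewrite chiM //.
have /eqP : (X n p * a - chi p a *: X n p) * gq = 0.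
  by apply: (length_filter_mul_product q0 gqE); rewrite (perm_size pq); apply: chi_filter.
rewrite mulrBl subr_eq0 => /eqP ->; rewrite -scalerAl -scalerAr (Xi_mul_descent_product q0 gqE) //.
rewrite scalerA => /eqP; rewrite -subr_eq0 -scalerBl scaler_eq0 (negPf gq0) orbF subr_eq0.
by rewrite mulrAC [Z in _ == Z]mulrC => /eqP/(mulIf chi_eq0).
Qed.

End LieSeries.

(** * The peak algebra *)

Definition peak_pattern (u : seq nat) : bool :=
  [&& size u == 3, nth 0 u 0 < nth 0 u 1 & nth 0 u 2 < nth 0 u 1]%N.

Fixpoint peakless (u : seq nat) : bool :=
  if u is _ :: u' then ~~ peak_pattern (take 3 u) && peakless u' else true.

Lemma peaklessP u :
  reflect (forall i, (i + 3 <= size u)%N -> ~~ peak_pattern (take 3 (drop i u)))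
          (peakless u).
Proof.
elim: u => [|a u IHu]; first by apply: (iffP idP) => // _ i; rewrite addn3.
apply: (iffP andP) => [[pat /IHu peak_u] [|i] iu|H]; [by []|exact: peak_u|split].
  case: (leqP 3 (size (a :: u))) => [au|au]; first exact: (H 0%N).
  by rewrite take_oversize ?(ltnW au) // /peak_pattern; case: eqP au => // ->.
by apply/IHu => i iu; apply: (H i.+1).
Qed.

Lemma valleyS j a b u : valley j.+1 [:: a, b & u] = (b <= a)%N && valley j (b :: u).
Proof. by rewrite /valley !rev_sorted /= andbA. Qed.

Lemma valley_peakless j u : valley j u -> peakless u.
Proof.
elim: u j => [|a [|b u] IHu] j //.
case: j => [|j].
  rewrite /valley drop0 => /andP[_ /= /andP[ab bu]].
  rewrite [peakless _]/= -/(peakless (b :: u)) (IHu 0%N) ?andbT; last by rewrite /valley /= take0 /= bu.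
  case: u bu {IHu} => [|c u] //= /andP[bc _]; rewrite /peak_pattern /= take0.
  by rewrite [(c < b)%N]ltnNge bc andbF.
rewrite valleyS => /andP[ba bu]; rewrite [peakless _]/= -/(peakless (b :: u)).
rewrite (IHu j) // andbT /peak_pattern /=.
by rewrite [(a < b)%N]ltnNge ba /= andbF.
Qed.

Lemma peakless_valley u : uniq u -> u != [::] -> peakless u ->
  exists2 j, (j < size u)%N & valley j u.
Proof.
elim: u => [|a [|b u] IHu] // ua _; first by exists 0%N.
rewrite [peakless _]/= -/(peakless (b :: u)) => /andP[pat peak_u].
have [|//|//|j ju vj] := IHu; first by case/andP: ua.
case: (ltngtP b a) => ba; last by rewrite ba /= inE eqxx in ua.
  by exists j.+1; rewrite ?valleyS ?vj ?(ltnW ba).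
(* After an initial ascent the bottom of the rest must be its first letter, as otherwise [b] would
   be a peak. *)
case: j ju vj => [|j] ju vj.
  by exists 0%N => //; move: vj; rewrite /valley !drop0 /= !take0 /= (ltnW ba).
case: u ju vj pat {IHu peak_u} ua => [|c u] // ju.
rewrite valleyS => /andP[cb _]; rewrite /peak_pattern /= take0 ba /= -leqNgt => bc.
have bcE : b = c by apply/eqP; rewrite eqn_leq bc cb.
by move=> /= /and3P[_]; rewrite bcE mem_head.
Qed.

Lemma sum_valley (K : fieldType) u : uniq u -> u != [::] ->
  \sum_(j < size u) (valley j u)%:R = (peakless u)%:R :> K.
Proof.
move=> uu u0; case: (boolP (peakless u)) => [/(peakless_valley uu u0)[j ju vj]|nop].
  rewrite (bigD1 (Ordinal ju)) //= vj big1 ?addr0 // => i.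
  rewrite -val_eqE /=; case: (boolP (valley i u)) => // vi.
  by rewrite (valley_uniq uu (ltn_ord i) ju vi vj) eqxx.
by rewrite big1 // => j _; case: (boolP (valley j u)) => // /valley_peakless; rewrite (negPf nop).
Qed.

Lemma peaks_perm_word n (s : 'S_n) (i : 'I_n) :
  (i \in peaks s) =
  (1 < i)%N && peak_pattern (take 3 (drop (i - 2) (perm_word (iota 0 n) s))).
Proof.
rewrite inE; case: (leqP 2 i) => i2; last first.
  apply/negbTE/existsP => -[g /existsP[h /and4P[/eqP gh /eqP hi _ _]]].
  by rewrite -hi -gh in i2.
have in_ := ltn_ord i; set t := perm_word _ s.
have st : size t = n by rewrite size_perm_word.
have i2n : (i - 2 < n)%N by lia.
have i1n : (i.-1 < n)%N by lia.
rewrite /peak_pattern size_take size_drop st !nth_take // !nth_drop.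
have -> : (if (3 < n - (i - 2))%N then 3 else n - (i - 2))%N = 3 by case: ltnP; lia.
rewrite eqxx /= addn0 addn1 subnK //.
have -> : (i - 2).+1 = i.-1 by lia.
rewrite nth_perm_iota (nth_perm_iota s (Ordinal i2n)) (nth_perm_iota s (Ordinal i1n)).
apply/existsP/andP => [[g /existsP[h /and4P[/eqP gh /eqP hi sg sh]]]|[sg sh]].
  have -> : Ordinal i2n = g by apply: val_inj; rewrite /= -hi -gh; lia.
  by have -> : Ordinal i1n = h by apply: val_inj; rewrite /= -hi.
exists (Ordinal i2n); apply/existsP; exists (Ordinal i1n); rewrite sg sh /= !andbT.
by apply/andP; split; apply/eqP; lia.
Qed.

(** [i.-1] and [i] are the only cuts strictly inside the three letters of a peak at [i]. *)
Lemma all_blocks_peakless n (s : 'S_n) w : sumn w = n ->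
  reflect (forall i, i \in peaks s ->
             ((i : nat) \in scanl addn 0%N w) || (i.-1 \in scanl addn 0%N w))
          (all_blocks peakless w (perm_word (iota 0 n) s)).
Proof.
move=> wn; apply: (iffP (all_blocksP _ _ peaklessP)) => //; rewrite ?size_perm_word ?wn //.
  move=> H i; rewrite peaks_perm_word => /andP[i2 pat].
  have [|[|[|[|j]]] // _] := H _ _ pat; first by have := ltn_ord i; lia.
    by rewrite (_ : (i - 2 + 1)%N = i.-1) => [->|]; rewrite ?orbT //; lia.
  by rewrite subnK // => ->.
move=> H i i_lt pat; have i2 : (i + 2 < n)%N by lia.
have := H (Ordinal i2); rewrite peaks_perm_word /= addnK pat andbT addn2 /=.
by case/(_ isT)/orP => H'; [exists 2|exists 1]; rewrite ?addn2 ?addn1.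
Qed.

Section PeakAlgebra.

Variables (K : fieldType) (n : nat).
Hypothesis n0 : (0 < n)%N.
Local Notation KS := (symalg K n).
Local Notation D := (descent_algebra K n).
Local Notation P := (peak_algebra K n).
Local Notation X q := (Xi K (word_set n q)).
Local Notation pg := (peak_generator K n).

Definition peak_sum (Q : {set 'I_n}) : KS := [ffun s => (peaks s == Q)%:R].

(** Each block contributes a factor 2, since its bottom can belong to the decreasing or to the
    increasing part. *)
Lemma conv_valley_delta w t : 0%N \notin w -> uniq t -> size t = sumn w ->
  conv (valley_family (fun _ _ => 1 : K)) w (sort leq t) (fun s => (s == t)%:R) =
  2 ^+ size w * (all_blocks peakless w t)%:R.
Proof.
have famQ := valley_family_perm (fun _ _ => 1 : K).
elim: w t => [|a w IHw] t; first by case: t => // _ _ _; rewrite /= !mul1r.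
rewrite inE negb_or => /andP[a0 w0] ut tw.
have at_ : (a <= size t)%N by rewrite tw leq_addr.
rewrite conv_delta // IHw ?drop_uniq //; last by rewrite size_drop tw addKn.
have uu : uniq (take a t) by rewrite take_uniq.
have su : size (take a t) = a by rewrite size_takel.
have u0 : take a t != [::] by rewrite -size_eq0 su eq_sym.
have := valley_family_delta (fun _ _ => 1 : K) uu; rewrite su => ->.
have := sum_split_valley (fun=> 1 : K) uu u0; rewrite su => ->.
rewrite -big_distrr /=; have := sum_valley K uu u0; rewrite su => ->.
by rewrite mulrACA -exprS -natrM mulnb.
Qed.

Lemma Xi_peakE w s : w \in compositions n ->
  (X w * pg) s = 2 ^+ size w *
     (all_blocks peakless w (perm_word (iota 0 n) s))%:R.
Proof.
rewrite mem_compositions => /andP[w0 /eqP wn].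
set t := perm_word _ s; have st : size t = n by rewrite size_perm_word.
have ut : uniq t by rewrite (perm_uniq (perm_wordP _ _)) ?size_iota ?iota_uniq.
rewrite -conv_valley_delta ?st ?wn // sort_perm_iota -(word_act_Xi_peak _ n0 wn) ?size_iota //.
rewrite /word_act (bigD1 s) //= eqxx mulr1 big1 ?addr0 // => s' /negPf ss.
by rewrite (inj_eq (@perm_word_inj n)) ss mulr0.
Qed.

Lemma peak_sum_mem Q : peak_sum Q \in P.
Proof. by apply/memv_span/imageP; exists Q. Qed.

Lemma peak_algebraE (a : KS) (phi : {set 'I_n} -> K) :
  (forall s, a s = phi (peaks s)) -> a = \sum_Q phi Q *: peak_sum Q.
Proof.
move=> aE; apply/ffunP => s; rewrite aE sum_ffunE (bigD1 (peaks s)) //=.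
rewrite !ffunE eqxx [_ *: _]mulr1 big1 ?addr0 // => Q /negPf sQ.
by rewrite !ffunE eq_sym sQ [_ *: _]mulr0.
Qed.

Lemma Xi_peak_sum w : w \in compositions n ->
  X w * pg = \sum_(Q : {set 'I_n}) (2 ^+ size w *
    [forall i in Q, ((i : nat) \in scanl addn 0%N w) || (i.-1 \in scanl addn 0%N w)]%:R)
      *: peak_sum Q.
Proof.
move=> wn; apply: peak_algebraE => s; rewrite Xi_peakE //; congr (_ * (nat_of_bool _)%:R).
move: wn; rewrite mem_compositions => /andP[_ /eqP wn].
by apply/(all_blocks_peakless _ wn)/forall_inP.
Qed.

Lemma peaks_apart (s : 'S_n) i j : i \in peaks s -> j \in peaks s -> i.+1 != j :> nat.
Proof.
rewrite !inE => /existsP[g /existsP[h /and4P[/eqP gh /eqP hi _ sh]]].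
case/existsP=> g' /existsP[h' /and4P[/eqP gh' /eqP hi' sg' _]].
apply/eqP => ij; have h'i : h' = i by apply: val_inj => /=; lia.
have g'h : g' = h by apply: val_inj => /=; lia.
by move: sg'; rewrite h'i g'h ltnNge ltnW.
Qed.

Lemma peak_sum_eq0 Q : (forall s : 'S_n, peaks s != Q) -> peak_sum Q = 0.
Proof. by move=> noQ; apply/ffunP => s; rewrite !ffunE (negPf (noQ s)). Qed.

(** [f] moves each peak by 0 or 1 into [Q]. It is injective because peaks are never adjacent, so the
    sum cannot drop; it grows if some peak moves or some element of [Q] is missed. *)
Lemma sum_peaks_lt (Q : {set 'I_n}) (s : 'S_n) : peaks s != Q ->
  (forall j, j \in Q -> (0 < j)%N) ->
  (forall i, i \in peaks s -> i \in Q \/ exists2 j, j \in Q & i.+1 = j) ->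
  (\sum_(i in peaks s) i < \sum_(i in Q) i)%N.
Proof.
(* For a peak outside [Q] the default of [insubd] does not occur: the successor lies in [Q], hence
   below [n]. *)
move=> neqQ Q0 near; pose f (i : 'I_n) := if i \in Q then i else insubd i i.+1.
have fE i : i \in peaks s -> i \notin Q -> f i = i.+1 :> nat.
  move=> ip iQ; have [|[j jQ ij]] := near i ip; first by rewrite (negPf iQ).
  by rewrite /f (negPf iQ) val_insubd ij ltn_ord.
have fQ i : i \in peaks s -> f i \in Q.
  move=> ip; have [iQ|iQ] := boolP (i \in Q); first by rewrite /f iQ.
  have [|[j jQ ij]] := near i ip; first by rewrite (negPf iQ).
  by rewrite (_ : f i = j) //; apply: val_inj; rewrite /= fE.
have f_inj : {in peaks s &, injective f}.
  move=> i j ip jp fij; have vfij := congr1 (@nat_of_ord n) fij.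
  have [iQ|iQ] := boolP (i \in Q); have [jQ|jQ] := boolP (j \in Q).
  - by move: fij; rewrite /f iQ jQ.
  - move: vfij; rewrite (fE j jp jQ) /f iQ => ij.
    by have := peaks_apart jp ip; rewrite ij eqxx.
  - move: vfij; rewrite (fE i ip iQ) /f jQ => ij.
    by have := peaks_apart ip jp; rewrite ij eqxx.
  - by apply: val_inj; move: vfij; rewrite !fE // => -[].
have le_f i : i \in peaks s -> (i <= f i)%N.
  by move=> ip; have [iQ|iQ] := boolP (i \in Q); [rewrite /f iQ|rewrite fE].
have image_sum : (\sum_(i in peaks s) f i = \sum_(j in f @: peaks s) j)%N.
  by rewrite big_imset.
have sub_image : f @: peaks s \subset Q by apply/subsetP => _ /imsetP[i ip ->]; apply: fQ.
have sum_image : (\sum_(j in Q) j =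
    \sum_(j in f @: peaks s) j + \sum_(j in Q :\: f @: peaks s) j)%N.
  by rewrite (big_setID (f @: peaks s)) /= (setIidPr sub_image).
have [sQ|/subsetPn[i ip iQ]] := boolP (peaks s \subset Q).
  have fid : f @: peaks s = peaks s.
    rewrite -[RHS]imset_id; apply: eq_in_imset => i ip.
    by rewrite /f (subsetP sQ _ ip).
  have : peaks s \proper Q by rewrite properEneq neqQ.
  case/properP=> _ [j jQ jp]; rewrite sum_image fid -addn1 leq_add2l.
  by rewrite (bigD1 j) ?in_setD ?jp ?jQ //= addn_gt0 Q0.
apply: leq_trans (_ : \sum_(i in peaks s) f i <= _)%N; last first.
  by rewrite sum_image image_sum leq_addr.
rewrite (bigD1 i) //= [Z in (_ < Z)%N](bigD1 i) //= fE // addSn ltnS leq_add2l.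
by apply: leq_sum => j /andP[jp _]; apply: le_f.
Qed.

Lemma peak_sum_gen Q : (2 : K) != 0 -> peak_sum Q \in (amulr pg @: D)%VS.
Proof.
move=> two; have [m] := ubnP (\sum_(i in Q) i)%N; elim: m Q => // m IHm Q; rewrite ltnS => Qm.
have [s /eqP sQ|noQ] := pickP (fun s : 'S_n => peaks s == Q); last first.
  by rewrite peak_sum_eq0 ?mem0v // => s; rewrite noQ.
have Q1 j : j \in Q -> (1 < j)%N by rewrite -sQ peaks_perm_word => /andP[].
(* The cuts are placed one position before the elements of [Q]. A peak set then occurs in Xi^w times
   the generator iff each of its elements, or its successor, lies in [Q]; by [sum_peaks_lt] all of
   these except [Q] have a smaller sum. *)
have [|w wn wE] := @word_set_surj n [set i : 'I_n | [exists j in Q, i.+1 == j]].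
  by move=> i; rewrite inE => /exists_inP[j /Q1 j1 /eqP ij]; lia.
have memw (i : 'I_n) : ((i : nat) \in scanl addn 0%N w) = [exists j in Q, i.+1 == j].
  by move/setP/(_ i): wE; rewrite !inE.
have mem_pred (i : 'I_n) : (0 < i)%N -> (i.-1 \in scanl addn 0%N w) = (i \in Q).
  move=> i0; have i1 : (i.-1 < n)%N by have := ltn_ord i; lia.
  rewrite (memw (Ordinal i1)) /= prednK //.
  apply/exists_inP/idP => [[j jQ /eqP ij]|iQ]; last by exists i.
  by rewrite (_ : i = j) //; apply: val_inj.
have XD : X w * pg \in (amulr pg @: D)%VS.
  by apply/memv_imgP; exists (X w); rewrite ?Xi_descent_algebra ?lfunE.
move: XD; rewrite Xi_peak_sum // (bigD1 Q) //= (_ : [forall i in Q, _] = true); last first.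
  by apply/forall_inP => i iQ; rewrite mem_pred ?iQ ?orbT // ltnW ?Q1.
rewrite mulr1; set c := 2 ^+ _; set S := \sum_(_ | _) _ => QS.
have c0 : c != 0 by rewrite expf_neq0.
suff SD : S \in (amulr pg @: D)%VS.
  rewrite -[peak_sum Q]scale1r -(mulVf c0) -scalerA rpredZ //.
  by rewrite -(addrK S (c *: _)) rpredB.
apply: rpred_sum => R RQ; case: (boolP [forall i in R, _]) => [/forall_inP near|_]; last first.
  by rewrite mulr0 scale0r mem0v.
have [t /eqP tR|noR] := pickP (fun s : 'S_n => peaks s == R); last first.
  by rewrite peak_sum_eq0 ?scaler0 ?mem0v // => t; rewrite noR.
rewrite rpredZ // IHm // (leq_trans _ Qm) // -tR sum_peaks_lt ?tR //.
  by move=> j /Q1/ltnW.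
move=> i iR; have i1 : (1 < i)%N by move: iR; rewrite -tR peaks_perm_word => /andP[].
have := near i iR; rewrite mem_pred ?memw ?(ltnW i1) // => /orP[/exists_inP[j jQ /eqP ij]|iQ].
  by right; exists j.
by left.
Qed.

Lemma peak_algebra_image : (2 : K) != 0 -> P = (amulr pg @: D)%VS.
Proof.
move=> two; apply/vspaceP => a; apply/idP/idP.
  apply: subvP a; apply/span_subvP => _ /imageP[Q _ ->].
  exact: peak_sum_gen.
case/memv_imgP => b bD ->; rewrite lfunE /=; move: b bD; apply: descent_ind.
- by rewrite mul0r mem0v.
- by move=> c a' b aP bP; rewrite mulrDl -scalerAl rpredD ?rpredZ.
by move=> w wn; rewrite Xi_peak_sum //; apply: rpred_sum => Q _; rewrite rpredZ ?peak_sum_mem.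
Qed.

End PeakAlgebra.

(** * Modules *)

From mathcomp Require Import generic_quotient ring_quotient boolp classical_sets.

Section ScalarModules.

Variables (K : fieldType) (F : falgType K).
Implicit Types (A : {vspace F}) (M N : premodule F) (f : F -> K).

(** A line on which [A] acts through [f]; if [f] vanishes on [A], this is the module with zero
    action. *)
Definition scalar_module A f M : Prop :=
  (exists2 v : M, v != 0 & forall x, exists c, x = c *: v) /\
  forall (a : F) (x : M), a \in A -> act a x = f a *: x.

Lemma scalar_module_irreducible A f M :
  (forall c a b, f (c *: a + b) = c * f a + f b) ->
  (forall a b, a \in A -> b \in A -> a * b \in A /\ f (a * b) = f a * f b) ->
  scalar_module A f M -> irreducible_module A M.
Proof.
move=> f_lin fM [[v v0 vM] actE]; split; last first.
- move=> U [U0 UZD _]; have [[x Ux x0]|noU] := pselect (exists2 x, U x & x != 0).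
    right; apply/seteqP; split=> // y _; have [c xE] := vM x; have [d yE] := vM y.
    have c0 : c != 0 by apply: contraNneq x0 => c0; rewrite xE c0 scale0r.
    rewrite -[y]addr0; suff -> : y = (d / c) *: x by apply: UZD.
    by rewrite xE yE scalerA divfK.
  left; apply/seteqP; split=> [x Ux|_ ->//] /=.
  by apply/eqP; apply: contraPT isT => x0 _; apply: noU; exists x.
- by exists v.
split=> [c a b x aA bA|c a x y aA|a b x aA bA].
- by rewrite !actE ?rpredD ?rpredZ // f_lin scalerDl scalerA.
- by rewrite !actE // scalerDr !scalerA mulrC.
by have [abA fab] := fM a b aA bA; rewrite !actE // fab scalerA.
Qed.

Lemma scalar_module_iso A f f' M N :
  scalar_module A f M -> scalar_module A f' N -> (forall a, a \in A -> f a = f' a) ->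
  module_iso A M N.
Proof.
move=> [[v v0 vM] actM] [[w w0 wN] actN] ff'.
(* Coordinates with respect to [v] and [w]; they are unique, hence linear, because these vectors are
   nonzero. *)
have [k kE] := choice vM; have [l lE] := choice wN.
have k_lin c x y : k (c *: x + y) = c * k x + k y.
  apply/eqP; rewrite -subr_eq0; have := congr1 id (kE (c *: x + y)).
  rewrite {1}(kE x) {1}(kE y) scalerA -scalerDl => /eqP.
  by rewrite eq_sym -subr_eq0 -scalerBl scaler_eq0 (negPf v0) orbF.
have k_scale c : k (c *: v) = c.
  have /eqP := kE (c *: v); rewrite eq_sym -subr_eq0 -scalerBl scaler_eq0 (negPf v0) orbF.
  by rewrite subr_eq0 => /eqP.
have l_scale c : l (c *: w) = c.
  have /eqP := lE (c *: w); rewrite eq_sym -subr_eq0 -scalerBl scaler_eq0 (negPf w0) orbF.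
  by rewrite subr_eq0 => /eqP.
pose h (x : M) : N := k x *: w.
have h_lin : linear h by move=> c x y; rewrite /h k_lin scalerDl scalerA.
pose hL : {linear M -> N} := HB.pack h (GRing.isLinear.Build K M N *:%R h h_lin).
exists hL; split; last by move=> a x aA; rewrite actM // actN // linearZ /= ff'.
exists (fun y => l y *: v) => [x|y] /=.
  by rewrite /h l_scale -kE.
by rewrite /h k_scale -lE.
Qed.

Lemma iso_scalar_module A f f' M N a :
  scalar_module A f M -> scalar_module A f' N -> module_iso A M N -> a \in A ->
  f a = f' a.
Proof.
move=> [[v v0 _] actM] [_ actN] [h [h_bij h_act]] aA.
have := h_act a v aA; rewrite actM // actN // linearZ /= => /eqP.
rewrite -subr_eq0 -scalerBl scaler_eq0 subr_eq0 => /orP[/eqP//|hv0].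
case/eqP: v0; apply: (bij_inj h_bij); rewrite linear0; exact/eqP.
Qed.

Lemma sub_scalar_module A B f M : (A <= B)%VS ->
  scalar_module B f M -> scalar_module A f M.
Proof. by move/subvP=> AB [vM actE]; split=> // a x /AB; apply: actE. Qed.

End ScalarModules.

Section TopModule.

Local Open Scope quotient_scope.

Variables (K : fieldType) (F : falgType K) (A : {vspace F}) (M : premodule F).

Lemma pi_top_eq (x y : M) :
  (\pi_(top_space A M) x == \pi_(top_space A M) y) = (x - y \in radical A M).
Proof. by rewrite Quotient.idealrBE. Qed.

End TopModule.

(** * The tops of the modules D_n gamma_p *)

Section Tops.

Local Open Scope quotient_scope.

Variables (K : fieldType) (charK0 : [pchar K] =i pred0).
Variables (n : nat) (g : forall m, symalg K m).
Hypothesis lie_g : lie_series g.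
Local Notation KS := (symalg K n).
Local Notation D := (descent_algebra K n).
Local Notation X q := (Xi K (word_set n q)).

Lemma descent1 : 1 \in D.
Proof. by rewrite -(Xi_one K n) Xi_descent_algebra. Qed.

Section Top.

Variable p : intpart n.
Local Notation gp := (partition_product g p).
Local Notation L := (Lambda g p).
Local Notation M := (left_ideal_module L).

Lemma intpart_notin0 : 0%N \notin parts p.
Proof. by case: p => q /= /and3P[]. Qed.

Lemma intpart_composition : parts p \in compositions n.
Proof. by rewrite mem_compositions intpart_notin0 sumn_intpart eqxx. Qed.

Let p0 := intpart_notin0.
Let pn := intpart_composition.
Let gpE : gp = ecast k (symalg K k) (sumn_intpart p) (word_product g p) := erefl.
Let c : K := (size (act_words primitive_delta p p))%:R.
Let c0 : c != 0 := size_act_words_neq0 charK0 p.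
Let Xgp : X p * gp = c *: gp := Xi_mul_product charK0 lie_g p0 gpE.
Let gp_n0 : gp != 0 := product_neq0 charK0 lie_g p0 gpE.

Lemma Xi_mul_descent_partition a : a \in D -> X p * (a * gp) = (chi p a * c) *: gp.
Proof. by move=> aD; apply: (Xi_mul_descent_product charK0 lie_g p0 gpE pn aD). Qed.

Lemma LambdaP (y : KS) : reflect (exists2 a, a \in D & y = a * gp) (y \in L).
Proof.
apply: (iffP idP) => [|[a aD ->]]; last by rewrite memv_mul ?memv_line.
have : (L <= amulr gp @: D)%VS.
  apply/prodvP => a _ aD /vlineP[k ->]; rewrite -scalerAr rpredZ //.
  by apply/memv_imgP; exists a; rewrite ?lfunE.
by move/subvP=> sub /sub /memv_imgP[a aD ->]; exists a; rewrite ?lfunE.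
Qed.

Lemma Lambda_act a y : a \in D -> y \in L -> a * y \in L.
Proof.
move=> aD /LambdaP[b bD ->]; apply/LambdaP; exists (a * b); first exact: descent_mul.
by rewrite mulrA.
Qed.

Lemma Lambda_val_act a (x : M) : a \in D -> vsval (act a x : subvs_of L) = a * vsval (x : subvs_of L).
Proof. by move=> aD; rewrite /act /= vsprojK // Lambda_act // subvsP. Qed.

Lemma Lambda_val0 : vsval ((0 : M) : subvs_of L) = 0.
Proof. exact: (linear0 (@vsval K KS L)). Qed.

Lemma Lambda_valZD k (x y : M) : vsval ((k *: x + y : M) : subvs_of L) =
  k *: vsval (x : subvs_of L) + vsval (y : subvs_of L).
Proof. exact: (linearP (@vsval K KS L)). Qed.

Lemma Lambda_valBZ k (x y : M) : vsval ((x - k *: y : M) : subvs_of L) =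
  vsval (x : subvs_of L) - k *: vsval (y : subvs_of L).
Proof. by rewrite addrC -scaleNr Lambda_valZD scaleNr addrC. Qed.

Definition Lambda_kernel : set M := fun x => X p * vsval (x : subvs_of L) = 0.

Lemma Lambda_elt (x : M) : exists2 a, a \in D & vsval (x : subvs_of L) = a * gp.
Proof. exact/LambdaP/subvsP. Qed.

Lemma Xi_act_Lambda a (x : M) : a \in D ->
  X p * (a * vsval (x : subvs_of L)) = chi p a *: (X p * vsval (x : subvs_of L)).
Proof.
move=> aD; have [b bD ->] := Lambda_elt x.
by rewrite mulrA -mulrA mulrA -!mulrA [a * _]mulrA !Xi_mul_descent_partition ?descent_mul // chiM // scalerA mulrA.
Qed.

(** If X p does not kill [y], it sends [y] to a nonzero multiple of gamma_p, which generates the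
    whole module. *)
Lemma Lambda_kernel_maximal (W : set M) : is_submodule D W ->
  (W `<=` Lambda_kernel)%classic \/ W = setT.
Proof.
move=> [W0 WZD Wact]; have [sub|/existsNP[y /not_implyP[Wy yK]]] := pselect (W `<=` Lambda_kernel)%classic.
  by left.
right; apply/seteqP; split=> // x _.
have [b bD yE] := Lambda_elt y; have [a aD xE] := Lambda_elt x.
move: yK; rewrite /Lambda_kernel yE Xi_mul_descent_partition // => /eqP.
rewrite scaler_eq0 (negPf gp_n0) orbF => bc0.
have -> : x = act ((chi p b * c)^-1 *: a) (act (X p) y).
  apply: val_inj; rewrite /= -!/(vsval _) !Lambda_val_act ?rpredZ ?Xi_descent_algebra //.
  by rewrite yE Xi_mul_descent_partition // xE -scalerAl -scalerAr scalerA mulVf ?scale1r.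
by apply: (Wact); rewrite ?rpredZ //; apply: (Wact) => //; apply: Xi_descent_algebra.
Qed.

Lemma Lambda_kernel_submodule : is_submodule D Lambda_kernel.
Proof.
split; rewrite /Lambda_kernel.
- by rewrite Lambda_val0 mulr0.
- by move=> k x y xK yK; rewrite Lambda_valZD mulrDr -scalerAr xK yK scaler0 addr0.
- by move=> a x aD xK; rewrite vsprojK ?Lambda_act ?subvsP // Xi_act_Lambda // xK scaler0.
Qed.

Let gL : M := vsproj L gp.

Lemma Lambda_val_generator : vsval (gL : subvs_of L) = gp.
Proof. by rewrite vsprojK //; apply/LambdaP; exists 1; rewrite ?descent1 ?mul1r. Qed.

Lemma Lambda_generator_notin_kernel : ~ Lambda_kernel gL.
Proof.
rewrite /Lambda_kernel Lambda_val_generator Xgp => /eqP.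
by rewrite scaler_eq0 (negPf c0) (negPf gp_n0).
Qed.

Lemma radical_LambdaE (x : M) : (x \in radical D M) <-> Lambda_kernel x.
Proof.
split=> [/radicalP/(_ Lambda_kernel)|xK].
  apply; split; first exact: Lambda_kernel_submodule.
    by move=> KT; apply: Lambda_generator_notin_kernel; rewrite KT.
  move=> W Wsub KW; have [WK|->] := Lambda_kernel_maximal Wsub; last by right.
  by left; apply/seteqP; split.
apply/radicalP => U [Usub UT Umax].
have [UK|//] := Lambda_kernel_maximal Usub.
have [<-//|KT] := Umax _ Lambda_kernel_submodule UK.
by case: Lambda_generator_notin_kernel; rewrite KT.
Qed.

Lemma Mtop_scalar : scalar_module D (chi p) (Mtop g p).
Proof.
have pi_scale k (x : M) : k *: (\pi_(top_space D M) x : Mtop g p) = \pi_(top_space D M) (k *: x).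
  by rewrite [RHS]pi_top_scale.
split.
  exists (\pi_(top_space D M) gL : Mtop g p).
    apply/eqP => gL0; apply: Lambda_generator_notin_kernel; apply/radical_LambdaE.
    rewrite -[gL]subr0 -pi_top_eq; apply/eqP; rewrite [LHS]gL0.
    by rewrite -[RHS]/(\pi_(top_space D M) (0 : M)) [RHS]raddf0.
  move=> x; rewrite -[x]reprK; set y : M := repr x; have [b bD yE] := Lambda_elt y.
  (* X p takes the same value on b gamma_p and on chi_p(b) gamma_p, so they agree modulo the
     kernel. *)
  exists (chi p b); rewrite pi_scale; apply/eqP; rewrite pi_top_eq; apply/radical_LambdaE.
  rewrite /Lambda_kernel Lambda_valBZ Lambda_val_generator yE mulrBr Xi_mul_descent_partition //.
  by rewrite -scalerAr Xgp scalerA subrr.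
move=> a x aD.
transitivity (chi p a *: (\pi_(top_space D M) (repr x : M) : Mtop g p)); last by rewrite reprK.
rewrite pi_scale -[act a x]/(\pi_(top_space D M) (act a (repr x : M))).
apply/eqP; rewrite pi_top_eq.
apply/radical_LambdaE; rewrite /Lambda_kernel.
rewrite Lambda_valBZ vsprojK ?Lambda_act ?subvsP // mulrBr Xi_act_Lambda //.
by rewrite -scalerAr subrr.
Qed.

End Top.

End Tops.

(** * Irreducible modules of the peak algebra *)

Section PeakModules.

Variables (K : fieldType) (charK0 : [pchar K] =i pred0).
Variables (n : nat) (n0 : (0 < n)%N).
Local Notation KS := (symalg K n).
Local Notation D := (descent_algebra K n).
Local Notation P := (peak_algebra K n).
Local Notation X q := (Xi K (word_set n q)).
Local Notation pg := (peak_generator K n).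

Lemma peak_memP (a : KS) : reflect (exists2 b, b \in D & a = b * pg) (a \in P).
Proof.
rewrite (peak_algebra_image n0 (natr_neq0 charK0 (isT : 0 < 2)%N)).
by apply: (iffP memv_imgP) => -[b bD ->]; exists b; rewrite ?lfunE.
Qed.

Lemma peak_sub_descent : (P <= D)%VS.
Proof.
apply/subvP => _ /peak_memP[b bD ->]; apply: descent_mul => //.
exact: valley_element_descent.
Qed.

Lemma peak_mul a b : a \in D -> b \in P -> a * b \in P.
Proof.
move=> aD /peak_memP[b' bD ->]; apply/peak_memP; exists (a * b'); rewrite ?mulrA //.
exact: descent_mul.
Qed.

Lemma chi_peak c b : c \in compositions n -> b \in D ->
  chi c (b * pg) = chi c b * \prod_(a <- c) (1 + (-1) ^+ a.-1).
Proof.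
by move=> cn bD; rewrite chiM ?valley_element_descent // chi_peak_generator.
Qed.

Lemma chi_even c a : c \in compositions n -> ~~ all odd c -> a \in P -> chi c a = 0.
Proof.
move=> cn /allPn[k kc kodd] /peak_memP[b bD ->]; rewrite chi_peak //.
apply/eqP; rewrite mulf_eq0; apply/orP; right; rewrite prodf_seq_eq0; apply/hasP.
exists k => //=; case: k kc kodd => [k0 _|k _]; last first.
  by rewrite /= negbK -signr_odd => ->; rewrite expr1 subrr.
by move: cn; rewrite mem_compositions k0.
Qed.

Lemma length_filter_chi0 k u a : u \in length_filter K n k -> a \in D ->
  (forall c, c \in compositions n -> chi c a = 0) -> u * a \in length_filter K n k.+1.
Proof.
move=> uF aD a0; move: u uF; apply: length_filter_ind.
- by rewrite mul0r mem0v.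
- by move=> c u v uF vF; rewrite mulrDl -scalerAl rpredD ?rpredZ.
move=> c cn kc; have := chi_filter cn aD; rewrite a0 // scale0r subr0.
by apply: subvP; apply: length_filterS.
Qed.

Section Classification.

Variable M : premodule KS.
Hypothesis irrM : irreducible_module P M.

Let modM : is_module P M. Proof. by case: irrM. Qed.

Lemma act_zero x : act (0 : KS) x = 0 :> M.
Proof.
have := act_linearl modM (-1) x (mem0v P) (mem0v P).
by rewrite scaler0 addr0 scaleN1r addNr.
Qed.

(** The vectors killed by the kernel of chi_c in the peak algebra form a submodule, since this
    kernel is stable under right multiplication. *)
Lemma annihilator_dichotomy c : c \in compositions n ->
  (forall x : M, forall a, a \in P -> chi c a = 0 -> act a x = 0) \/
  (forall x : M, x != 0 -> exists a, [/\ a \in P, chi c a = 0 & act a x != 0]).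
Proof.
move=> cn; pose U : set M := fun x => forall a, a \in P -> chi c a = 0 -> act a x = 0.
have subU : is_submodule P U.
  split=> [a aP _|k x y Ux Uy a aP a0|b x bP Ux a aP a0].
  - have := act_linearr modM (-1) 0 0 aP.
    by rewrite scaler0 addr0 scaleN1r addNr.
  - by rewrite (act_linearr modM) // Ux // Uy // scaler0 addr0.
  rewrite -(actM modM) //; apply: Ux; first exact: (peak_mul (subvP peak_sub_descent _ aP)).
  by rewrite chiM ?(subvP peak_sub_descent) // a0 mul0r.
have [_ _ /(_ U subU)[U0|UT]] := irrM; last first.
  by left=> x a aP a0; have Ux : U x by [rewrite UT]; apply: Ux.
right=> x x0; have : ~ U x by rewrite U0 /= => /eqP; rewrite (negPf x0).
move/existsNP=> [a /not_implyP[aP /not_implyP[a0 ax]]].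
by exists a; split=> //; apply/eqP.
Qed.

Lemma exists_character : exists2 c, c \in compositions n &
  forall (x : M) a, a \in P -> chi c a = 0 -> act a x = 0.
Proof.
apply: contrapT => noc.
have kill c : c \in compositions n ->
    forall x : M, x != 0 -> exists a, [/\ a \in P, chi c a = 0 & act a x != 0].
  by move=> cn; case: (annihilator_dichotomy cn) => // H; case: noc; exists c.
have nn : [:: n] \in compositions n.
  by rewrite mem_compositions inE /= addn0 eqxx andbT eq_sym -lt0n.
have PD := subvP peak_sub_descent.
(* Factors from the kernels of all characters, each chosen so that the vector stays nonzero,
   multiply to one element lying in all kernels. *)
have kill_all (l : seq (seq nat)) : {subset l <= compositions n} -> forall x : M, x != 0 ->
    exists a, [/\ a \in P, {in l, forall c, chi c a = 0} & act a x != 0].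
  elim: l => [|c l IHl] sub x x0; first by have [a [aP _ ax]] := kill _ nn x x0; exists a.
  have [d dl|a [aP a0 ax]] := IHl _ x x0; first by apply: sub; rewrite inE dl orbT.
  have cn : c \in compositions n by apply: sub; apply: mem_head.
  have [b [bP b0 bax]] := kill c cn _ ax; exists (b * a); split.
  - by apply: peak_mul; rewrite ?PD.
  - move=> d dl; rewrite chiM ?PD ?sub //; move: dl; rewrite inE => /predU1P[->|dl].
      by rewrite b0 mul0r.
    by rewrite a0 ?mulr0.
  - by rewrite (actM modM).
(* Each further factor lying in all kernels raises the length by one; beyond [n] the filtration is
   zero, while the vector is still nonzero. *)
have kill_length k : forall x : M, x != 0 ->
    exists a, [/\ a \in P, forall b, b \in D -> b * a \in length_filter K n k & act a x != 0].
  elim: k => [|k IHk] x x0.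
    have [a [aP _ ax]] := kill _ nn x x0; exists a; split=> // b bD.
    by rewrite length_filter0; apply: descent_mul bD (PD _ aP).
  have [j [jP j0 jx]] := @kill_all (compositions n) (fun _ => id) x x0.
  have [a [aP aF ajx]] := IHk _ jx; exists (a * j); split.
  - by apply: peak_mul; rewrite ?PD.
  - by move=> b bD; rewrite mulrA; apply: length_filter_chi0 (aF b bD) (PD _ jP) j0.
  - by rewrite (actM modM).
have [_ [x x0] _] := irrM; have [a [aP aF]] := kill_length n.+1 x x0.
have := aF 1 (descent1 K n); rewrite mul1r length_filter_eq0 // memv0 => /eqP->.
by rewrite act_zero eqxx.
Qed.

Lemma scalar_action : (exists2 c, c \in compositions n & ~~ all odd c) ->
  exists2 c, c \in compositions n &
  forall (a : KS) (x : M), a \in P -> act a x = chi c a *: x.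
Proof.
case=> e en e_even; have [c cn killc] := exists_character.
(* The zero action is represented by a composition with an even part, whose character vanishes on
   the peak algebra. *)
have [zero|] := pselect (forall a (x : M), a \in P -> act a x = 0).
  by exists e => // a x aP; rewrite zero // chi_even // scale0r.
case/existsNP=> w /existsNP[z /not_implyP[wP /eqP wz]]; exists c => // a x aP.
have PD := subvP peak_sub_descent.
have [chi0|] := pselect (forall b, b \in P -> chi c b = 0).
  by rewrite killc ?chi0 // scale0r.
case/existsNP=> b /not_implyP[bP /eqP b0].
have chi_0 : chi c (0 : KS) = 0.
  by have := chiZD c (-1) (0 : KS) 0; rewrite scaler0 addr0 mulN1r addNr.
have chiZ k (d : KS) : chi c (k *: d) = k * chi c d.
  by rewrite -[k *: d]addr0 chiZD chi_0 addr0.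
(* [u] will replace the missing identity: [d] minus chi_c(d) [u] lies in the kernel of chi_c, hence
   acts by zero. *)
pose u := (chi c b)^-1 *: b; have uP : u \in P by rewrite rpredZ.
have u1 : chi c u = 1 by rewrite chiZ mulVf.
have actE d (y : M) : d \in P -> act d y = chi c d *: act u y.
  move=> dP; have := killc y (- chi c d *: u + d).
  rewrite (act_linearl modM) // chiZD u1 mulr1 addNr rpredD ?rpredZ // => /(_ isT erefl).
  by rewrite scaleNr => /eqP; rewrite addrC subr_eq0 => /eqP.
rewrite actE //; congr (_ *: _).
(* This submodule is not everything, hence zero. It contains [act u x - x], because [u * u] and [u]
   have the same character and so act alike. *)
pose U : set M := fun y => act u y = 0.
have subU : is_submodule P U.
  split=> [|k y y' Uy Uz|d' y dP' Uy]; rewrite /U.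
  - by have := act_linearr modM (-1) 0 0 uP; rewrite scaler0 addr0 scaleN1r addNr.
  - by rewrite (act_linearr modM) // Uy Uz scaler0 addr0.
  - rewrite (actE _ _ dP') Uy scaler0; have := act_linearr modM (-1) 0 0 uP.
    by rewrite scaler0 addr0 scaleN1r addNr.
have [_ _ /(_ U subU)[U0|UT]] := irrM; last first.
  have Uz : U z by rewrite UT.
  by rewrite actE // Uz scaler0 eqxx in wz.
have : U (act u x - x).
  rewrite /U -scaleN1r addrC (act_linearr modM) // -(actM modM) // (actE (u * u)) ?peak_mul ?PD //.
  by rewrite chiM ?PD // u1 mulr1 scale1r scaleN1r addNr.
by rewrite U0 => /eqP; rewrite subr_eq0 => /eqP.
Qed.

Lemma irreducible_scalar : (exists2 c, c \in compositions n & ~~ all odd c) ->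
  exists2 c, c \in compositions n & scalar_module P (chi c) M.
Proof.
move=> even_c; have [c cn actE] := scalar_action even_c; exists c => //; split=> //.
have [_ [x x0] irr] := irrM; exists x => // y.
pose U : set M := fun z => exists k, z = k *: x.
have subU : is_submodule P U.
  split=> [|k _ _ [l ->] [m ->]|a _ aP [l ->]].
  - by exists 0; rewrite scale0r.
  - by exists (k * l + m); rewrite scalerDl scalerA.
  - by exists (chi c a * l); rewrite actE // scalerA.
have [U0|UT] := irr U subU; last by have Uy : U y by [rewrite UT]; apply: Uy.
have : U x by exists 1; rewrite scale1r.
by rewrite U0 => /= /eqP; rewrite (negPf x0).
Qed.

End Classification.

End PeakModules.

Lemma sort_intpart n c : c \in compositions n -> is_intpart n (sort geq c).
Proof.
rewrite mem_compositions => /andP[c0 cn]; apply/and3P; split.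
- by apply: sort_sorted => x y; apply: leq_total.
- by rewrite mem_sort.
- by rewrite (perm_sumn (permEl (perm_sort _ _))).
Qed.

(** * The characters chi_p on the peak algebra *)

Section Characters.

Variables (K : fieldType) (charK0 : [pchar K] =i pred0).
Variables (n : nat) (n0 : (0 < n)%N) (g : forall m, symalg K m).
Hypothesis lie_g : lie_series g.
Local Notation P := (peak_algebra K n).
Local Notation X q := (Xi K (word_set n q)).
Local Notation pg := (peak_generator K n).

Lemma Mtop_peak (p : intpart n) : scalar_module P (chi p) (Mtop g p).
Proof. exact: sub_scalar_module (peak_sub_descent charK0 n0) (Mtop_scalar charK0 lie_g p). Qed.

Lemma Mtop_irreducible (p : intpart n) : irreducible_module P (Mtop g p).
Proof.
apply: scalar_module_irreducible (Mtop_peak p) => [c a b|a b aP bP]; first exact: chiZD.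
have PD := subvP (peak_sub_descent charK0 n0).
split; first exact: peak_mul (PD _ aP) bP.
by rewrite chiM ?PD ?intpart_composition.
Qed.

Lemma chi_Xi_neq0 (p : intpart n) : chi p (X p) != 0 :> K.
Proof.
have gpE : partition_product g p =
  ecast k (symalg K k) (sumn_intpart p) (word_product g p) by [].
have := Xi_mul_descent_product charK0 lie_g (intpart_notin0 p) gpE (intpart_composition p)
  (Xi_descent_algebra K (word_set n p)).
have Xgp := Xi_mul_product charK0 lie_g (intpart_notin0 p) gpE.
rewrite Xgp -scalerAr Xgp scalerA => /eqP; rewrite -subr_eq0 -scalerBl scaler_eq0.
rewrite (negPf (product_neq0 charK0 lie_g (intpart_notin0 p) gpE)) orbF.
rewrite subr_eq0 => /eqP/(mulIf (size_act_words_neq0 charK0 p)) <-.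
exact: size_act_words_neq0.
Qed.

Lemma chi_peak_neq0 (p : intpart n) : odd_intpart p -> chi p (X p * pg) != 0 :> K.
Proof.
move=> p_odd; rewrite chi_peak ?intpart_composition ?Xi_descent_algebra // mulf_neq0 ?chi_Xi_neq0 //.
rewrite prodf_seq_neq0; apply/allP => a ap /=.
have := allP p_odd a ap; case: a ap => // a _ /= a_even.
by rewrite -signr_odd (negPf a_even) expr0 -mulr2n natr_neq0.
Qed.

Lemma Xi_peak_mem (q : seq nat) : X q * pg \in P.
Proof.
by apply/(peak_memP charK0 n0); exists (X q) => //; apply: Xi_descent_algebra.
Qed.

Lemma chi_Xi_product (p q : intpart n) : chi q (X p) != 0 :> K ->
  X p * partition_product g q != 0.
Proof.
have gqE : partition_product g q =
  ecast k (symalg K k) (sumn_intpart q) (word_product g q) by [].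
apply: contraNneq => Xpq0.
have := Xi_mul_descent_product charK0 lie_g (intpart_notin0 q) gqE (intpart_composition q)
  (Xi_descent_algebra K (word_set n p)).
rewrite Xpq0 mulr0 => /esym/eqP; rewrite scaler_eq0 (negPf (product_neq0 charK0 lie_g (intpart_notin0 q) gqE)).
by rewrite orbF mulf_eq0 (negPf (size_act_words_neq0 charK0 q)) orbF => /eqP->.
Qed.

(** Equality at X p times the generator shows that X p does not kill gamma_q, so [p] is not longer
    than [q]. By symmetry the lengths agree; then [p] is a rearrangement of [q], and both are
    sorted. *)
Lemma chi_peak_inj (p q : intpart n) : odd_intpart p -> odd_intpart q ->
  {in P, chi p =1 (chi q : symalg K n -> K)} -> p = q.
Proof.
move=> p_odd q_odd pq.
have size_le (r s : intpart n) : odd_intpart r ->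
    {in P, chi r =1 (chi s : symalg K n -> K)} ->
    (X r * partition_product g s != 0) /\ (size r <= size s)%N.
  move=> r_odd rs; have rs_neq0 : X r * partition_product g s != 0.
    apply: chi_Xi_product; have := chi_peak_neq0 r_odd.
    rewrite rs ?Xi_peak_mem // chi_peak ?intpart_composition ?Xi_descent_algebra //.
    by rewrite mulf_eq0 negb_or => /andP[].
  split=> //; rewrite leqNgt; apply: contra rs_neq0 => sr.
  by rewrite (Xi_mul_product_eq0 charK0 lie_g (intpart_notin0 s) (erefl (partition_product g s))) ?intpart_composition.
have [Xpq pq_le] := size_le p q p_odd pq.
have [_ qp_le] := size_le q p q_odd (fun a aP => esym (pq a aP)).
have sz : size p = size q by apply/eqP; rewrite eqn_leq pq_le qp_le.
have perm_pq := Xi_mul_product_perm charK0 lie_g (intpart_notin0 q) (erefl (partition_product g q))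
  (intpart_composition p) sz Xpq.
apply: val_inj; apply: (sorted_eq (leT := geq)) perm_pq.
- by move=> y x z xy yz; apply: leq_trans yz xy.
- by move=> x y; rewrite andbC => /anti_leq.
- by have /and3P[] := partsP p.
- by have /and3P[] := partsP q.
Qed.

End Characters.

Theorem corollary10p4 (K : fieldType) (charK0 : [pchar K] =i pred0)
    (n : nat) (n_gt1 : (1 < n)%N)
    (gamma : forall m : nat, symalg K m)
    (gamma_lie : lie_series gamma)
    (gamma_odd : forall m : nat, odd m -> gamma m \in peak_algebra K m) :
  let P := peak_algebra K n in
  let M := fun p : intpart n => Mtop gamma p in
  let M0 := M (intpart21 n_gt1) in
  [/\ [/\ (forall p : intpart n, odd_intpart p -> irreducible_module P (M p)),
          irreducible_module P M0,
          (forall p q : intpart n, odd_intpart p -> odd_intpart q ->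
             module_iso P (M p) (M q) -> p = q),
          (forall p : intpart n, odd_intpart p -> ~ module_iso P (M p) M0)
        & (forall X : premodule (symalg K n), irreducible_module P X ->
             (exists p : intpart n, odd_intpart p /\ module_iso P X (M p))
             \/ module_iso P X M0)]
    & (forall q : intpart n, ~~ odd_intpart q -> module_iso P M0 (M q))].
Proof.
move=> P M M0; have n_gt0 := ltnW n_gt1.
pose chiE := Mtop_peak charK0 n_gt0 gamma_lie.
have p0_even : ~~ odd_intpart (intpart21 n_gt1) by [].
have chi0 (q : intpart n) a : ~~ odd_intpart q -> a \in P -> chi q a = 0.
  by move=> q_even aP; apply: chi_even aP; rewrite ?intpart_composition.
split; first split.
- by move=> p _; apply: Mtop_irreducible.
- exact: Mtop_irreducible.
- move=> p q p_odd q_odd iso_pq; apply: (chi_peak_inj charK0 n_gt0 gamma_lie) => // a aP.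
  exact: iso_scalar_module (chiE p) (chiE q) iso_pq aP.
- move=> p p_odd iso_p0; have := chi_peak_neq0 charK0 n_gt0 gamma_lie p_odd.
  have pP := Xi_peak_mem charK0 n_gt0 p.
  by rewrite (iso_scalar_module (chiE p) (chiE _) iso_p0 pP) chi0 ?eqxx.
- move=> X irrX.
  have [|c cn cX] := irreducible_scalar charK0 n_gt0 irrX.
    by exists (parts (intpart21 n_gt1)); rewrite ?intpart_composition.
  (* The character belongs to a composition; by [chi_perm] sorting it into a partition leaves the
     character unchanged. *)
  pose p := IntPart (sort_intpart cn).
  have cp a : a \in P -> chi c a = chi p a.
    move=> aP; apply: (chi_perm charK0 gamma_lie); rewrite ?intpart_composition //.
      by rewrite perm_sym perm_sort.
    exact: subvP (peak_sub_descent charK0 n_gt0) _ aP.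
  have [p_odd|p_even] := boolP (odd_intpart p).
    by left; exists p; split=> //; apply: scalar_module_iso cX (chiE p) cp.
  right; apply: scalar_module_iso cX (chiE _) _ => a aP.
  by rewrite cp // !chi0.
- move=> q q_even; apply: scalar_module_iso (chiE _) (chiE q) _ => a aP.
  by rewrite !chi0.
Qed.
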